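(* Let $w\in \mathbf{S}_n^{312}$ be a $312$-avoiding permutation and let $\pi$ be the Dyck path of size $n$ corresponding to $w$ under the Bandlow--Killpatrick bijection. Then $X_{w}$ is a spherical Schubert variety if and only if $\pi$ is a spherical Dyck path.
   Context: Schubert varieties: $G=\mathbf{GL}(n,\mathbb{C})$, $B$ the upper triangular Borel subgroup, $T$ the diagonal torus; $\mathbf{S}_n$ is identified with the permutation matrices ($we_i=e_{w(i)}$) and $X_w=\overline{BwB/B}\subseteq G/B$. Let $L$ be the standard Levi subgroup (containing $T$) of the stabilizer of $X_w$ in $G$ and $B_L$ a Borel subgroup of $L$ containing $T$; $X_w$ is spherical if $B_L$ has finitely many orbits in $X_w$ (equivalently, an open orbit). In one-line notation $w=w_1\cdots w_n$, $w_i=w(i)$; $w$ is $312$-avoiding if there are no $i<j<k$ with $w_j<w_k<w_i$. Dyck paths: a Dyck path of size $n$ is a lattice path from $(0,0)$ to $(n,n)$ with unit North steps $N=(0,1)$ and unit East steps $E=(1,0)$ staying weakly above the main diagonal $y=x$; it is identified with its word in $N,E$. Bandlow--Killpatrick bijection: given a Dyck path $\pi$ of size $n$, consider the full unit squares lying between $\pi$ and the main diagonal; put the simple transposition $s_j=(j,\,j+1)$ in each such square lying in column $j$ (between $x=j-1$ and $x=j$), so that the first full square to the left of the diagonal in row $i$ gets $s_{i-1}$ and indices decrease by one going left. Read the entries row by row, from the top row to the bottom row, and left to right inside each row, to get a word $s_{j_1}s_{j_2}\cdots s_{j_\ell}$. The permutation $w=\phi(\pi)$ is obtained by evaluating this word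 from left to right: $w(k)$ is the result of applying first $s_{j_1}$ to $k$, then $s_{j_2}$, and so on. The map $\phi$ is a bijection from Dyck paths of size $n$ onto $\mathbf{S}_n^{312}$; the path corresponding to $w$ is $\phi^{-1}(w)$. For example $NNEENNNNEEENNEEE$ corresponds to $w=21654873$. Spherical Dyck paths: the $r$-th diagonal is the line $y-x-r=0$; $\pi^{(r)}$ is the part of $\pi$ lying weakly above the $r$-th diagonal. A connected component of $\pi^{(r)}$ is a subpath of $\pi^{(r)}$ that starts and ends on the $r$-th diagonal and touches the $r$-th diagonal exactly twice; the connected components of $\pi$ are those of $\pi^{(0)}=\pi$. A path with word $N^mE^m$ ($m\ge1$) is an elbow. A path with word $N^{m-1}E^{a}NE^{b}$ with $a\ge 1$, $b\ge 2$, $a+b=m$ is a ledge. (These notions apply to subpaths up to translation.) The path $\pi$ is a spherical Dyck path if for every connected component $\tau$ of $\pi$, say starting at $(c,c)$, one of the following holds: (i) $\tau$ is an elbow or a ledge; or (ii) every connected component of the part of $\tau$ lying weakly above the line $y-x-1=0$ is either an elbow, or a ledge that extends to the main diagonal, i.e. a ledge which is the first of these components, starting at $(c,c+1)$ directly after the initial North step of $\tau$. *)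

(* Defs.v *)
From HB Require Import structures.
From mathcomp Require Import all_boot all_order all_fingroup all_algebra.
From mathcomp Require Import classical_sets cardinality reals complex.
From mathcomp Require mpoly.

Set Implicit Arguments.
Unset Strict Implicit.
Unset Printing Implicit Defensive.

Import GRing.Theory.
Local Open Scope classical_set_scope.
Local Open Scope ring_scope.

(** * Linear algebraic groups inside GL_n, as sets of matrices *)

Definition GL {F : closedFieldType} {n : nat} : set 'M[F]_n :=
  [set g | g \in unitmx].

(* A polynomial function on 'M_n is a polynomial in the n * n entries.
   Allowing 1/det as well, as in the coordinate ring of GL_n, would not change
   the closed subsets of GL_n. *)
Definition zariski_closed {F : closedFieldType} {n : nat} (A : set 'M[F]_n) :
    Prop :=
  exists I : set (mpoly.mpoly (n * n) F),
    A = [set g | GL g /\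
                 forall p, I p -> mpoly.meval (fun k => mxvec g 0 k) p = 0].

Definition zariski_connected {F : closedFieldType} {n : nat}
    (A : set 'M[F]_n) : Prop :=
  forall Z1 Z2 : set 'M[F]_n, zariski_closed Z1 -> zariski_closed Z2 ->
    A `<=` Z1 `|` Z2 -> A `&` Z1 `&` Z2 = set0 -> A `<=` Z1 \/ A `<=` Z2.

Definition subgroup {F : closedFieldType} {n : nat} (H : set 'M[F]_n) : Prop :=
  [/\ H `<=` GL, H 1%:M,
      forall g h, H g -> H h -> H (g *m h) &
      forall g, H g -> H (invmx g)].

Definition closed_connected_subgroup {F : closedFieldType} {n : nat}
    (H K : set 'M[F]_n) : Prop :=
  [/\ subgroup H, zariski_closed H, zariski_connected H & H `<=` K].

Definition normal_in {F : closedFieldType} {n : nat} (H K : set 'M[F]_n) :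
    Prop :=
  forall g h, K g -> H h -> H (g *m h *m invmx g).

Definition unipotent {F : closedFieldType} {n : nat} (H : set 'M[F]_n) : Prop :=
  forall g, H g -> exists k : nat, (g - 1%:M) ^+ k = 0.

Definition commutator_subgroup {F : closedFieldType} {n : nat}
    (H : set 'M[F]_n) : set 'M[F]_n :=
  [set x | forall K : set 'M[F]_n, subgroup K ->
     (forall g h, H g -> H h -> K (g *m h *m invmx g *m invmx h)) -> K x].

Definition solvable_subgroup {F : closedFieldType} {n : nat}
    (H : set 'M[F]_n) : Prop :=
  exists k : nat, iter k commutator_subgroup H = [set 1%:M].

Definition is_unipotent_radical {F : closedFieldType} {n : nat}
    (P U : set 'M[F]_n) : Prop :=
  [/\ closed_connected_subgroup U P, normal_in U P, unipotent U &
      forall V, closed_connected_subgroup V P -> normal_in V P ->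
        unipotent V -> V `<=` U].

(* P is the semidirect product of L and its unipotent radical. *)
Definition is_levi_subgroup {F : closedFieldType} {n : nat}
    (P L : set 'M[F]_n) : Prop :=
  closed_connected_subgroup L P /\
  exists U, [/\ is_unipotent_radical P U, L `&` U = [set 1%:M] &
                forall g, P g -> exists l u, [/\ L l, U u & g = l *m u]].

(* A maximal closed connected solvable subgroup. *)
Definition is_borel_subgroup {F : closedFieldType} {n : nat}
    (G B : set 'M[F]_n) : Prop :=
  [/\ closed_connected_subgroup B G, solvable_subgroup B &
      forall H, closed_connected_subgroup H G -> solvable_subgroup H ->
        B `<=` H -> H = B].

(** * Schubert varieties *)

(* is_trig_mx means lower triangular. *)
Definition upper_borel {F : closedFieldType} {n : nat} : set 'M[F]_n :=
  [set g | GL g /\ is_trig_mx g^T].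

Definition diagonal_torus {F : closedFieldType} {n : nat} : set 'M[F]_n :=
  [set g | GL g /\ is_diag_mx g].

Definition translate {F : closedFieldType} {n : nat}
    (g : 'M[F]_n) (x : set 'M[F]_n) : set 'M[F]_n := [set g *m h | h in x].

Definition flag_variety {F : closedFieldType} {n : nat} : set (set 'M[F]_n) :=
  [set translate g upper_borel | g in GL].

(* Quotient topology on G/B: the union of the cosets in Z is the preimage of Z
   under G -> G/B. *)
Definition flag_closed {F : closedFieldType} {n : nat}
    (Z : set (set 'M[F]_n)) : Prop :=
  Z `<=` flag_variety /\ zariski_closed (\bigcup_(x in Z) x).

Definition flag_closure {F : closedFieldType} {n : nat}
    (S : set (set 'M[F]_n)) : set (set 'M[F]_n) :=
  \bigcap_(Z in [set Z | flag_closed Z /\ S `<=` Z]) Z.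

(* w e_j = e_(w j); perm_mx w is the transpose of this matrix. *)
Definition permutation_matrix {F : closedFieldType} {n : nat} (w : 'S_n) :
    'M[F]_n :=
  \matrix_(i, j) (i == w j)%:R.

Definition schubert_variety {F : closedFieldType} {n : nat} (w : 'S_n) :
    set (set 'M[F]_n) :=
  flag_closure [set translate (b *m permutation_matrix w) upper_borel
                   | b in upper_borel].

Definition stabilizer {F : closedFieldType} {n : nat}
    (X : set (set 'M[F]_n)) : set 'M[F]_n :=
  [set g | GL g /\ [set translate g x | x in X] = X].

Definition orbit_of {F : closedFieldType} {n : nat}
    (H : set 'M[F]_n) (x : set 'M[F]_n) : set (set 'M[F]_n) :=
  [set translate h x | h in H].

Definition finitely_many_orbits {F : closedFieldType} {n : nat}
    (H : set 'M[F]_n) (X : set (set 'M[F]_n)) : Prop :=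
  finite_set [set orbit_of H x | x in X].

Definition avoids_312 {n : nat} (w : 'S_n) : Prop :=
  forall i j k : 'I_n, (i < j)%N -> (j < k)%N -> ~ (w j < w k < w i)%N.

(** * Dyck paths *)

(* A lattice path is the word of its steps: [true] is North, [false] is East. *)
Definition path_word := seq bool.
Definition North : bool := true.
Definition East : bool := false.

(* The coordinates of the lattice point reached after k steps. *)
Definition xcoord (p : path_word) (k : nat) : nat := count_mem East (take k p).
Definition ycoord (p : path_word) (k : nat) : nat := count_mem North (take k p).

Definition is_dyck_path (n : nat) (p : path_word) : Prop :=
  [/\ count_mem North p = n, count_mem East p = n &
      forall k, (k <= size p)%N -> (xcoord p k <= ycoord p k)%N].

(* Rows and columns are counted from 0. The square [j, j+1] x [i, i+1] lies
   below p when the East step from x = j to x = j+1 has height at least i+1;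
   it is a full square above the main diagonal when j < i. *)
Definition square_below (p : path_word) (i j : nat) : bool :=
  [exists k : 'I_(size p),
    [&& nth North p k == East, xcoord p k == j & (i < ycoord p k)%N]].

(* [ordS j] is j+1 here: since j < i, the cyclic successor does not wrap around.
   In 'S_n the leftmost factor of a product is applied first. *)
Definition bandlow_killpatrick (n : nat) (p : path_word) : 'S_n :=
  (\prod_(i <- rev (enum 'I_n))
     \prod_(j <- enum 'I_n | (j < i)%N && square_below p i j)
        tperm j (ordS j))%g.

(* The subpath of p between its points number a and b is a connected component
   of the part of p weakly above y - x - r = 0. *)
Definition is_component (r : nat) (p : path_word) (a b : nat) : Prop :=
  [/\ (a < b <= size p)%N, ycoord p a = (xcoord p a + r)%N,
      ycoord p b = (xcoord p b + r)%N &
      forall k, (a < k < b)%N -> (xcoord p k + r < ycoord p k)%N].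

Definition subpath (p : path_word) (a b : nat) : path_word := drop a (take b p).

Definition is_elbow (p : path_word) : Prop :=
  exists m : nat, (1 <= m)%N /\ p = nseq m North ++ nseq m East.

Definition is_ledge (p : path_word) : Prop :=
  exists m a b : nat,
    [/\ (1 <= a)%N, (2 <= b)%N, (a + b = m)%N &
        p = nseq m.-1 North ++ nseq a East ++ North :: nseq b East].

(* t is a translate to the origin of a component of the path; its components
   above y - x - 1 = 0 that may be ledges are those starting at (0, 1), that is,
   after exactly one step. *)
Definition is_spherical_dyck_path (p : path_word) : Prop :=
  forall a b, is_component 0 p a b ->
    let t := subpath p a b in
    (is_elbow t \/ is_ledge t) \/
    (forall c d, is_component 1 t c d ->
       is_elbow (subpath t c d) \/ (is_ledge (subpath t c d) /\ c = 1%N)).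

(* Main.v *)
(** Write [m_j] for the height of the [j]-th East step.  A permutation avoiding 312 is
    determined by its prefix maxima, which for the Bandlow-Killpatrick permutation are
    the [m_j]; hence [X_w] consists of the flags [F] with [F_j] contained in [E_(m_j)],
    that is, of the classes of the invertible matrices supported under a staircase.  Its
    stabilizer is the block upper triangular group whose blocks are cut out by the peaks
    of the path, the Levi subgroup containing the torus is the block diagonal group, and
    by Lie-Kolchin a Borel subgroup of the latter containing the torus consists of the
    block diagonal matrices that are upper triangular for some ordering of each block.

    The path fails to be spherical exactly when some valley at distance at least 2 from
    the diagonal is followed by two North steps or preceded, inside its component, by
    another valley.  Such a valley yields four coordinates among which the group links at
    most two disjoint pairs, and a one-parameter family of flags in pairwise distinct
    orbits.  Otherwise the staircase is built peak by peak, each step being the problem of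
    classifying full flags of a space of dimension [1 + r] under the product of [GL_1] and
    the upper triangular subgroup of [GL_r]; a Bruhat decomposition followed by a
    rescaling brings every matrix to one with entries 0 and 1, so the number of orbits is
    finite. *)
Require Import Defs.
From mathcomp Require Import all_boot all_order all_fingroup all_algebra.
From mathcomp Require Import classical_sets cardinality boolp reals complex.
From mathcomp Require Import zify ring spectral.
From mathcomp Require Import mpoly.

Set Implicit Arguments.
Unset Strict Implicit.
Unset Printing Implicit Defensive.

Import Order.TTheory GRing.Theory Num.Theory.
Local Open Scope classical_set_scope.
Local Open Scope ring_scope.

(** * Zariski-closed and connected sets of matrices *)

(** Both directions pass through the numerical condition [obstruction n m], so the geometry sees
    only the heights [m]. One obstacle is that the Levi and Borel subgroups are known only by
    abstract properties. Three elementary tools pin them down: a unipotent matrix of size [n] has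
    trace [n]; a quantity with finitely many values and closed level sets is constant on a connected
    group; finitely many polynomials, each nonzero somewhere on a line, are all nonzero at a common
    point of it. The last tool gives connectedness and density without dimension theory. The four
    coordinates of an obstruction come from a dimension count. If two North steps follow the valley,
    all full flags of a 4-space occur, in dimension 6, while the torus modulo scalars and at most
    two root subgroups have dimension at most 5. If an earlier valley is used, the line of the flag
    is confined to a 3-space, which leaves dimension 5, and at most one root subgroup survives, for
    dimension at most 4. *)

Definition polynomial_fun {F : closedFieldType} {n : nat} (f : 'M[F]_n -> F) :=
  exists p : mpoly.mpoly (n * n) F,
    forall g, f g = mpoly.meval (fun k => mxvec g 0 k) p.

Section Polynomial.
Context {F : numClosedFieldType} {n : nat}.
Implicit Types (f : 'M[F]_n -> F) (A : set 'M[F]_n).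

Lemma polynomial_fun_ext f f' : f =1 f' -> polynomial_fun f -> polynomial_fun f'.
Proof. by move=> ff' [p fp]; exists p => g; rewrite -ff' fp. Qed.

Lemma polynomial_cst (c : F) : polynomial_fun (fun _ : 'M[F]_n => c).
Proof. by exists (mpoly.mpolyC _ c) => g; rewrite mpoly.mevalC. Qed.

Lemma polynomial_entry i j : polynomial_fun (fun g : 'M[F]_n => g i j).
Proof.
exists (mpoly.mpolyX F (mpoly.mnm1 (mxvec_index i j))) => g.
by rewrite mpoly.mevalXU mxvecE.
Qed.

Lemma polynomial_add f f' : polynomial_fun f -> polynomial_fun f' ->
  polynomial_fun (fun g => f g + f' g).
Proof.
by move=> [p fp] [q fq]; exists (p + q) => g; rewrite mpoly.mevalD fp fq.
Qed.

Lemma polynomial_mul f f' : polynomial_fun f -> polynomial_fun f' ->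
  polynomial_fun (fun g => f g * f' g).
Proof.
by move=> [p fp] [q fq]; exists (p * q) => g; rewrite mpoly.mevalM fp fq.
Qed.

Lemma polynomial_sum (I : Type) (r : seq I) (P : pred I) (f : I -> 'M[F]_n -> F) :
  (forall i, polynomial_fun (f i)) ->
  polynomial_fun (fun g => \sum_(i <- r | P i) f i g).
Proof.
move=> fP; elim: r => [|i r IH].
  by apply: polynomial_fun_ext (polynomial_cst 0) => g; rewrite big_nil.
apply: (@polynomial_fun_ext
  (fun g => (P i)%:R * f i g + \sum_(i <- r | P i) f i g)).
  by move=> g; rewrite big_cons; case: (P i); rewrite ?mul1r ?mul0r ?add0r.
by apply: polynomial_add => //; apply: polynomial_mul => //; apply: polynomial_cst.
Qed.

Lemma polynomial_prod (I : Type) (r : seq I) (f : I -> 'M[F]_n -> F) :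
  (forall i, polynomial_fun (f i)) ->
  polynomial_fun (fun g => \prod_(i <- r) f i g).
Proof.
move=> fP; elim: r => [|i r IH].
  by apply: polynomial_fun_ext (polynomial_cst 1) => g; rewrite big_nil.
apply: (@polynomial_fun_ext (fun g => f i g * \prod_(i <- r) f i g)).
  by move=> g; rewrite big_cons.
exact: polynomial_mul.
Qed.

Lemma polynomial_det m (X : 'M[F]_n -> 'M[F]_m) :
  (forall i j, polynomial_fun (fun g => X g i j)) ->
  polynomial_fun (fun g => \det (X g)).
Proof.
move=> XP; apply: polynomial_sum => s; apply: polynomial_mul.
  exact: polynomial_cst.
by apply: polynomial_prod => i.
Qed.

Definition polynomial_mx m k (X : 'M[F]_n -> 'M[F]_(m, k)) :=
  forall i j, polynomial_fun (fun g => X g i j).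

Lemma polynomial_mx_cst m k (C : 'M[F]_(m, k)) : polynomial_mx (fun _ => C).
Proof. by move=> i j; apply: polynomial_cst. Qed.

Lemma polynomial_mx_id : polynomial_mx (fun g : 'M[F]_n => g).
Proof. by move=> i j; apply: polynomial_entry. Qed.

Lemma polynomial_mx_mul m k l (X : 'M[F]_n -> 'M[F]_(m, k))
    (Y : 'M[F]_n -> 'M[F]_(k, l)) :
  polynomial_mx X -> polynomial_mx Y -> polynomial_mx (fun g => X g *m Y g).
Proof.
move=> XP YP i j; apply: polynomial_fun_ext.
  by move=> g; rewrite mxE; reflexivity.
by apply: polynomial_sum => a; apply: polynomial_mul.
Qed.

Lemma polynomial_mx_sub m k (X Y : 'M[F]_n -> 'M[F]_(m, k)) :
  polynomial_mx X -> polynomial_mx Y -> polynomial_mx (fun g => X g - Y g).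
Proof.
move=> XP YP i j; apply: (@polynomial_fun_ext (fun g => X g i j + -1 * Y g i j)).
  by move=> g; rewrite !mxE mulN1r.
apply: polynomial_add => //; apply: polynomial_mul => //; exact: polynomial_cst.
Qed.

Lemma polynomial_mx_scale m k (c : F) (X : 'M[F]_n -> 'M[F]_(m, k)) :
  polynomial_mx X -> polynomial_mx (fun g => c *: X g).
Proof.
move=> XP i j; apply: (@polynomial_fun_ext (fun g => c * X g i j)).
  by move=> g; rewrite !mxE.
by apply: polynomial_mul => //; apply: polynomial_cst.
Qed.

(** Stands in for the inverse, which is not polynomial: [h *m x *m \adj h] is the conjugate of [x]
    multiplied by [\det h], and homogeneous equations do not see this factor. *)
Lemma polynomial_mx_adj (X : 'M[F]_n -> 'M[F]_n) :
  polynomial_mx X -> polynomial_mx (fun g => \adj (X g)).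
Proof.
move=> XP i j; apply: (@polynomial_fun_ext (fun g => cofactor (X g) j i)).
  by move=> g; rewrite mxE.
rewrite /cofactor; apply: polynomial_mul; first exact: polynomial_cst.
apply: polynomial_det => a b.
apply: (@polynomial_fun_ext (fun g => X g (lift j a) (lift i b))) => // g.
by rewrite !mxE.
Qed.

Lemma polynomial_mx_linear m k m' k' (r : {linear 'M[F]_(m, k) -> 'M[F]_(m', k')})
    (X : 'M[F]_n -> 'M[F]_(m, k)) :
  polynomial_mx X -> polynomial_mx (fun g => r (X g)).
Proof.
move=> XP i j.
apply: (@polynomial_fun_ext (fun g => \sum_a \sum_b X g a b * r (delta_mx a b) i j)).
  move=> g; rewrite {2}[X g]matrix_sum_delta linear_sum summxE.
  apply: eq_bigr => a _; rewrite linear_sum summxE; apply: eq_bigr => b _.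
  by rewrite linearZ mxE.
apply: polynomial_sum => a; apply: polynomial_sum => b.
by apply: polynomial_mul => //; apply: polynomial_cst.
Qed.

Lemma closed_polynomial (I : Type) (f : I -> 'M[F]_n -> F) :
  (forall i, polynomial_fun (f i)) ->
  zariski_closed [set g | GL g /\ forall i, f i g = 0].
Proof.
move=> fP; exists [set p | exists i, forall g, f i g = mpoly.meval (fun k => mxvec g 0 k) p].
apply/seteqP; split => g /= [Gg fg]; split => //.
  by move=> p [i fp]; rewrite -fp.
by move=> i; have [p fp] := fP i; rewrite fp; apply: fg; exists i.
Qed.

Lemma closed_polynomial_mx m k (X Y : 'M[F]_n -> 'M[F]_(m, k)) :
  polynomial_mx X -> polynomial_mx Y -> zariski_closed [set g | GL g /\ X g = Y g].
Proof.
move=> XP YP; have XYP := polynomial_mx_sub XP YP.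
have := @closed_polynomial _ (fun ij g => (X g - Y g) ij.1 ij.2)
  (fun ij : 'I_m * 'I_k => XYP ij.1 ij.2).
congr zariski_closed; apply/seteqP; split => g /= [Gg E]; split => //.
  by apply/eqP; rewrite -subr_eq0; apply/eqP/matrixP => i j; rewrite (E (i, j)) mxE.
by move=> [i j]; rewrite E subrr mxE.
Qed.

Lemma closed_set0 : zariski_closed (@set0 'M[F]_n).
Proof.
have := @closed_polynomial _ (fun _ _ => 1) (fun _ : unit => polynomial_cst 1).
congr zariski_closed; apply/seteqP; split => g //= [_ /(_ tt) /eqP].
by rewrite oner_eq0.
Qed.

Lemma closed_setU A1 A2 :
  zariski_closed A1 -> zariski_closed A2 -> zariski_closed (A1 `|` A2).
Proof.
move=> [I1 ->] [I2 ->].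
exists [set p | exists p1 p2, [/\ I1 p1, I2 p2 & p = p1 * p2]].
apply/seteqP; split => g /=.
  case=> -[Gg H]; split => // _ [p1 [p2 [I1p I2p ->]]]; rewrite mpoly.mevalM.
    by rewrite (H _ I1p) mul0r.
  by rewrite (H _ I2p) mulr0.
move=> [Gg H]; have [H1|/existsNP [p1 /not_implyP [I1p1 /eqP p1n]]] :=
  pselect (forall p, I1 p -> mpoly.meval (fun k => mxvec g 0 k) p = 0).
  by left.
right; split => // p2 I2p2; apply/eqP.
have /eqP := H (p1 * p2) (ex_intro _ p1 (ex_intro _ p2 (And3 I1p1 I2p2 erefl))).
by rewrite mpoly.mevalM mulf_eq0 (negPf p1n).
Qed.

(** The [Z c] are level sets of a quantity with values in the finite list [s]. The level set of [c0]
    and the union of the others are closed, cover [H] and are disjoint on it. *)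
Lemma connected_constant (H : set 'M[F]_n) (s : seq F) (Z : F -> set 'M[F]_n)
    (c0 : F) h0 :
  zariski_connected H -> (forall c, zariski_closed (Z c)) ->
  (forall h, H h -> exists2 c, c \in s & Z c h) ->
  (forall c c' h, H h -> Z c h -> Z c' h -> c = c') ->
  H h0 -> Z c0 h0 -> H `<=` Z c0.
Proof.
move=> Hc Zc cover disj Hh0 Zh0.
pose Z2 s' := [set h | exists2 c, c \in [seq c <- s' | c != c0] & Z c h].
have Z2c : zariski_closed (Z2 s).
  elim: s {cover} => [|c s IH].
    by have := closed_set0; congr zariski_closed; apply/seteqP; split => h // [].
  case: (eqVneq c c0) => [cc0|cc0].
    move: IH; congr zariski_closed; apply/seteqP; split => h [d ds Zd];
    by exists d => //; move: ds; rewrite /= cc0 eqxx.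
  have := closed_setU (Zc c) IH; congr zariski_closed; apply/seteqP; split => h /=.
    case=> [Zch|[d ds Zd]]; first by exists c; rewrite //= cc0 inE eqxx.
    by exists d => //=; rewrite cc0 inE ds orbT.
  by case=> d /=; rewrite cc0 inE => /orP [/eqP ->|ds] Zd; [left|right; exists d].
case: (Hc _ _ (Zc c0) Z2c) => //.
- move=> h Hh; have [c cs Zch] := cover h Hh.
  case: (eqVneq c c0) => [<-|cc0]; first by left.
  by right; exists c; rewrite // mem_filter cc0.
- apply/seteqP; split => h // [[Hh Zh] [c]]; rewrite mem_filter => /andP [/eqP nc _] Zch.
  by case: nc; apply: disj Zch Zh.
- move=> /(_ _ Hh0) [c]; rewrite mem_filter => /andP [/eqP nc _] Zch.
  by case: nc; apply: disj Zch Zh0.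
Qed.

(** In characteristic 0 the integers below [size q] are distinct, and too many to be all roots. *)
Lemma exists_nonroot (q : {poly F}) : q != 0 -> exists t, q.[t] != 0.
Proof.
move=> q0; apply: contrapT => /forallNP nr.
pose r := [seq i%:R : F | i <- iota 0 (size q)].
have ar : all (root q) r by apply/allP => t _; rewrite /root; apply/negPn/negP/nr.
have ur : uniq r.
  by rewrite map_inj_uniq ?iota_uniq // => i j /eqP; rewrite eqr_nat => /eqP.
by have := max_poly_roots q0 ar ur; rewrite size_map size_iota ltnn.
Qed.

Lemma polynomial_on_line (p : mpoly.mpoly (n * n) F) (x y : 'M[F]_n) :
  exists q : {poly F}, forall t,
    mpoly.meval (fun k => mxvec (x + t *: y) 0 k) p = q.[t].
Proof.
exists (\sum_(m <- mpoly.msupp p) (mpoly.mcoeff m p)%:P *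
   \prod_i ((mxvec x 0 i)%:P + (mxvec y 0 i)%:P * 'X) ^+ (mpoly.fun_of_multinom m i))
  => t; rewrite mpoly.mevalE horner_sum; apply: eq_bigr => m _.
rewrite hornerM hornerC horner_prod; congr (_ * _); apply: eq_bigr => i _.
by rewrite horner_exp hornerD hornerM hornerX !hornerC linearD linearZ /= !mxE mulrC.
Qed.
End Polynomial.

(** An irreducibility argument: a polynomial of [Z1] nonzero at [x] ([t = 0]), one of [Z2] nonzero
    at [y] ([t = 1]) and the determinant restrict to nonzero polynomials in [t], so some invertible
    point of the line lies in [A] but in neither closed set. *)
Lemma connected_by_lines {F : numClosedFieldType} {n : nat} (A : set 'M[F]_n) :
  A `<=` GL ->
  (forall x y t, A x -> A y -> GL (x + t *: (y - x)) -> A (x + t *: (y - x))) ->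
  zariski_connected A.
Proof.
move=> AG Al Z1 Z2 [I1 Z1E] [I2 Z2E] AZ _.
apply: contrapT => /not_orP [/existsNP [x /not_implyP [Ax Z1x]]
                             /existsNP [y /not_implyP [Ay Z2y]]].
have miss I z : GL z ->
    ~ [set g | GL g /\ forall p : mpoly.mpoly (n * n) F, I p ->
         mpoly.meval (fun k => mxvec g 0 k) p = 0] z ->
    exists2 p, I p & mpoly.meval (fun k => mxvec z 0 k) p != 0.
  move=> Gz /not_andP [//|/existsNP [p /not_implyP [Ip /eqP p0]]].
  by exists p.
rewrite Z1E in Z1x; rewrite Z2E in Z2y.
have [p1 Ip1 p1x] := miss _ _ (AG _ Ax) Z1x.
have [p2 Ip2 p2y] := miss _ _ (AG _ Ay) Z2y.
have [pd pdE] : @polynomial_fun F n (fun g => \det g).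
  exact/polynomial_det/polynomial_entry.
have [q1 q1E] := polynomial_on_line p1 x (y - x).
have [q2 q2E] := polynomial_on_line p2 x (y - x).
have [qd qdE] := polynomial_on_line pd x (y - x).
have nz (q : {poly F}) t : q.[t] != 0 -> q != 0.
  by apply: contra_neq => ->; rewrite horner0.
have q1n : q1 != 0 by apply: (@nz _ 0); rewrite -q1E scale0r addr0.
have q2n : q2 != 0 by apply: (@nz _ 1); rewrite -q2E scale1r addrC subrK.
have qdn : qd != 0.
  apply: (@nz _ 0); rewrite -qdE -pdE scale0r addr0 -unitfE -unitmxE.
  exact: AG Ax.
have [t] := exists_nonroot (mulf_neq0 (mulf_neq0 q1n q2n) qdn).
rewrite !hornerM !mulf_eq0 !negb_or => /andP [/andP [q1t q2t] qdt].
have Gt : GL (x + t *: (y - x)).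
  by rewrite /GL /= unitmxE unitfE pdE qdE.
have [] := AZ _ (Al _ _ _ Ax Ay Gt).
  by rewrite Z1E => -[_ /(_ _ Ip1)]; rewrite q1E; apply/eqP.
by rewrite Z2E => -[_ /(_ _ Ip2)]; rewrite q2E; apply/eqP.
Qed.

(** * Groups of invertible matrices with prescribed zeros *)

Definition supported {F : nzRingType} {m n : nat} (R : 'I_m -> 'I_n -> bool)
  (g : 'M[F]_(m, n)) := forall i j, g i j != 0 -> R i j.

(** For a preorder [R] these are the units of its incidence algebra. The upper triangular,
    parabolic, Levi and Borel groups below are all of this form. *)
Definition incidence_group {F : closedFieldType} {n : nat} (R : rel 'I_n) :
  set 'M[F]_n := [set g | GL g /\ supported R g].

Section Supported.
Context {F : fieldType}.

Lemma supportedM m n p (R1 : 'I_m -> 'I_n -> bool) (R2 : 'I_n -> 'I_p -> bool)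
    (R3 : 'I_m -> 'I_p -> bool) (g : 'M[F]_(m, n)) h :
  (forall i j k, R1 i j -> R2 j k -> R3 i k) ->
  supported R1 g -> supported R2 h -> supported R3 (g *m h).
Proof.
move=> R12 sg sh i k; rewrite mxE => nz.
have [j _ /[!mulf_eq0]] : exists2 j, true & g i j * h j k != 0.
  apply: contrapT => H; case/eqP: nz; apply: big1 => j _.
  by apply/eqP/negPn/negP => nz; apply: H; exists j.
by rewrite negb_or => /andP [gij hjk]; apply: R12 (sg _ _ gij) (sh _ _ hjk).
Qed.

Lemma supported_scalar n (R : rel 'I_n) (c : F) : reflexive R -> supported R c%:M.
Proof.
by move=> Rr i j; rewrite mxE; case: (eqVneq i j) => [-> _|_] //=; rewrite eqxx.
Qed.

Lemma supportedD m n (R : 'I_m -> 'I_n -> bool) (g h : 'M[F]_(m, n)) :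
  supported R g -> supported R h -> supported R (g + h).
Proof.
move=> sg sh i j; rewrite mxE => nz; case: (eqVneq (g i j) 0) => [g0|]; last exact: sg.
by apply: sh; rewrite g0 add0r in nz.
Qed.

Lemma supportedZ m n (R : 'I_m -> 'I_n -> bool) (c : F) (g : 'M[F]_(m, n)) :
  supported R g -> supported R (c *: g).
Proof.
by move=> sg i j; rewrite mxE mulf_eq0 negb_or => /andP [_ nz]; apply: sg.
Qed.

Lemma supportedN m n (R : 'I_m -> 'I_n -> bool) (g : 'M[F]_(m, n)) :
  supported R g -> supported R (- g).
Proof. by move=> sg i j; rewrite mxE oppr_eq0; apply: sg. Qed.

Lemma supportedW m n (R R' : 'I_m -> 'I_n -> bool) (g : 'M[F]_(m, n)) :
  (forall i j, R i j -> R' i j) -> supported R g -> supported R' g.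
Proof. by move=> RR' sg i j /sg /RR'. Qed.

Lemma supported_eq0 m n (R : 'I_m -> 'I_n -> bool) (g : 'M[F]_(m, n)) i j :
  supported R g -> ~~ R i j -> g i j = 0.
Proof. by move=> sg nR; apply/eqP; apply: contraNT nR => /sg. Qed.

(* By Cayley-Hamilton, the inverse of [g] is a polynomial in [g]. *)
Lemma supported_inv n (R : rel 'I_n) (g : 'M[F]_n) : reflexive R -> transitive R ->
  g \in unitmx -> supported R g -> supported R (invmx g).
Proof.
case: n R g => [|n] R g Rr Rt gu sg; first by case.
have sh (p : {poly F}) : supported R (horner_mx g p).
  elim/poly_ind: p => [|p c IH]; first by rewrite rmorph0 => i j; rewrite mxE eqxx.
  rewrite rmorphD rmorphM /= horner_mx_X horner_mx_C.
  apply: supportedD; last exact: supported_scalar.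
  by apply: supportedM IH sg => i j k; apply: Rt.
pose c := (char_poly g).[0].
have c0 : c != 0.
  rewrite /c horner_coef0 char_poly_det mulf_neq0 ?signr_eq0 //.
  by rewrite -unitfE -unitmxE.
have /factor_theorem [q qE] : root (char_poly g - c%:P) 0.
  by rewrite /root hornerD hornerN hornerC subrr.
have E : horner_mx g q *m g = - c%:M.
  have := congr1 (horner_mx g) qE.
  rewrite rmorphB rmorphM /= Cayley_Hamilton horner_mx_C polyC0 subr0 horner_mx_X sub0r.
  by move=> ->.
suff -> : invmx g = - c^-1 *: horner_mx g q by apply: supportedZ.
rewrite -[horner_mx g q](mulmxK gu) E scalemxAl scalerN scaleNr opprK.
by rewrite scale_scalar_mx mulVf // mul1mx.
Qed.
End Supported.

Section IncidenceGroup.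
Context {F : numClosedFieldType} {n : nat}.
Implicit Types R : rel 'I_n.

Lemma closed_prescribed (P : rel 'I_n) (c : 'M[F]_n) :
  zariski_closed [set g | GL g /\ forall i j, P i j -> g i j = c i j].
Proof.
pose f (ij : 'I_n * 'I_n) (g : 'M[F]_n) :=
  (P ij.1 ij.2)%:R * (g ij.1 ij.2 + - c ij.1 ij.2).
have fP ij : polynomial_fun (f ij).
  apply: polynomial_mul; first exact: polynomial_cst.
  by apply: polynomial_add; [exact: polynomial_entry | exact: polynomial_cst].
have := closed_polynomial fP; congr zariski_closed.
apply/seteqP; split => g [Gg E]; split => //.
  move=> i j Pij; have := E (i, j); rewrite /f /= Pij mul1r => /eqP.
  by rewrite subr_eq0 => /eqP.
move=> [i j]; rewrite /f /=; case: (boolP (P i j)) => [/E ->|]; last by rewrite mul0r.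
by rewrite subrr mulr0.
Qed.

Lemma incidence_groupE R :
  incidence_group R = [set g : 'M[F]_n | GL g /\ forall i j, ~~ R i j -> g i j = (0 : 'M_n) i j].
Proof.
apply/seteqP; split => g [Gg sg]; split => // i j.
  by rewrite mxE; apply: supported_eq0.
by apply: contraNT => /sg ->; rewrite mxE.
Qed.

Lemma connected_prescribed (P : rel 'I_n) (c : 'M[F]_n) :
  zariski_connected [set g | GL g /\ forall i j, P i j -> g i j = c i j].
Proof.
apply: connected_by_lines => [g []//|x y t [_ xc] [_ yc] Gt]; split => // i j Pij.
by rewrite !mxE xc // yc // subrr mulr0 addr0.
Qed.

Lemma incidence_subgroup R : reflexive R -> transitive R ->
  subgroup (incidence_group R : set 'M[F]_n).
Proof.
move=> Rr Rt; split => [g []//||g h [Gg sg] [Gh sh]|g [Gg sg]].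
- by split; [exact: unitmx1 | exact: supported_scalar].
- split; first by rewrite /GL /= unitmx_mul Gg Gh.
  by apply: supportedM sg sh => i j k; apply: Rt.
- by split; [rewrite /GL /= unitmx_inv | exact: supported_inv].
Qed.

Lemma incidence_closed_connected R (K : set 'M[F]_n) : reflexive R -> transitive R ->
  incidence_group R `<=` K -> closed_connected_subgroup (incidence_group R) K.
Proof.
move=> Rr Rt RK; split => //; first exact: incidence_subgroup.
  rewrite incidence_groupE; exact: (closed_prescribed (fun i j => ~~ R i j) 0).
rewrite incidence_groupE; exact: (@connected_prescribed (fun i j => ~~ R i j) 0).
Qed.

Lemma incidence_sub R R' : (forall i j, R i j -> R' i j) ->
  (incidence_group R : set 'M[F]_n) `<=` incidence_group R'.
Proof. by move=> RR' g [Gg sg]; split => //; apply: supportedW sg. Qed.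
End IncidenceGroup.

(** In use [S] is a two-sided ideal of a preorder [W], and this is 1 plus an ideal of the incidence
    algebra. Both the unipotent radical and the bounds for a derived series have this form. *)
Definition unipotent_group {F : closedFieldType} {n : nat} (S : rel 'I_n) :
  set 'M[F]_n := [set g | GL g /\ supported S (g - 1%:M)].

Section UnipotentGroup.
Context {F : numClosedFieldType} {n : nat} (W S : rel 'I_n).
Hypotheses (Wr : reflexive W) (Wt : transitive W) (SW : forall i j, S i j -> W i j).
Hypotheses (WS : forall i j k, W i j -> S j k -> S i k).
Hypotheses (Sw : forall i j k, S i j -> W j k -> S i k).

Lemma unipotent_group_sub : (unipotent_group S : set 'M[F]_n) `<=` incidence_group W.
Proof.
move=> g [Gg sg]; split => //; rewrite -[g](subrK 1%:M).
by apply: supportedD; [exact: supportedW sg | exact: supported_scalar].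
Qed.

Lemma unipotent_subgroup : subgroup (unipotent_group S : set 'M[F]_n).
Proof.
split => [g []//||g h Ug Uh|g Ug].
- by split; [exact: unitmx1 | rewrite subrr => i j; rewrite mxE eqxx].
- have [[Gg sg] [Gh sh]] := (Ug, Uh); have [_ wh] := unipotent_group_sub Uh.
  split; first by rewrite /GL /= unitmx_mul Gg Gh.
  have -> : g *m h - 1%:M = (g - 1%:M) *m h + (h - 1%:M).
    by rewrite mulmxBl mul1mx addrA subrK.
  by apply: supportedD => //; apply: supportedM sg wh.
- have [Gg sg] := Ug; have [_ wg] := unipotent_group_sub Ug.
  split; first by rewrite /GL /= unitmx_inv.
  have -> : invmx g - 1%:M = - ((g - 1%:M) *m invmx g).
    by rewrite mulmxBl mul1mx mulmxV // opprB.
  by apply/supportedN/(supportedM Sw sg)/(supported_inv Wr Wt Gg wg).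
Qed.

Lemma unipotent_group_normal (g h : 'M[F]_n) : incidence_group W g ->
  unipotent_group S h -> unipotent_group S (g *m h *m invmx g).
Proof.
move=> [Gg wg] [Gh sh]; split; first by rewrite /GL /= !unitmx_mul unitmx_inv Gg Gh.
have -> : g *m h *m invmx g - 1%:M = g *m (h - 1%:M) *m invmx g.
  by rewrite mulmxBr mulmxBl mulmx1 mulmxV.
exact: supportedM Sw (supportedM WS wg sh) (supported_inv Wr Wt Gg wg).
Qed.

Lemma unipotent_group_closed_connected (K : set 'M[F]_n) :
  unipotent_group S `<=` K -> closed_connected_subgroup (unipotent_group S) K.
Proof.
have E : unipotent_group S =
    [set g : 'M[F]_n | GL g /\ forall i j, ~~ S i j -> g i j = (1%:M : 'M_n) i j].
  apply/seteqP; split => g [Gg sg]; split => // i j.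
    by move=> nS; apply/eqP; rewrite -subr_eq0; have := supported_eq0 sg nS;
       rewrite !mxE => ->.
  by apply: contraNT => /sg; rewrite !mxE => ->; rewrite subrr.
move=> UK; split => //; first exact: unipotent_subgroup.
  by rewrite E; apply: (@closed_prescribed _ _ (fun i j => ~~ S i j) 1%:M).
by rewrite E; apply: (@connected_prescribed _ _ (fun i j => ~~ S i j) 1%:M).
Qed.
End UnipotentGroup.

(** The only eigenvalue is 0, so the characteristic polynomial is a power of ['X], and the trace is
    read off its second coefficient. *)
Lemma nilpotent_trace {F : numClosedFieldType} n (N : 'M[F]_n) k :
  N ^+ k = 0 -> \tr N = 0.
Proof.
case: n N => [|n] N N0; first by rewrite /mxtrace big_ord0.
have eig a : root (char_poly N) a -> a = 0.
  rewrite -eigenvalue_root_char => /eigenvalueP [v vN v0].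
  have vNk i : v *m N ^+ i = a ^+ i *: v.
    elim: i => [|i IH]; first by rewrite !expr0 mulmx1 scale1r.
    by rewrite exprSr mulmxA IH -scalemxAl vN scalerA exprSr.
  have /eqP := vNk k; rewrite N0 mulmx0 eq_sym scaler_eq0 (negPf v0) orbF.
  by rewrite expf_eq0 => /andP [_ /eqP].
have [r cE] := closed_field_poly_normal (char_poly N).
have r0 a : a \in r -> a = 0.
  move=> ar; apply: eig; rewrite cE rootZ ?lead_coef_eq0 ?root_prod_XsubC //.
  by rewrite -size_poly_eq0 size_char_poly.
have E : char_poly N = 'X ^+ n.+1.
  have E1 : \prod_(z <- r) ('X - z%:P) = 'X ^+ (size r) :> {poly F}.
    rewrite big_seq (eq_bigr (fun=> 'X)); last by move=> a /r0 ->; rewrite polyC0 subr0.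
    by rewrite -big_seq big_const_seq count_predT iter_mulr_1.
  have /eqP lc : lead_coef (char_poly N) == 1 by exact: char_poly_monic.
  have := size_char_poly N; rewrite cE lc scale1r E1 size_polyXn => -[->] //.
apply/eqP; rewrite -oppr_eq0 -char_poly_trace // E coefXn /=.
by rewrite eqn_leq ltnn andbF.
Qed.

Lemma unipotent_trace {F : numClosedFieldType} n (g : 'M[F]_n) k :
  (g - 1%:M) ^+ k = 0 -> \tr g = n%:R.
Proof.
move/nilpotent_trace/eqP; rewrite raddfB /= mxtrace_scalar subr_eq0.
by move/eqP.
Qed.

(** * Levi subgroups of a block triangular group *)

Section Levi.
Context {F : numClosedFieldType} {n : nat} (be : 'I_n -> nat).

Definition block_parabolic : set 'M[F]_n := incidence_group (fun i j => be i <= be j)%N.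
Definition block_levi : set 'M[F]_n := incidence_group (fun i j => be i == be j).
Definition block_radical : set 'M[F]_n := unipotent_group (fun i j => be i < be j)%N.

Let leq_r : reflexive (fun i j => be i <= be j)%N. Proof. by move=> i /=. Qed.
Let leq_t : transitive (fun i j => be i <= be j)%N.
Proof. by move=> j i k /=; apply: leq_trans. Qed.

Lemma block_parabolic_subgroup : subgroup block_parabolic.
Proof. exact: incidence_subgroup. Qed.

Lemma block_radical_sub : block_radical `<=` block_parabolic.
Proof. by apply: unipotent_group_sub => // i j; apply: ltnW. Qed.

Lemma block_radical_closed_connected : closed_connected_subgroup block_radical block_parabolic.
Proof.
apply: (@unipotent_group_closed_connected _ _ (fun i j => be i <= be j)%N) => //.
- by move=> i j; apply: ltnW.
- by move=> i j k; apply: leq_trans.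
- exact: block_radical_sub.
Qed.

Lemma block_radical_normal : normal_in block_radical block_parabolic.
Proof.
move=> g h; apply: unipotent_group_normal => //.
- by move=> i j k; apply: leq_ltn_trans.
- by move=> i j k; apply: leq_trans.
Qed.

(** Each factor [g - 1%:M] raises the block number, so a power beyond the largest block number
    vanishes. *)
Lemma block_radical_unipotent : unipotent block_radical.
Proof.
move=> g [_ sg].
have sk k : supported (fun i j => be i + k <= be j)%N ((g - 1%:M) ^+ k).
  elim: k => [|k IH].
    by rewrite expr0; apply: supported_scalar => i; rewrite /= addn0.
  by rewrite exprSr; apply: supportedM IH sg => i j l /=; lia.
exists (\max_i be i).+1; apply/matrixP => i j; rewrite [RHS]mxE.
apply: (supported_eq0 (sk _ )); rewrite -ltnNge.
have := leq_bigmax (F := be) j; lia.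
Qed.

Lemma block_levi_radical (g : 'M[F]_n) : block_levi g -> block_radical g -> g = 1%:M.
Proof.
move=> [_ lg] [_ ug]; apply/eqP; rewrite -subr_eq0; apply/eqP/matrixP => i j.
rewrite [RHS]mxE; apply/eqP/negPn/negP => nz; have bij := ug _ _ nz.
have bN : be i == be j = false by move: bij; lia.
move: nz; rewrite !mxE; case: (eqVneq i j) => [ij|_]; first by move: bij; rewrite ij; lia.
by rewrite subr0 => /lg; rewrite bN.
Qed.

(* Since [g] is conjugated within [U] by [1 + c E_ij], all products
   [g (1 + c E_ij) g (1 - c E_ij)] have trace [n]; the coefficient of [c ^ 2] is
   [- g_ji ^ 2]. *)
Lemma normal_unipotent_offdiag (U : set 'M[F]_n) g i j : normal_in U block_parabolic ->
  subgroup U -> unipotent U -> U g -> i != j -> be i = be j -> g j i = 0.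
Proof.
move=> Un [UG U1 UM UV] Uu Ug ij bij.
pose E : 'M[F]_n := delta_mx i j.
have EE : E *m E = 0 by rewrite mul_delta_mx_cond eq_sym (negPf ij) mulr0n.
pose e c := 1%:M + c *: E.
have eV c : e c *m e (- c) = 1%:M.
  rewrite /e mulmxDl mul1mx mulmxDr mulmx1 -scalemxAl -scalemxAr EE !scaler0 addr0.
  by rewrite scaleNr subrK.
have eu c : e c \in unitmx by have [] := mulmx1_unit (eV c).
have eI c : invmx (e c) = e (- c).
  by rewrite -[RHS](mulKmx (eu c)) eV mulmx1.
have Pe c : block_parabolic (e c).
  split; first exact: eu.
  apply: supportedD; first exact: supported_scalar.
  apply: supportedZ => a b; rewrite mxE; case: (eqVneq a i) => [->|] //=; last by rewrite eqxx.
  by case: (eqVneq b j) => [->|] //=; rewrite ?eqxx // bij.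
have tr c : \tr (g *m (e c *m g *m e (- c))) = n%:R.
  have [|k] := Uu (g *m (e c *m g *m e (- c))); last exact: unipotent_trace.
  by apply: UM => //; rewrite -eI; apply: Un.
pose A := \tr (g *m g); pose B := \tr (g *m (E *m g)) - \tr (g *m (g *m E)).
pose D := \tr (g *m (E *m g *m E)).
have trE c : A + c * B - c ^+ 2 * D = n%:R.
  rewrite -(tr c) /e !mulmxDl !mulmxDr !mul1mx !mulmx1 -!scalemxAl -!scalemxAr.
  rewrite !scalerA !raddfD /= !linearZ /=. rewrite /A /B /D; ring.
(* The values at 0, 1 and -1 agree, and the second difference of [A + c * B - c ^+ 2 * D] is minus
   twice [D]. *)
have D0 : D = 0.
  have := trE 0; have := trE 1; have := trE (-1).
  rewrite !mul0r expr0n /= mul0r subr0 addr0 expr1n !mul1r mulN1r sqrrN expr1n mul1r.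
  move=> e1 e2 e3; have : D *+ 2 = 0.
    transitivity (A + A - (A - B - D) - (A + B - D)); first by ring.
    by rewrite e1 e2 e3 addrK subrr.
  by move/eqP; rewrite mulrn_eq0 => /eqP.
have dl (h : 'M[F]_n) a b : (E *m h) a b = (a == i)%:R * h j b.
  rewrite mxE (bigD1 j) //= big1 ?addr0; last first.
    by move=> c cj; rewrite mxE (negPf cj) andbF mul0r.
  by rewrite mxE eqxx andbT.
have dr (h : 'M[F]_n) a b : (h *m E) a b = h a i * (b == j)%:R.
  rewrite mxE (bigD1 i) //= big1 ?addr0; last first.
    by move=> c ci; rewrite mxE (negPf ci) mulr0.
  by rewrite mxE eqxx.
have : D = g j i * g j i.
  rewrite /D mulmxA /mxtrace (bigD1 j) //= big1 ?addr0; last first.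
    by move=> a aj; rewrite dr (negPf aj) mulr0.
  rewrite dr eqxx mulr1 mxE (bigD1 i) //= big1 ?addr0; last first.
    by move=> a ai; rewrite dl (negPf ai) mul0r mulr0.
  by rewrite dl eqxx mul1r.
by rewrite D0 => /esym/eqP; rewrite mulf_eq0 => /orP [] /eqP.
Qed.

Lemma supported_triangular_exp (N : 'M[F]_n) k :
  supported (fun i j => (i == j) || (be i < be j)%N) N ->
  supported (fun i j => (i == j) || (be i < be j)%N) (N ^+ k) /\
  forall i, (N ^+ k) i i = N i i ^+ k.
Proof.
move=> sN; elim: k => [|k [IHs IH]].
  rewrite expr0; split; first by apply: supported_scalar => i /=; rewrite eqxx.
  by move=> i; rewrite mxE eqxx.
rewrite exprSr; split.
  apply: supportedM IHs sN => i j l /=.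
  by move=> /orP [/eqP ->//|bij] /orP [/eqP <-|bjl]; rewrite ?bij ?orbT // (ltn_trans bij bjl) orbT.
move=> i; rewrite mxE (bigD1 i) //= IH big1 ?addr0 ?exprSr // => j ji.
apply/eqP; rewrite mulf_eq0; apply/norP => -[/IHs + /sN].
by rewrite eq_sym (negPf ji) /=; lia.
Qed.

(** Off-diagonal entries inside a block vanish by [normal_unipotent_offdiag]; then [g - 1%:M] is
    triangular and nilpotent, so its diagonal vanishes too. *)
Lemma block_radical_max (U : set 'M[F]_n) : closed_connected_subgroup U block_parabolic ->
  normal_in U block_parabolic -> unipotent U -> U `<=` block_radical.
Proof.
move=> [Us _ _ UP] Un Uu g Ug; have [Gg sg] := UP _ Ug.
have sN : supported (fun i j => (i == j) || (be i < be j)%N) (g - 1%:M).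
  move=> i j; rewrite !mxE; case: (eqVneq i j) => [->|ij] //=; rewrite subr0 => nz.
  rewrite ltn_neqAle sg // andbT; apply: contra nz => /eqP bij.
  by rewrite (normal_unipotent_offdiag Un Us Uu Ug (i := j)) // eq_sym.
split => // i j nz; have /orP [/eqP ij|//] := sN _ _ nz.
have [k Nk] := Uu _ Ug; have [_ /(_ i)] := supported_triangular_exp k sN.
rewrite Nk mxE => /esym/eqP; rewrite expf_eq0 => /andP [_ /eqP z].
by move: nz; rewrite -ij z eqxx.
Qed.

(* The commutator of [l] with a generic central element [t] of the block
   diagonal group lies in the radical. *)
Lemma levi_sub_block_levi (L : set 'M[F]_n) : closed_connected_subgroup L block_parabolic ->
  diagonal_torus `<=` L -> L `&` block_radical = [set 1%:M] -> L `<=` block_levi.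
Proof.
move=> [[LG L1 LM LV] _ _ LP] TL LU l Ll; have [Gl sl] := LP _ Ll.
(* Equal entries within a block and distinct ones across blocks; the successor keeps them
   nonzero. *)
pose t : 'M[F]_n := diag_mx (\row_i (be i).+1%:R).
have tu : t \in unitmx.
  by rewrite unitmxE unitfE det_diag; apply/prodf_neq0 => i _; rewrite mxE pnatr_eq0.
have Lt : L t by apply: TL; split => //; apply: diag_mx_is_diag.
pose s : 'M[F]_n := diag_mx (\row_i (be i).+1%:R^-1).
have ts : t *m s = 1%:M.
  rewrite mulmx_diag; apply/matrixP => i j; rewrite !mxE mulfV //.
  by rewrite pnatr_eq0.
have tV : invmx t = s by rewrite -[s](mulKmx tu) ts mulmx1.
pose y := t *m l *m s - l.
have yE i j : y i j = ((be i).+1%:R / (be j).+1%:R - 1) * l i j.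
  by rewrite /y mul_mx_diag mul_diag_mx !mxE; ring.
have sy : supported (fun i j => be i < be j)%N y.
  move=> i j; rewrite yE mulf_eq0 negb_or => /andP [nb /sl]; rewrite leq_eqVlt.
  case/orP => // /eqP bij; move: nb; rewrite bij divff ?subrr ?eqxx //.
  by rewrite pnatr_eq0.
have xU : block_radical (t *m l *m s *m invmx l).
  split; first by rewrite /GL /= !unitmx_mul -tV !unitmx_inv tu Gl.
  have -> : t *m l *m s *m invmx l - 1%:M = y *m invmx l.
    by rewrite /y mulmxBl mulmxV.
  apply: supportedM sy (supported_inv leq_r leq_t Gl sl) => i j k.
  exact: leq_trans.
have : (L `&` block_radical) (t *m l *m s *m invmx l).
  split => //; apply: (LM); last exact: LV.
  by apply: (LM); [apply: LM | rewrite -tV; apply: LV].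
rewrite LU => /= x1; have y0 : y = 0.
  by rewrite /y -[X in X - _](mulmxKV Gl) x1 mul1mx subrr.
split => // i j nz; have /eqP := yE i j; rewrite y0 mxE eq_sym mulf_eq0 (negPf nz) orbF.
rewrite subr_eq0 => /eqP E; have : (be i).+1%:R = (be j).+1%:R :> F.
  by rewrite -[LHS](divfK (_ : (be j).+1%:R != 0)) ?E ?mul1r // pnatr_eq0.
by move/eqP; rewrite eqr_nat.
Qed.

(** For the reverse inclusion write [g = l *m u]: both [g] and [l] are block diagonal, hence so is
    [u], and a block diagonal element of the radical is 1. *)
Lemma levi_eq_block_levi (L : set 'M[F]_n) : is_levi_subgroup block_parabolic L ->
  diagonal_torus `<=` L -> L = block_levi.
Proof.
move=> [Lc [U [[Uc Un Uu Umax] LU dec]]] TL.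
have UE : U = block_radical.
  apply/seteqP; split; first exact: block_radical_max.
  apply: Umax; [exact: block_radical_closed_connected | exact: block_radical_normal|].
  exact: block_radical_unipotent.
rewrite UE in LU dec.
have sub := levi_sub_block_levi Lc TL LU.
apply/seteqP; split => // g lg.
have Pg : block_parabolic g by apply: incidence_sub lg => i j /eqP ->.
have [l [u [Ll Uu' E]]] := dec g Pg.
have [lG lM lV] : [/\ block_levi `<=` GL, forall g h, block_levi g -> block_levi h -> block_levi (g *m h)
   & forall g, block_levi g -> block_levi (invmx g)].
  have [] := @incidence_subgroup F n (fun i j => be i == be j) => //.
  by move=> j i k /= /eqP -> /eqP ->.
have [Gl _] := sub _ Ll.
have u1 : u = 1%:M.
  apply: block_levi_radical => //; have -> : u = invmx l *m g by rewrite E mulKmx.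
  by apply: lM => //; apply: lV; apply: sub.
by rewrite E u1 mulmx1.
Qed.
End Levi.

(** * Connected solvable groups *)

Section CommonEigenvector.
Context {F : numClosedFieldType} {m : nat}.

(** Otherwise the span of a finite part of [S] could be enlarged until it exceeds the dimension of
    the matrix algebra. *)
Lemma exists_finite_span (S : set 'M[F]_m) :
  exists2 As : seq 'M[F]_m, (forall a, a \in As -> S a) &
    forall x, S x -> x \in <<As>>%VS.
Proof.
apply: contrapT => nfin.
have grow k : exists2 As : seq 'M[F]_m, (forall a, a \in As -> S a) & (k <= \dim <<As>>)%N.
  elim: k => [|k [As AS kA]]; first by exists [::].
  have [x Sx xA] : exists2 x, S x & x \notin <<As>>%VS.
    apply: contrapT => nx; apply: nfin; exists As => // x Sx.
    by apply/negPn/negP => xA; apply: nx; exists x.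
  exists (x :: As) => [a|]; first by rewrite inE => /predU1P [->|/AS].
  apply: leq_ltn_trans kA _; rewrite ltnNge; apply: contra xA => le.
  have sub : (<<As>> <= <<x :: As>>)%VS by rewrite span_cons addvSr.
  have /eqP -> : (<<As>> == <<x :: As>>)%VS by rewrite eqEdim sub.
  by apply: memv_span; rewrite mem_head.
have [As _] := grow (\dim {:'M[F]_m}).+1.
by rewrite ltnNge dimvS // subvf.
Qed.

Lemma common_eigenvector_set (S : set 'M[F]_m) : (0 < m)%N ->
  (forall a b, S a -> S b -> a *m b = b *m a) ->
  exists2 v : 'rV[F]_m, v != 0 & forall a, S a -> exists c, v *m a = c *: v.
Proof.
move=> m0 Sc; have [As AS span] := exists_finite_span S.
have [|v v0 /allP vA] := @common_eigenvector F m As m0.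
  by move=> a b /AS Sa /AS Sb; apply: Sc.
exists v => // a /span aA.
suff /sub_rVP [c ->] : (v *m a <= v)%MS by exists c.
rewrite (coord_span (X := in_tuple As) aA) mulmx_sumr; apply: summx_sub => i _.
rewrite -scalemxAr; apply: scalemx_sub; apply: vA.
by apply: mem_nth; rewrite /= ltn_ord.
Qed.
End CommonEigenvector.

(** Supplies, like [eigenvalues_finite], a finite list of values for [connected_constant]. *)
Lemma unity_roots_finite {F : numClosedFieldType} m : (0 < m)%N ->
  exists s : seq F, forall z, z ^+ m = 1 -> z \in s.
Proof.
move=> m0; have [s sE] := closed_field_poly_normal ('X ^+ m - 1 : {poly F}).
exists s => z zm; have : root ('X ^+ m - 1 : {poly F}) z.
  by rewrite /root !hornerE zm subrr.
by rewrite sE rootZ ?lead_coef_eq0 ?root_prod_XsubC // -size_poly_eq0 size_XnsubC.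
Qed.

Lemma eigenvalues_finite {F : numClosedFieldType} m (a : 'M[F]_m) :
  exists s : seq F, forall z, eigenvalue a z -> z \in s.
Proof.
have [s sE] := closed_field_poly_normal (char_poly a).
exists s => z; rewrite eigenvalue_root_char sE rootZ ?lead_coef_eq0 ?root_prod_XsubC //.
by rewrite -size_poly_eq0 size_char_poly.
Qed.

(** * Derived series of a matrix group *)

Section DerivedSeries.
Context {F : numClosedFieldType} {n : nat}.
Implicit Types H K : set 'M[F]_n.

Lemma invmxM (g h : 'M[F]_n) : GL g -> GL h -> invmx (g *m h) = invmx h *m invmx g.
Proof.
move=> Gg Gh; have Ggh : g *m h \in unitmx by rewrite unitmx_mul Gg Gh.
have E : invmx h *m invmx g *m (g *m h) = 1%:M.
  by rewrite -mulmxA (mulmxA (invmx g)) mulVmx // mul1mx mulVmx.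
by rewrite -[RHS](mulmxK Ggh) E mul1mx.
Qed.

Lemma conjmx_mul (h x y : 'M[F]_n) : GL h ->
  h *m (x *m y) *m invmx h = (h *m x *m invmx h) *m (h *m y *m invmx h).
Proof. by move=> Gh; rewrite !mulmxA mulmxKV. Qed.

Lemma conjmx_inv (h x : 'M[F]_n) : GL h -> GL x ->
  h *m invmx x *m invmx h = invmx (h *m x *m invmx h).
Proof.
move=> Gh Gx; have Gi : GL (invmx h) by rewrite /GL /= unitmx_inv.
by rewrite invmxM ?invmxM ?invmxK ?mulmxA // /GL /= unitmx_mul Gh.
Qed.

Lemma commutator_subgroup_gen K g h : K g -> K h ->
  commutator_subgroup K (g *m h *m invmx g *m invmx h).
Proof. by move=> Kg Kh L _ KL; apply: KL. Qed.

Lemma commutator_subgroup_min K L : subgroup L ->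
  (forall g h, K g -> K h -> L (g *m h *m invmx g *m invmx h)) ->
  commutator_subgroup K `<=` L.
Proof. by move=> Ls KL x; apply. Qed.

Lemma commutator_subgroup_sub K : subgroup K -> commutator_subgroup K `<=` K.
Proof.
move=> Ks; have [KG K1 KM KV] := Ks; apply: commutator_subgroup_min => // g h Kg Kh.
by apply: (KM); [apply: (KM); [apply: (KM) | apply: KV] | apply: KV].
Qed.

Lemma commutator_subgroupP K : subgroup K -> subgroup (commutator_subgroup K).
Proof.
move=> Ks; have [KG K1 KM KV] := Ks; split.
- by move=> g /(commutator_subgroup_sub Ks) /KG.
- by move=> L [].
- by move=> g h Dg Dh L Ls KL; have [_ _ LM _] := Ls; apply: LM; [apply: Dg|apply: Dh].
- by move=> g Dg L Ls KL; have [_ _ _ LV] := Ls; apply: LV; apply: Dg.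
Qed.

(** The matrices whose conjugate by [h] lies in [L] form a subgroup, which contains the commutators
    of [K] because [h] normalizes [K]. *)
Lemma commutator_subgroup_normal H K : H `<=` GL -> K `<=` GL ->
  normal_in K H -> normal_in (commutator_subgroup K) H.
Proof.
move=> HG KG nK h x Hh Dx L Ls KL; have Gh := HG _ Hh; have [LG L1 LM LV] := Ls.
pose M := [set y : 'M[F]_n | GL y /\ L (h *m y *m invmx h)].
suff : commutator_subgroup K `<=` M by move=> /(_ _ Dx) [].
apply: commutator_subgroup_min => [|g g' Kg Kg'].
  split => [g []//||y z [Gy Ly] [Gz Lz]|y [Gy Ly]].
  - by split; [exact: unitmx1 | rewrite mulmx1 mulmxV].
  - by split; [rewrite /GL /= unitmx_mul Gy Gz | rewrite conjmx_mul //; apply: LM].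
  - by split; [rewrite /GL /= unitmx_inv | rewrite conjmx_inv //; apply: LV].
have [Gg Gg'] := (KG _ Kg, KG _ Kg'); split.
  by rewrite /GL /= !unitmx_mul !unitmx_inv Gg Gg'.
by rewrite !conjmx_mul // !conjmx_inv //; apply: KL; apply: nK.
Qed.

Lemma derived_series H k : subgroup H ->
  [/\ subgroup (iter k commutator_subgroup H), iter k commutator_subgroup H `<=` H &
      normal_in (iter k commutator_subgroup H) H].
Proof.
move=> Hs; have [HG H1 HM HV] := Hs; elim: k => [|k [Ks KH nK]] /=.
  by split => // g h Hg Hh; apply: (HM); [apply: HM | apply: HV].
split; first exact: commutator_subgroupP.
  by apply: subset_trans KH; apply: commutator_subgroup_sub.
by apply: commutator_subgroup_normal => //; have [] := Ks.
Qed.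
End DerivedSeries.

(* The proof of Lie-Kolchin usually needs the connectedness of derived subgroups.
   Letting only the conjugating element vary in [H] avoids it. *)
Section LieKolchin.
Context {F : numClosedFieldType} {n m : nat}.
Variables (H : set 'M[F]_n) (r : {linear 'M[F]_n -> 'M[F]_m}).
Hypotheses (Hs : subgroup H) (Hc : zariski_connected H).
Hypotheses (r1 : r 1%:M = 1%:M) (rM : forall g h, H g -> H h -> r (g *m h) = r g *m r h).
(** Irreducibility: the orbit of a nonzero vector spans the whole space, so no nonzero matrix
    annihilates it. *)
Hypothesis irr : forall (v : 'rV[F]_m) (M : 'M[F]_m), v != 0 ->
  (forall h, H h -> v *m r h *m M = 0) -> M = 0.
Hypothesis m_gt0 : (0 < m)%N.

Let HG : H `<=` GL. Proof. by case: Hs. Qed.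
Let H1 : H 1%:M. Proof. by case: Hs. Qed.
Let HM g h : H g -> H h -> H (g *m h). Proof. by case: Hs => _ _ + _; apply. Qed.
Let HV g : H g -> H (invmx g). Proof. by case: Hs => _ _ _; apply. Qed.
Let HJ g h : H g -> H h -> H (g *m h *m invmx g).
Proof. by move=> Hg Hh; apply: HM; [apply: HM | apply: HV]. Qed.

Let rV g : H g -> r g *m r (invmx g) = 1%:M.
Proof. by move=> Hg; rewrite -rM ?mulmxV ?r1 //; [apply: HG | apply: HV]. Qed.

Let rVl g : H g -> r (invmx g) *m r g = 1%:M.
Proof. by move=> Hg; rewrite -rM ?mulVmx ?r1 //; [apply: HG | apply: HV]. Qed.

Let ru g : H g -> r g \in unitmx.
Proof. by move=> /rV /mulmx1_unit []. Qed.

Let commE x y z : H x -> H y -> r (x *m y *m invmx x *m invmx y) = z%:M ->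
  r x *m r y = z *: (r y *m r x).
Proof.
move=> Hx Hy E; have [Gx Gy] := (HG Hx, HG Hy).
rewrite -!rM // -mul_scalar_mx -E -rM; last exact: HM.
  by rewrite mulmxA mulmxKV // mulmxKV.
by do ![apply: (HM) => //]; apply: HV.
Qed.

Let scalar_root x y z : H x -> H y -> r x *m r y = z *: (r y *m r x) -> z ^+ m = 1.
Proof.
move=> Hx Hy /(congr1 determinant); rewrite detZ !det_mulmx mulrC -[LHS]mul1r.
by move/mulIf => -> //; rewrite mulf_neq0 // -unitfE -unitmxE ru.
Qed.

Let rJ g h : H g -> H h -> r (g *m h *m invmx g) = r g *m r h *m r (invmx g).
Proof. by move=> Hg Hh; rewrite rM ?rM //; [apply: HM | apply: HV]. Qed.

Let unit0 : ((0 : 'M[F]_m) \in unitmx) = false.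
Proof. by case: (m) m_gt0 => // k _; rewrite unitmxE det0 unitr0. Qed.

Let is_scalar_on x := exists c, r x = c%:M.

Section Step.
Variable N : set 'M[F]_n.
Hypotheses (NH : N `<=` H) (Ns : subgroup N) (Nn : normal_in N H).
Hypothesis Nsc : forall x y, N x -> N y -> is_scalar_on (x *m y *m invmx x *m invmx y).

Let NM g h : N g -> N h -> N (g *m h). Proof. by case: Ns => _ _ + _; apply. Qed.
Let NV g : N g -> N (invmx g). Proof. by case: Ns => _ _ _; apply. Qed.

(** The commutator of [h *m x *m invmx h] with [y] acts by a scalar, an [m]-th root of unity by
    comparison of determinants. Having finitely many values on [H], this scalar does not depend on
    [h]. *)
Let zeta_const x y : N x -> N y -> exists z, forall h, H h ->
  r (h *m x *m invmx h) *m r y = z *: (r y *m r (h *m x *m invmx h)).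
Proof.
move=> Nx Ny; have [s sP] := unity_roots_finite (F := F) m_gt0.
pose Z c := [set h : 'M[F]_n | GL h /\
  r (h *m x *m \adj h) *m r y = c *: (r y *m r (h *m x *m \adj h))].
have Zc c : zariski_closed (Z c).
  have P : polynomial_mx (fun h : 'M[F]_n => r (h *m x *m \adj h)).
    apply: polynomial_mx_linear; apply: polynomial_mx_mul.
      by apply: polynomial_mx_mul; [exact: polynomial_mx_id | exact: polynomial_mx_cst].
    exact/polynomial_mx_adj/polynomial_mx_id.
  apply: closed_polynomial_mx; first by apply: polynomial_mx_mul => //; exact: polynomial_mx_cst.
  by apply: polynomial_mx_scale; apply: polynomial_mx_mul => //; exact: polynomial_mx_cst.
have ZE c h : H h -> Z c h <->
    r (h *m x *m invmx h) *m r y = c *: (r y *m r (h *m x *m invmx h)).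
  move=> Hh; have Gh := HG Hh; have d0 : \det h != 0 by rewrite -unitfE -unitmxE.
  have -> : r (h *m x *m invmx h) = (\det h)^-1 *: r (h *m x *m \adj h).
    by rewrite -linearZ /= /invmx [h \in unitmx]Gh -scalemxAr.
  rewrite /Z /= -scalemxAl -scalemxAr scalerA [c * _]mulrC -scalerA.
  split=> [[_ ->] //|E]; split => //.
  by apply: (scalerI (invr_neq0 d0)).
have val h : H h -> exists2 c, c \in s & Z c h.
  move=> Hh; have Nx' := Nn Hh Nx.
  have [z zE] := Nsc Nx' Ny; have E := commE (NH Nx') (NH Ny) zE.
  by exists z; [apply/sP/(scalar_root _ _ E) => //; apply: NH | apply/ZE].
have [c0 _ Zc0] := val _ H1; exists c0 => h Hh; apply/ZE => //.
apply: (connected_constant Hc Zc val _ H1 Zc0) => // c c' g Hg /ZE -/(_ Hg) E /ZE -/(_ Hg) E'.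
apply/eqP; rewrite -subr_eq0; apply: contraTT isT => cc'.
have : (c - c') *: (r y *m r (g *m x *m invmx g)) = 0.
  by rewrite scalerBl -E -E' subrr.
move/eqP; rewrite scaler_eq0 (negPf cc') /= => /eqP Z0.
have := ru (HM (NH Ny) (HJ Hg (NH Nx))); rewrite rM ?Z0; last 2 first.
- exact: NH.
- exact/HJ/NH.
by rewrite unit0.
Qed.

Let central a := N a /\ forall y, N y -> r a *m r y = r y *m r a.

(** Central elements have a common eigenvector [v]. Conjugates of [a] under [H] are again central,
    so every [v *m r h] is an eigenvector of [r a]; its eigenvalue is constant by connectedness, and
    the orbit of [v] spans. *)
Let central_scalar a : central a -> is_scalar_on a.
Proof.
pose S := [set M | exists2 b, central b & M = r b].
have [|v v0 vS] := @common_eigenvector_set F m S m_gt0.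
  by move=> _ _ [b [Nb Cb] ->] [c [Nc Cc] ->]; apply: Cb.
move=> Ca; have [Na _] := Ca; have [s sP] := eigenvalues_finite (r a).
pose Z c := [set h : 'M[F]_n | GL h /\ v *m r h *m r a = c *: (v *m r h)].
have Zc c : zariski_closed (Z c).
  have P : polynomial_mx (fun h : 'M[F]_n => v *m r h).
    apply: polynomial_mx_mul; first exact: polynomial_mx_cst.
    exact/polynomial_mx_linear/polynomial_mx_id.
  apply: closed_polynomial_mx; last exact: polynomial_mx_scale.
  by apply: polynomial_mx_mul => //; exact: polynomial_mx_cst.
have vr h : H h -> v *m r h != 0.
  by move=> Hh; apply: contra_neq v0 => /(congr1 (mulmx^~ (r (invmx h)))); rewrite -mulmxA rV // mulmx1 mul0mx.
have val h : H h -> exists2 c, c \in s & Z c h.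
  move=> Hh; have Hi := HV Hh; have Gh := HG Hh.
  have Ca' : central (h *m a *m invmx h).
    split => [|y Ny]; first exact: Nn.
    have Ny' : N (invmx h *m y *m h) by rewrite -[X in _ *m X]invmxK; apply: Nn.
    have [_ /(_ _ Ny') E] := Ca.
    have yE : r y = r h *m r (invmx h *m y *m h) *m r (invmx h).
      have := rJ Hi (NH Ny); rewrite invmxK => ->.
      by rewrite !mulmxA rV // mul1mx -mulmxA rV // mulmx1.
    rewrite yE rJ //; last exact: NH.
    have cancel A B : (r h *m A *m r (invmx h)) *m (r h *m B *m r (invmx h)) =
        r h *m (A *m B) *m r (invmx h).
      by rewrite -!mulmxA (mulmxA (r (invmx h)) (r h)) rVl // mul1mx.
    by rewrite !cancel E.
  have [c vc] := vS _ (ex_intro2 _ _ _ Ca' erefl).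
  have E : v *m r h *m r a = c *: (v *m r h).
    rewrite scalemxAl -vc rJ //; last exact: NH.
    by rewrite -!mulmxA rVl // mulmx1.
  exists c => //; apply: sP; apply/eigenvalueP; exists (v *m r h) => //; exact: vr.
have [c0 _ Zc0] := val _ H1; exists c0; apply/eqP; rewrite -subr_eq0; apply/eqP.
apply: irr v0 _ => h Hh.
have [|_ E] := connected_constant Hc Zc val _ H1 Zc0 Hh.
  move=> c c' g Hg [_ E] [_ E']; apply/eqP; rewrite -subr_eq0.
  have := scalerBl c c' (v *m r g); rewrite -E -E' subrr => /eqP.
  by rewrite scaler_eq0 (negPf (vr _ Hg)) orbF.
by rewrite mulmxBr E mul_mx_scalar subrr.
Qed.

(** The scalar of [zeta_const] is the same at [h] and at 1, so [h *m x *m invmx h *m invmx x] is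
    central, hence scalar. Thus [h] and [x] commute up to a root of unity, which is 1 at [h = 1] and
    so everywhere. An eigenvector of [r x] then has its whole orbit in one eigenspace. *)
Lemma lie_kolchin_step x : N x -> is_scalar_on x.
Proof.
move=> Nx; have Hx := NH Nx; have Gx := HG Hx.
have csc h : H h -> is_scalar_on (h *m x *m invmx h *m invmx x).
  move=> Hh; have Nx' := Nn Hh Nx; apply: central_scalar; split.
    by apply: NM => //; apply: NV.
  move=> y Ny; have [z zP] := zeta_const Nx Ny.
  have E1 := zP _ Hh; have := zP _ H1; rewrite mul1mx invmx1 mulmx1 => E0.
  move: Nx' E1; move: (h *m x *m invmx h) => x' Nx' E1.
  have Hx' := NH Nx'; rewrite rM //; last exact: HV.
  have z0 : z != 0.
    have := scalar_root Hx (NH Ny) E0; apply: contra_eq_neq => ->.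
    by rewrite expr0n eqn0Ngt m_gt0 eq_sym oner_eq0.
  apply: (can_inj (mulmxK (ru Hx))); rewrite -!mulmxA rVl // mulmx1.
  apply: (scalerI z0); rewrite -E1 2!scalemxAr -E0.
  by rewrite (mulmxA (r (invmx x))) rVl // mul1mx.
have [s sP] := unity_roots_finite (F := F) m_gt0.
pose Z c := [set h : 'M[F]_n | GL h /\ r h *m r x = c *: (r x *m r h)].
have Zc c : zariski_closed (Z c).
  have P : polynomial_mx (fun h : 'M[F]_n => r h).
    exact/polynomial_mx_linear/polynomial_mx_id.
  apply: closed_polynomial_mx; first by apply: polynomial_mx_mul => //; exact: polynomial_mx_cst.
  by apply: polynomial_mx_scale; apply: polynomial_mx_mul => //; exact: polynomial_mx_cst.
have val h : H h -> exists2 c, c \in s & Z c h.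
  move=> Hh; have [z /(commE Hh Hx) E] := csc h Hh.
  by exists z; [apply/sP/(scalar_root Hh Hx E) | split => //; apply: HG].
have Z1 : Z 1 1%:M by split; [exact: HG | rewrite r1 mul1mx mulmx1 scale1r].
have comm h : H h -> r h *m r x = r x *m r h.
  move=> Hh; have [|_] := connected_constant Hc Zc val _ H1 Z1 Hh; last by rewrite scale1r.
  move=> c c' g Hg [_ E] [_ E']; apply/eqP; rewrite -subr_eq0.
  have := scalerBl c c' (r x *m r g); rewrite -E -E' subrr => /eqP.
  rewrite scaler_eq0 => /orP [//|/eqP Z0].
  by have := ru (HM Hx Hg); rewrite rM // Z0 unit0.
have [c /eigenvalueP [v vc v0]] := eigenvalue_closed (r x) m_gt0.
exists c; apply/eqP; rewrite -subr_eq0; apply/eqP; apply: irr v0 _ => h Hh.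
by rewrite mulmxBr -mulmxA comm // mulmxA vc -scalemxAl mul_mx_scalar subrr.
Qed.
End Step.

(** Climbs the derived series from the trivial group: commutators of one term lie in the next, where
    the action is already scalar. *)
Lemma lie_kolchin : solvable_subgroup H -> forall x, H x -> exists c, r x = c%:M.
Proof.
move=> [k Dk]; have : forall x, iter k commutator_subgroup H x -> is_scalar_on x.
  by rewrite Dk => x ->; exists 1; rewrite r1.
elim: k {Dk} => [//|k IH] Dk; apply: IH => x.
have [Ds DH Dn] := derived_series k Hs.
apply: lie_kolchin_step => // y z Dy Dz; apply: Dk.
exact: commutator_subgroup_gen.
Qed.
End LieKolchin.

(** * Borel subgroups of a block diagonal group *)

Section Borel.
Context {F : numClosedFieldType} {n : nat} (be : 'I_n -> nat).

Definition block_borel (f : 'I_n -> nat) : set 'M[F]_n :=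
  incidence_group (fun i j => (be i == be j) && (f i <= f j)%N).

Section Solvable.
Variables (f : 'I_n -> nat).
Hypothesis f_inj : injective f.

Let W i j := (be i == be j) && (f i <= f j)%N.
Let S k i j := (be i == be j) && (f i + k <= f j)%N.
Let Wr : reflexive W. Proof. by move=> i; rewrite /W eqxx leqnn. Qed.
Let Wt : transitive W.
Proof.
by move=> j i k; rewrite /W => /andP [/eqP -> l1] /andP [-> l2]; rewrite (leq_trans l1 l2).
Qed.
Let WW i j l : W i j -> W j l -> W i l. Proof. exact: Wt. Qed.
Let SW k i j : S k i j -> W i j. Proof. by rewrite /S /W => /andP [->] /=; lia. Qed.
Let WS k i j l : W i j -> S k j l -> S k i l.
Proof. by rewrite /S /W => /andP [/eqP ->] + /andP [->] /=; lia. Qed.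
Let Sw k i j l : S k i j -> W j l -> S k i l.
Proof. by rewrite /S /W => /andP [/eqP ->] + /andP [->] /=; lia. Qed.
Let SS k i j l : S k.+1 i j -> S k.+1 j l -> S k.+2 i l.
Proof. by rewrite /S => /andP [/eqP ->] + /andP [->] /=; lia. Qed.

Lemma block_borel_subgroup : subgroup (block_borel f).
Proof. exact: incidence_subgroup. Qed.

Lemma block_borel_closed_connected :
  closed_connected_subgroup (block_borel f) (block_levi be).
Proof.
by apply: incidence_closed_connected => //; apply: incidence_sub => i j /andP [].
Qed.

Let comm_supported k (g h : 'M[F]_n) : block_borel f g -> block_borel f h ->
  supported (S k) (g *m h - h *m g) ->
  unipotent_group (S k) (g *m h *m invmx g *m invmx h).
Proof.
move=> [Gg sg] [Gh sh] sc; split.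
  by rewrite /GL /= !unitmx_mul !unitmx_inv Gg Gh.
have -> : g *m h *m invmx g *m invmx h - 1%:M =
    (g *m h - h *m g) *m (invmx g *m invmx h).
  by rewrite mulmxBl !mulmxA mulmxK // mulmxV.
apply: (supportedM (@Sw k)) sc _.
exact: supportedM WW (supported_inv Wr Wt Gg sg) (supported_inv Wr Wt Gh sh).
Qed.

(** At the first step the diagonals of [g *m h] and [h *m g] agree, since [f] is injective, which
    gains one. Later [g *m h - h *m g] is a difference of products of two elements of the ideal,
    where the gaps of [f] add up. *)
Lemma block_borel_derived k :
  iter k.+1 commutator_subgroup (block_borel f) `<=` unipotent_group (S k.+1).
Proof.
have Us l : subgroup (unipotent_group (S l) : set 'M[F]_n).
  exact: (unipotent_subgroup Wr Wt (@SW l) (@Sw l)).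
elim: k => [|k IH]; rewrite iterS; apply: commutator_subgroup_min => // g h.
  move=> Bg Bh; apply: comm_supported => // i j nz.
  have sgh : supported W (g *m h - h *m g).
    have [[_ sg] [_ sh]] := (Bg, Bh).
    by apply: supportedD; [|apply: supportedN]; apply: (supportedM WW).
  have Wij := sgh _ _ nz; move: (Wij); rewrite /S /W => /andP [-> /=].
  rewrite addn1 ltn_neqAle => ->; rewrite andbT; apply: contra nz => /eqP /f_inj <-.
  rewrite !mxE subr_eq0 (bigD1 i) //= [X in _ == X](bigD1 i) //= mulrC.
  rewrite !big1 // => k ki; apply/eqP; rewrite mulf_eq0; apply: contraR ki;
  rewrite negb_or => /andP [];
  have [[_ sg] [_ sh]] := (Bg, Bh).
    by move=> /sh /andP [_ l1] /sg /andP [_ l2]; apply/eqP/f_inj; lia.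
  by move=> /sg /andP [_ l1] /sh /andP [_ l2]; apply/eqP/f_inj; lia.
move=> /IH Ug /IH Uh; have sub := unipotent_group_sub Wr (@SW k.+1).
apply: comm_supported; [exact: sub | exact: sub|].
have -> : g *m h - h *m g =
    (g - 1%:M) *m (h - 1%:M) - (h - 1%:M) *m (g - 1%:M).
  rewrite !mulmxBl !mulmxBr !mul1mx !mulmx1.
  by rewrite !opprB; apply/matrixP => i j; rewrite !mxE; ring.
have [[_ sg] [_ sh]] := (Ug, Uh).
by apply: supportedD; [|apply: supportedN]; apply: (supportedM (@SS k)).
Qed.

Lemma block_borel_solvable : solvable_subgroup (block_borel f).
Proof.
exists (\max_i f i).+1; apply/seteqP; split => g.
  move/block_borel_derived => [Gg sg]; apply/eqP; rewrite -subr_eq0; apply/eqP/matrixP => i j.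
  rewrite [RHS]mxE; apply: (supported_eq0 sg); rewrite /S negb_and -ltnNge.
  by have := leq_bigmax (F := f) j; lia.
by move=> ->; have [[]] := derived_series (\max_i f i).+1 block_borel_subgroup.
Qed.
End Solvable.

Section Classification.
Variable BL : set 'M[F]_n.
Hypotheses (BLb : is_borel_subgroup (block_levi be) BL) (TB : diagonal_torus `<=` BL).

Let Bs : subgroup BL. Proof. by case: BLb => -[]. Qed.
Let Bc : zariski_connected BL. Proof. by case: BLb => -[]. Qed.
Let Bsol : solvable_subgroup BL. Proof. by case: BLb. Qed.
Let BLL : BL `<=` block_levi be. Proof. by case: BLb => -[]. Qed.
Let BM g h : BL g -> BL h -> BL (g *m h). Proof. by case: Bs => _ _ + _; apply. Qed.

Let tor i : 'M[F]_n := 1%:M + delta_mx i i.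

Let Btor i : BL (tor i).
Proof.
have E : tor i = diag_mx (\row_k (1 + (k == i)%:R)).
  apply/matrixP => a b; rewrite !mxE; case: (eqVneq a b) => [->|ab].
    by rewrite andbb mulr1n.
  rewrite mulr0n add0r; case: (eqVneq a i) => [ai|//]; rewrite -ai eq_sym (negPf ab).
  by [].
apply: TB; split; last by rewrite E diag_mx_is_diag.
rewrite /GL /= E unitmxE unitfE det_diag; apply/prodf_neq0 => k _; rewrite mxE.
by rewrite -(natrD _ 1) pnatr_eq0.
Qed.

(** The left side expands to [delta_mx i i *m h *m delta_mx j j]. So the linear span of [BL]
    contains a matrix unit as soon as some element has a nonzero entry there. *)
Let torM i (h : 'M[F]_n) j : (tor i *m h *m tor j - tor i *m h) - (h *m tor j - h) =
  h i j *: delta_mx i j.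
Proof.
rewrite /tor !mulmxDr !mulmx1 !mulmxDl !mul1mx.
have -> : delta_mx i i *m h *m delta_mx j j = h i j *: delta_mx i j :> 'M[F]_n.
  apply/matrixP => a b; rewrite mxE (bigD1 j) //= big1 ?addr0; last first.
    by move=> k kj; rewrite !mxE (negPf kj) /= mulr0.
  rewrite mxE (bigD1 i) //= big1 ?addr0; last first.
    by move=> k ki; rewrite !mxE (negPf ki) andbF mul0r.
  by rewrite !mxE !eqxx /= andbT mulrAC -natrM mulnb mulrC.
by apply/matrixP => a b; rewrite !mxE; ring.
Qed.

Let R i j := `[< exists2 h, BL h & h i j != 0 >].

Let R_refl : reflexive R.
Proof.
move=> i; apply/asboolP; exists 1%:M; first by case: Bs.
by rewrite mxE eqxx oner_eq0.
Qed.

Let R_trans : transitive R.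
Proof.
move=> j i k /asboolP [g Bg gij] /asboolP [h Bh hjk]; apply/asboolP.
case: (eqVneq ((g *m h) i k) 0) => [gh0|]; last by exists (g *m h) => //; exact: BM.
(* When the terms of the entry of [g *m h] cancel, inserting [tor j] adds exactly
   [g i j * h j k]. *)
exists (g *m tor j *m h); first by apply: (BM) => //; apply: BM.
rewrite /tor mulmxDr mulmx1 mulmxDl mxE gh0 add0r mxE (bigD1 j) //= big1 ?addr0; last first.
  move=> l lj; rewrite mxE big1 ?mul0r // => a _; rewrite mxE (negPf lj) andbF mulr0 //.
rewrite mulf_neq0 // mxE (bigD1 j) //= big1 ?addr0; last first.
  by move=> l lj; rewrite mxE (negPf lj) mulr0.
by rewrite mxE eqxx mulr1.
Qed.

(* The submatrices on a strong component of [R] form an irreducible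
   representation of [BL], which is one-dimensional by Lie-Kolchin. *)
Let R_anti i0 j0 : R i0 j0 -> R j0 i0 -> i0 = j0.
Proof.
move=> Rij Rji.
pose C := [set i | R i i0 && R i0 i]%SET.
pose e : 'I_#|C| -> 'I_n := enum_val.
have eC a : R (e a) i0 /\ R i0 (e a) by have := enum_valP a; rewrite inE => /andP.
pose r : {linear 'M[F]_n -> 'M[F]_#|C|} := mxsub e e.
have r1 : r 1%:M = 1%:M.
  by apply/matrixP => a b; rewrite !mxE (inj_eq enum_val_inj).
(* An intermediate index with both entries nonzero is related to the class [C] on both sides, so it
   lies in [C]. *)
have rM g h : BL g -> BL h -> r (g *m h) = r g *m r h.
  move=> Bg Bh; apply/matrixP => a b; rewrite !mxE.
  rewrite (bigID (mem C)) /= [X in _ + X]big1 ?addr0; last first.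
    move=> k kC; apply/eqP; rewrite mulf_eq0; apply: contraR kC.
    rewrite negb_or => /andP [gk hk]; rewrite inE.
    have Rak : R (e a) k by apply/asboolP; exists g.
    have Rkb : R k (e b) by apply/asboolP; exists h.
    by rewrite (R_trans Rkb) ?(R_trans _ Rak) //; [have [] := eC a | have [] := eC b].
  by rewrite big_enum_val; apply: eq_bigr => c _; rewrite !mxE.
have irr (v : 'rV[F]_#|C|) (M : 'M[F]_#|C|) : v != 0 ->
    (forall h, BL h -> v *m r h *m M = 0) -> M = 0.
  move=> /rV0Pn [a va] vM; apply/row_matrixP => b.
  have /asboolP [h Bh hab] : R (e a) (e b).
    by have [ai _] := eC a; have [_ ib] := eC b; apply: R_trans ai ib.
  have : v *m r (h (e a) (e b) *: delta_mx (e a) (e b)) *m M = 0.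
    have rB A B : r (A - B) = r A - r B by exact: raddfB.
    rewrite -torM !rB !mulmxBr !mulmxBl !vM ?subrr //;
    by [exact: BM | apply: (BM) => //; exact: BM].
  have -> : r (h (e a) (e b) *: delta_mx (e a) (e b)) = h (e a) (e b) *: delta_mx a b.
    by apply/matrixP => c d; rewrite !mxE !(inj_eq enum_val_inj).
  rewrite -scalemxAr -scalemxAl => /eqP; rewrite scaler_eq0 (negPf hab) /= => /eqP E.
  have : v 0 a *: row b M = 0.
    rewrite -E; apply/rowP => c; rewrite !mxE (bigD1 b) //= big1 ?addr0; last first.
      move=> k kb; rewrite mxE big1 ?mul0r // => l _.
      by rewrite mxE (negPf kb) andbF mulr0.
    rewrite mxE (bigD1 a) //= big1 ?addr0; last first.
      by move=> k ka; rewrite mxE (negPf ka) mulr0.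
    by rewrite !mxE !eqxx mulr1.
  by move/eqP; rewrite scaler_eq0 (negPf va) row0 => /eqP.
have i0C : i0 \in C by rewrite inE R_refl.
have j0C : j0 \in C by rewrite inE Rij Rji.
have C0 : (0 < #|C|)%N by apply/card_gt0P; exists i0.
(* The image of [tor i0] is scalar, but its diagonal has 2 at [i0] and 1 at every other index of
   [C]. *)
have [c /matrixP tc] := lie_kolchin Bs Bc r1 rM irr C0 Bsol (Btor i0).
have ei : e (enum_rank_in i0C i0) = i0 by rewrite /e enum_rankK_in.
have ej : e (enum_rank_in i0C j0) = j0 by rewrite /e enum_rankK_in.
have := tc (enum_rank_in i0C i0) (enum_rank_in i0C i0).
have := tc (enum_rank_in i0C j0) (enum_rank_in i0C j0).
rewrite !mxE ei ej !eqxx !andbb /=; case: (eqVneq j0 i0) => [//|_] <- /eqP.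
by rewrite addr0 -subr_eq0 addrK oner_eq0.
Qed.

(** The number [f0] of predecessors increases strictly along [R], and adding [i < n] to [f0 i * n]
    breaks ties. The triangular group of this order contains [BL] and is closed, connected and
    solvable, so maximality gives equality. *)
Lemma borel_eq_block_borel : exists2 f : 'I_n -> nat, injective f & BL = block_borel f.
Proof.
pose f0 i := #|[set j | R j i]%SET|.
pose f i := (f0 i * n + i)%N.
have f_inj : injective f.
  move=> i j /(congr1 (modn^~ n)); rewrite /f !modnMDl !modn_small //.
  by move/val_inj.
exists f => //; case: BLb => _ _ /(_ (block_borel f)) max; apply/esym; apply: max.
- exact: block_borel_closed_connected.
- exact: block_borel_solvable.
move=> g Bg; have [Gg sg] := BLL Bg; split => // i j nz.
have Rij : R i j by apply/asboolP; exists g.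
rewrite sg //=; case: (eqVneq i j) => [->//|ij].
have lt : (f0 i < f0 j)%N.
  apply: proper_card; apply/properP; split.
    by apply/fintype.subsetP => k; rewrite !finset.in_set => Rki; apply: R_trans Rki Rij.
  exists j; rewrite finset.in_set ?R_refl //; apply: contra ij => Rji.
  by apply/eqP/R_anti.
rewrite /f; apply: leq_trans (_ : (f0 i).+1 * n <= _)%N; last first.
  by apply: leq_trans (leq_addr _ _); rewrite leq_mul2r lt orbT.
by rewrite mulSn addnC leq_add2r ltnW.
Qed.
End Classification.
End Borel.

(** * Schubert varieties of 312-avoiding permutations *)

Section TrailingMinors.
Context {F : numClosedFieldType}.

(** The product of the lower right principal minors; where it is nonzero, the matrix lies in the big
    cell of products of an upper and a lower triangular matrix. *)
Fixpoint trailing_minors n : 'M[F]_n -> F :=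
  if n is n'.+1 return 'M[F]_n -> F then
    fun A => \det A * trailing_minors (drsubmx (A : 'M_(1 + n')))
  else fun _ => 1.

Lemma trailing_minors1 n : trailing_minors (1%:M : 'M_n) = 1.
Proof.
elim: n => [|n IH] //=.
by rewrite det1 mul1r -[RHS]IH -[n.+1]/(1 + n)%N scalar_mx_block block_mxKdr.
Qed.

Lemma polynomial_trailing_minors n k (X : 'M[F]_n -> 'M[F]_k) :
  polynomial_mx X -> polynomial_fun (fun g => trailing_minors (X g)).
Proof.
elim: k X => [|k IH] X XP /=; first exact: polynomial_cst.
apply: polynomial_mul; first exact: polynomial_det.
apply: IH => i j; apply: (polynomial_fun_ext _ (XP (rshift 1 i) (rshift 1 j))) => g.
by rewrite !mxE.
Qed.

Lemma upper_lower_decomposition n (A : 'M[F]_n) : trailing_minors A != 0 ->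
  exists U L : 'M[F]_n, [/\ U \in unitmx, L \in unitmx,
    supported (fun i j => i <= j)%N U, supported (fun i j => j <= i)%N L & A = U *m L].
Proof.
elim: n A => [|n IH] A.
  by exists 1%:M, 1%:M; split; rewrite ?unitmx1 ?flatmx0 // => -[].
move: A; rewrite -[n.+1]/(1 + n)%N => A.
have -> : trailing_minors A = \det A * trailing_minors (drsubmx A) by [].
rewrite mulf_eq0 negb_or => /andP [dA /IH [U [L [Uu Lu sU sL AE]]]].
pose x := ursubmx A *m invmx L; pose y := invmx U *m dlsubmx A.
pose U1 := block_mx 1%:M x 0 U : 'M[F]_(1 + n).
pose L1 := block_mx (ulsubmx A - x *m y) 0 y L : 'M[F]_(1 + n).
have E : A = U1 *m L1.
  rewrite mulmx_block !mul1mx !mul0mx !add0r subrK.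
  by rewrite mulmxKV // mulKVmx // -AE submxK.
have : U1 *m L1 \in unitmx by rewrite -E unitmxE unitfE.
rewrite unitmx_mul => /andP [U1u L1u].
exists U1, L1; split => // i j; rewrite !mxE; case: splitP => i' ->;
  rewrite !mxE; case: splitP => j' -> //.
- by rewrite !ord1.
- by rewrite ord1.
- by rewrite mxE eqxx.
- by move/sU.
- by rewrite !ord1.
- by rewrite mxE eqxx.
- by rewrite ord1.
- by move/sL.
Qed.
End TrailingMinors.

(** * Schubert varieties as staircases, and their stabilizers *)

Section Cells.
Context {F : numClosedFieldType} {n : nat}.
Implicit Types (g : 'M[F]_n) (w : 'S_n).

Lemma upper_borelE : @upper_borel F n = incidence_group (fun i j => i <= j)%N.
Proof.
apply/seteqP; split => g [Gg tg]; split => //.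
  move=> i j; apply: contraR; rewrite -ltnNge => ji.
  by have /is_trig_mxP /(_ _ _ ji) := tg; rewrite mxE => ->.
by apply/is_trig_mxP => i j ij; rewrite mxE; apply: supported_eq0 tg _; rewrite -ltnNge.
Qed.

Lemma upper_borel_subgroup : subgroup (@upper_borel F n).
Proof.
rewrite upper_borelE; apply: incidence_subgroup; first by move=> i /=.
by move=> j i k /=; apply: leq_trans.
Qed.

Lemma translateM g h x : translate g (translate h x) = translate (g *m h) x.
Proof.
apply/seteqP; split => y.
  by move=> [_ [z xz <-] <-]; exists z; rewrite ?mulmxA.
by move=> [z xz <-]; exists (h *m z); [exists z | rewrite mulmxA].
Qed.

Lemma translate1 x : translate (1%:M : 'M[F]_n) x = x.
Proof.
by apply/seteqP; split => y; [move=> [z xz <-] | move=> xy; exists y]; rewrite ?mul1mx.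
Qed.

Lemma translate_refl g : translate g upper_borel g.
Proof. by exists 1%:M; rewrite ?mulmx1 //; case: upper_borel_subgroup. Qed.

Lemma translate_borel g b : upper_borel b ->
  translate (g *m b) upper_borel = translate g upper_borel.
Proof.
move=> Bb; have [BG B1 BM BV] := upper_borel_subgroup.
apply/seteqP; split => _ [c Bc <-].
  by exists (b *m c); [apply: BM | rewrite mulmxA].
exists (invmx b *m c); first by apply: BM => //; apply: BV.
by rewrite mulmxA mulmxK //; apply: BG.
Qed.

Lemma translate_eq g h : GL g -> translate g upper_borel = translate h upper_borel ->
  exists2 b, upper_borel b & g = h *m b.
Proof.
move=> Gg E; have : translate h upper_borel g by rewrite -E; apply: translate_refl.
by move=> [b Bb <-]; exists b.
Qed.

Lemma permutation_matrixE w : permutation_matrix w = perm_mx w^-1 :> 'M[F]_n.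
Proof. by apply/matrixP => i j; rewrite !mxE -[in RHS](inj_eq (@perm_inj _ w)) permKV. Qed.

Lemma permutation_matrixK w : permutation_matrix w *m perm_mx w = 1%:M :> 'M[F]_n.
Proof. by rewrite permutation_matrixE -perm_mxM mulVg perm_mx1. Qed.

Lemma permutation_matrix_unit w : permutation_matrix w \in @unitmx F n.
Proof. by rewrite permutation_matrixE unitmx_perm. Qed.

Variable m : nat -> nat.

Definition staircase : set 'M[F]_n := [set g | GL g /\ supported (fun i j => i < m j)%N g].

Hypothesis m_mono : forall i j, (i <= j)%N -> (m i <= m j)%N.
Hypothesis m_gt : forall i, (i < n)%N -> (i < m i)%N.

Lemma staircase_closed : zariski_closed staircase.
Proof.
have := @closed_prescribed F n (fun i j => ~~ (i < m j)%N) 0; congr zariski_closed.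
apply/seteqP; split => g [Gg sg]; split => // i j.
  by apply: contraR => nm; rewrite sg // mxE.
by move=> nm; rewrite (supported_eq0 sg) // mxE.
Qed.

Lemma staircase_borel g b : staircase g -> upper_borel b -> staircase (g *m b).
Proof.
rewrite upper_borelE => -[Gg sg] [Gb sb]; split; first by rewrite /GL /= unitmx_mul Gg Gb.
by apply: supportedM sg sb => i j k ij jk; apply: leq_trans ij (m_mono jk).
Qed.

Lemma borel_staircase b g : upper_borel b -> staircase g -> staircase (b *m g).
Proof.
rewrite upper_borelE => -[Gb sb] [Gg sg]; split; first by rewrite /GL /= unitmx_mul Gg Gb.
by apply: supportedM sb sg => i j k; apply: leq_ltn_trans.
Qed.

Section Permutation.
Variable w : 'S_n.
Hypotheses (w_lt : forall k, (w k < m k)%N).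
Hypothesis w_max : forall j : 'I_n, exists2 i : 'I_n, (i <= j)%N & (w i).+1 = m j.
Hypothesis w_avoids : avoids_312 w.

Lemma permutation_staircase : staircase (permutation_matrix w).
Proof.
split; first exact: permutation_matrix_unit.
by move=> i j; rewrite mxE; case: (eqVneq i (w j)) => [->|_] //=; rewrite eqxx.
Qed.

(* If [l] is lower triangular and [l w] lies in the staircase, an entry of
   [w^-1 l w] below the diagonal would produce a pattern 312 in [w]. *)
Lemma staircase_cell g : staircase g -> trailing_minors (g *m perm_mx w) != 0 ->
  exists b c, [/\ upper_borel b, upper_borel c & g = b *m permutation_matrix w *m c].
Proof.
move=> Sg /upper_lower_decomposition [u [l [Uu Lu su sl E]]].
have Bu : upper_borel u by rewrite upper_borelE.
have [BG B1 BM BV] := upper_borel_subgroup.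
have gE : g = u *m (l *m permutation_matrix w).
  by rewrite mulmxA -E permutation_matrixE -mulmxA -perm_mxM mulgV perm_mx1 mulmx1.
have [_ slw] : staircase (l *m permutation_matrix w).
  by rewrite -[_ *m _](mulKmx Uu) -gE; apply: borel_staircase => //; apply: BV.
pose c := perm_mx w *m (l *m permutation_matrix w).
have lwE i j : (l *m permutation_matrix w) i j = l i (w j).
  by rewrite permutation_matrixE -col_permE mxE.
have cE p q : c p q = l (w p) (w q).
  by rewrite /c -row_permE mxE lwE.
exists u, c; split => //; last first.
  by rewrite /c [RHS]mulmxA -(mulmxA u) permutation_matrixK mulmx1.
rewrite upper_borelE; split.
  by rewrite /GL /= !unitmx_mul unitmx_perm Lu permutation_matrix_unit.
move=> p q; rewrite cE => nz; have wqp := sl _ _ nz.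
have : (w p < m q)%N by apply: slw; rewrite lwE.
have [i iq <-] := w_max q; rewrite ltnS leq_eqVlt => /orP [/eqP|wpi].
  by move/val_inj/perm_inj ->.
rewrite leqNgt; apply/negP => qp.
have wqp' : (w q < w p)%N.
  rewrite ltn_neqAle wqp andbT; apply: contraTneq qp => /val_inj/perm_inj ->.
  by rewrite ltnn.
apply: (@w_avoids i q p) => //; last by rewrite wqp'.
rewrite ltn_neqAle iq andbT; apply: contraTneq (ltn_trans wqp' wpi) => /val_inj ->.
by rewrite ltnn.
Qed.

(** Density of the cell: the invertible points on the line from the permutation matrix to [g] stay
    in the staircase, and those with nonzero trailing minors are in the cell. A polynomial vanishing
    on the cell thus vanishes on the line. *)
Lemma staircase_closure g Z : staircase g -> zariski_closed Z ->
  (forall b c, upper_borel b -> upper_borel c -> Z (b *m permutation_matrix w *m c)) -> Z g.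
Proof.
move=> Sg [I ->] BZ; split => [|p Ip]; first by case: Sg.
pose pw : 'M[F]_n := permutation_matrix w.
have [pd pdE] : @polynomial_fun F n (fun g => \det g).
  exact/polynomial_det/polynomial_entry.
have [pt ptE] : @polynomial_fun F n (fun g => trailing_minors (g *m perm_mx w)).
  apply/polynomial_trailing_minors/polynomial_mx_mul; first exact: polynomial_mx_id.
  exact: polynomial_mx_cst.
have [q qE] := polynomial_on_line p pw (g - pw).
have [qd qdE] := polynomial_on_line pd pw (g - pw).
have [qt qtE] := polynomial_on_line pt pw (g - pw).
have nz (r : {poly F}) t : r.[t] != 0 -> r != 0.
  by apply: contra_neq => ->; rewrite horner0.
apply: contrapT => /eqP pg.
have qn : q != 0 by apply: (@nz _ 1); rewrite -qE scale1r addrC subrK.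
have qdn : qd != 0.
  apply: (@nz _ 0); rewrite -qdE -pdE scale0r addr0 -unitfE -unitmxE.
  exact: permutation_matrix_unit.
have qtn : qt != 0.
  apply: (@nz _ 0); rewrite -qtE -ptE scale0r addr0.
  by rewrite permutation_matrixK trailing_minors1 oner_eq0.
have [t] := exists_nonroot (mulf_neq0 (mulf_neq0 qn qdn) qtn).
rewrite !hornerM !mulf_eq0 !negb_or => /andP [/andP [qt0 qdt] qtt].
have [_ sg] := Sg; have [_ sw] := permutation_staircase.
have [||b [c [Bb Bc E]]] := @staircase_cell (pw + t *: (g - pw)).
- split; first by rewrite /GL /= unitmxE unitfE pdE qdE.
  by apply: supportedD => //; apply/supportedZ/supportedD => //; apply: supportedN.
- by rewrite ptE qtE.
have [_ /(_ _ Ip)] := BZ b c Bb Bc; rewrite -E qE; exact/eqP.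
Qed.

Lemma schubert_varietyE :
  schubert_variety w = [set translate g upper_borel | g in staircase].
Proof.
have [BG B1 BM BV] := upper_borel_subgroup.
apply/seteqP; split => x.
  apply; split; last first.
    move=> _ [b Bb <-]; exists (b *m permutation_matrix w) => //.
    exact/borel_staircase/permutation_staircase.
  split; first by move=> _ [g [Gg _] <-]; exists g.
  have -> : \bigcup_(x in [set translate g upper_borel | g in staircase]) x = staircase.
    apply/seteqP; split => g.
      by move=> [_ [h Sh <-] [b Bb <-]]; apply: staircase_borel.
    by move=> Sg; exists (translate g upper_borel); [exists g | apply: translate_refl].
  exact: staircase_closed.
move=> [g Sg <-] Z [[Zf Zc] SZ].
have [|x' Zx' xg] := staircase_closure Sg Zc.
  move=> b c Bb Bc; exists (translate (b *m permutation_matrix w) upper_borel).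
    by apply: SZ; exists b.
  by exists c.
have [h Gh E] := Zf _ Zx'; rewrite -E in Zx' xg.
by have [b Bb <-] := xg; rewrite translate_borel.
Qed.

(** Constant on the rows between two consecutive heights and larger after each height, so its fibres
    are the blocks of the stabilizer. *)
Definition column_block (i : 'I_n) : nat := #|[set c : 'I_n | m c <= i]%N|%SET.

Lemma column_block_lt (i k c : 'I_n) : (k < m c)%N -> (m c <= i)%N ->
  (column_block k < column_block i)%N.
Proof.
move=> kc ci; apply: proper_card; apply/properP; split.
  apply/fintype.subsetP => d; rewrite !finset.in_set => dk.
  by apply: leq_trans dk _; apply: ltnW; apply: leq_trans kc ci.
by exists c; rewrite finset.in_set // -ltnNge.
Qed.

(** If the block of [k] precedes that of [i], some column [c] has its height in between. For
    [k != c] the matrix [1%:M + delta_mx k c] is in the staircase, and its product with [g] has at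
    [(i, c)] the entry [g i c + g i k]; both this sum and [g i c] must vanish. *)
Lemma stabilizer_schubert :
  stabilizer (schubert_variety w) = block_parabolic column_block :> set ('M[F]_n).
Proof.
rewrite schubert_varietyE.
have stair1 : staircase 1%:M.
  split; first exact: unitmx1.
  move=> i j; rewrite mxE; case: (eqVneq i j) => [-> _|_] /=; last by rewrite eqxx.
  exact: m_gt.
have PS g h : block_parabolic column_block g -> staircase h -> staircase (g *m h).
  move=> [Gg sg] [Gh sh]; split; first by rewrite /GL /= unitmx_mul Gg Gh.
  apply: supportedM sg sh => i k c ik kc; rewrite ltnNge; apply/negP => ci.
  by have := column_block_lt kc ci; rewrite ltnNge ik.
apply/seteqP; split => g [Gg sg]; split => //.
  have gS h : staircase h -> staircase (g *m h).
    move=> Sh; have : [set translate g x | x in [set translate g upper_borel | g in staircase]]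
        (translate (g *m h) upper_borel).
      by exists (translate h upper_borel); [exists h | rewrite translateM].
    rewrite sg => -[h' Sh' E]; have : translate h' upper_borel (g *m h).
      by rewrite E; apply: translate_refl.
    by move=> [b Bb <-]; apply: staircase_borel.
  move=> i k; apply: contraR; rewrite -ltnNge => ki.
  have [c kc ci] : exists2 c : 'I_n, (k < m c)%N & (m c <= i)%N.
    apply: contrapT => nc; move: ki; rewrite ltnNge subset_leq_card //.
    apply/fintype.subsetP => c; rewrite !finset.in_set => ci.
    by rewrite leqNgt; apply/negP => kc; apply: nc; exists c.
  have gic : g i c = 0.
    have [_ s1] := gS _ stair1; rewrite mulmx1 in s1.
    by apply: supported_eq0 s1 _; rewrite -leqNgt.
  case: (eqVneq k c) => [->|nkc]; first exact/eqP.
  have Sh : staircase (1%:M + delta_mx k c).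
    split.
      rewrite /GL /=; have : (1%:M + delta_mx k c) *m (1%:M - delta_mx k c) = 1%:M :> 'M[F]_n.
        rewrite mulmxDl mul1mx mulmxBr mulmx1 mul_delta_mx_cond eq_sym (negPf nkc).
        by rewrite mulr0n subr0 subrK.
      by case/mulmx1_unit.
    apply: supportedD; first by case: stair1.
    move=> a b; rewrite mxE; case: (eqVneq a k) => [->|_]; last by rewrite eqxx.
    by case: (eqVneq b c) => [->|_] //; rewrite eqxx.
  have [_ s1] := gS _ Sh; have nic : ~~ (i < m c)%N by rewrite -leqNgt.
  have := supported_eq0 s1 nic; rewrite mulmxDr mulmx1 mxE gic add0r mxE (bigD1 k) //=.
  rewrite big1 ?addr0; first by rewrite mxE !eqxx mulr1 => ->.
  by move=> d dk; rewrite mxE (negPf dk) mulr0.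
have Pg : block_parabolic column_block g by [].
have [_ _ _ PV] := block_parabolic_subgroup (F := F) column_block.
apply/seteqP; split => x.
  move=> [_ [h Sh <-] <-]; exists (g *m h); first exact: PS.
  by rewrite translateM.
move=> [h Sh <-]; exists (translate (invmx g *m h) upper_borel).
  by exists (invmx g *m h) => //; apply: PS => //; apply: PV.
by rewrite translateM mulmxA mulmxV // mul1mx.
Qed.
End Permutation.
End Cells.

(** * Column heights of a Dyck path and the Bandlow-Killpatrick permutation *)

Section Heights.
Local Open Scope nat_scope.

Fixpoint heights (y : nat) (p : path_word) : seq nat :=
  match p with
  | [::] => [::]
  | s :: p' => if s then heights y.+1 p' else y :: heights y p'
  end.

(** Past the last column the default is the number of North steps, so the function stays monotone on
    all of [nat]. *)
Definition column_height (p : path_word) (j : nat) : nat :=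
  nth (count_mem North p) (heights 0 p) j.

Lemma xcoord_cons s p k : xcoord (s :: p) k.+1 = ~~ s + xcoord p k.
Proof. by rewrite /xcoord /=; case: s. Qed.

Lemma ycoord_cons s p k : ycoord (s :: p) k.+1 = s + ycoord p k.
Proof. by rewrite /ycoord /=; case: s. Qed.

Lemma size_heights y p : size (heights y p) = count_mem East p.
Proof. by elim: p y => //= -[] p IH y /=; rewrite IH. Qed.

Lemma nth_heights d y p k : k < size p -> nth North p k = East ->
  nth d (heights y p) (xcoord p k) = y + ycoord p k.
Proof.
elim: p y k => // s p IH y [|k] /=; first by move=> _ ->; rewrite /xcoord /ycoord /= addn0.
rewrite ltnS xcoord_cons ycoord_cons => kp pk.
by case: s => /=; rewrite IH // ?addnS.
Qed.

Lemma exists_east p j : j < count_mem East p ->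
  exists2 k, k < size p & nth North p k = East /\ xcoord p k = j.
Proof.
elim: p j => // -[] p IH j /=.
  by rewrite add0n => /IH [k kp [pk xk]]; exists k.+1.
rewrite add1n; case: j => [|j]; first by exists 0.
rewrite ltnS => /IH [k kp [pk xk]]; exists k.+1 => //.
by rewrite xcoord_cons xk.
Qed.

Lemma xcoordS p k : k < size p -> xcoord p k.+1 = xcoord p k + (nth North p k == East).
Proof.
by move=> kp; rewrite /xcoord (take_nth North) // -cats1 count_cat /= addn0.
Qed.

Lemma ycoordS p k : k < size p -> ycoord p k.+1 = ycoord p k + nth North p k.
Proof.
move=> kp; rewrite /ycoord (take_nth North) // -cats1 count_cat /= addn0.
by case: (nth _ _ _).
Qed.

Lemma count_take_mono (T : Type) (a : pred T) s k l : k <= l ->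
  count a (take k s) <= count a (take l s).
Proof.
move=> kl; rewrite -(cat_take_drop k (take l s)) count_cat take_takel //.
exact: leq_addr.
Qed.

Lemma xcoord_mono p k l : k <= l -> xcoord p k <= xcoord p l.
Proof. exact: count_take_mono. Qed.

Lemma ycoord_mono p k l : k <= l -> ycoord p k <= ycoord p l.
Proof. exact: count_take_mono. Qed.

Lemma ycoord_le p k : ycoord p k <= count_mem North p.
Proof. by rewrite /ycoord -[in X in _ <= X](cat_take_drop k p) count_cat leq_addr. Qed.

Variables (n : nat) (p : path_word).
Hypothesis p_dyck : is_dyck_path n p.
Let m := column_height p.

Lemma column_height_east k : k < size p -> nth North p k = East ->
  m (xcoord p k) = ycoord p k.
Proof. by move=> kp pk; rewrite /m /column_height nth_heights. Qed.

Lemma column_height_default j : n <= j -> m j = n.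
Proof.
have [N E _] := p_dyck.
by move=> nj; rewrite /m /column_height nth_default // size_heights E.
Qed.

Lemma column_height_le j : m j <= n.
Proof.
have [N E _] := p_dyck; case: (ltnP j n) => [jn|/column_height_default -> //].
have [|k kp [pk <-]] := @exists_east p j; first by rewrite E.
by rewrite column_height_east // -N ycoord_le.
Qed.

Lemma column_height_mono i j : i <= j -> m i <= m j.
Proof.
have [N E _] := p_dyck; case: (ltnP j n) => [jn|/column_height_default ->]; last first.
  by move=> _; apply: column_height_le.
rewrite leq_eqVlt => /predU1P [->//|ij].
have [|k kp [pk xk]] := @exists_east p i; first by rewrite E; lia.
have [|l lp [pl xl]] := @exists_east p j; first by rewrite E.
rewrite -xk -xl !column_height_east //; apply: ycoord_mono.
by rewrite leqNgt; apply/negP => /ltnW /(xcoord_mono p); lia.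
Qed.

Lemma column_height_gt i : i < n -> i < m i.
Proof.
have [N E D] := p_dyck => ilt.
have [|k kp [pk <-]] := @exists_east p i; first by rewrite E.
rewrite column_height_east //; have := D k.+1 kp.
by rewrite xcoordS // ycoordS // pk /= addn0 addn1.
Qed.

Lemma square_belowE i j : j < n -> square_below p i j = (i < m j).
Proof.
have [N E _] := p_dyck => jn; apply/existsP/idP => [[k /and3P [/eqP pk /eqP <-]]|ij].
  by rewrite column_height_east.
have [|k kp [pk xk]] := @exists_east p j; first by rewrite E.
by exists (Ordinal kp); rewrite /= pk xk !eqxx -column_height_east // xk.
Qed.

Definition exchange j x := if x == j then j.+1 else if x == j.+1 then j else x.

(** The number [c] of columns already read is a parameter for the sake of induction; the full row is
    [c = n]. *)
Definition row_action i c x :=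
  foldl (fun x j => if (j < i) && (i < m j) then exchange j x else x) x (iota 0 c).

Lemma exists_threshold i : i < n ->
  exists2 l, l <= i & forall j, (i < m j) = (l <= j).
Proof.
move=> ilt; have ex : exists j, i < m j by exists i; apply: column_height_gt.
have [l li lmin] := ex_minnP ex; exists l; first by apply/lmin/column_height_gt.
by move=> j; apply/idP/idP => [/lmin//|/column_height_mono]; lia.
Qed.

(* The [i]-th row is the cycle taking the first column [l] of height above [i]
   to [i] and decreasing the elements of [(l, i]]. *)
Lemma row_actionE i l c x : l <= i -> (forall j, (i < m j) = (l <= j)) ->
  row_action i c x =
    if x < l then x else if x == l then (if c <= l then l else minn c i)
    else if x <= i then (if x <= c then x.-1 else x) else x.
Proof.
move=> li lP; rewrite /minn; elim: c => [|c IH]; first by rewrite /row_action /=; do ?case: ifP => ? //=; lia.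
have -> : row_action i c.+1 x =
    if (c < i) && (i < m c) then exchange c (row_action i c x) else row_action i c x.
  by rewrite /row_action -[in iota _ _]addn1 iotaD foldl_cat.
rewrite lP /exchange; move: (row_action i c x) IH => y.
by do ?case: ifP => ? //=; lia.
Qed.

(** The rows below [k], from the top down: what remains once the rows from [k] upwards have been
    read. *)
Definition path_action k x := foldl (fun x i => row_action i n x) x (rev (iota 0 k)).

Lemma path_actionS k x : path_action k.+1 x = path_action k (row_action k n x).
Proof. by rewrite /path_action -[k.+1]addn1 iotaD add0n /= cats1 rev_rcons. Qed.

(** The first disjunct means that [x] is settled, since rows below [i] fix everything from [i]
    upwards. Before that, a row either lowers or fixes [x], which stays at most [k], or sends it to
    the row number; then [x] is a column of height above that row, and monotonicity gives the
    bound. *)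
Lemma path_action_lt k i x : k < n -> i <= n ->
  (x < m k) && (i <= x) || (x < i) && (x <= k) -> path_action i x < m k.
Proof.
move=> kn; elim: i x => [|i IH] x ilt; first by rewrite /path_action /=; lia.
move=> xP; rewrite path_actionS; apply: IH; first exact: ltnW.
have [l li lP] := exists_threshold ilt; rewrite (row_actionE _ _ li lP).
by have := lP k; rewrite /minn; do ?case: ifP => ? //=; lia.
Qed.

(** Rows above [a] start after column [j], whose height is only [a.+1], and fix [j]; row [a] sends
    [j] to [a]; the rows below fix [a]. *)
Lemma path_action_eq j a i x : j < n -> m j = a.+1 -> (forall j', (a < m j') = (j <= j')) ->
  i <= n -> x = (if a < i then j else a) -> path_action i x = a.
Proof.
move=> jn mj jP; elim: i x => [|i IH] x ilt; first by rewrite /path_action.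
move=> xP; rewrite path_actionS; apply: IH; first exact: ltnW.
have [l li lP] := exists_threshold ilt; rewrite (row_actionE _ _ li lP).
have := lP j; rewrite mj; have := jP l; have := lP l; have := jP j.
have := column_height_gt jn; rewrite mj.
by move: xP; rewrite ltnS /minn; do ?case: ifP => ? //=; lia.
Qed.

Lemma prod_perm_foldl (I : Type) (s : seq I) (P : pred I) (t : I -> 'S_n) (q : 'I_n) :
  (\prod_(j <- s | P j) t j)%g q = foldl (fun x j => if P j then t j x else x) q s.
Proof.
elim: s q => [|j s IH] q; first by rewrite big_nil perm1.
by rewrite big_cons /=; case: (P j); rewrite ?permM IH.
Qed.

Lemma val_foldl (I J : Type) (h : I -> J) (s : seq I) (f : 'I_n -> I -> 'I_n)
    (f' : nat -> J -> nat) (q : 'I_n) :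
  (forall x j, val (f x j) = f' (val x) (h j)) ->
  val (foldl f q s) = foldl f' (val q) (map h s).
Proof. by move=> ff'; elim: s q => //= j s IH q; rewrite IH ff'. Qed.

Lemma bandlow_killpatrickE (q : 'I_n) : bandlow_killpatrick n p q = path_action n q :> nat.
Proof.
rewrite /bandlow_killpatrick prod_perm_foldl /path_action.
rewrite (@val_foldl _ _ val _ _ (fun x i => row_action i n x)) ?map_rev ?val_enum_ord //.
move=> x i; rewrite prod_perm_foldl /row_action.
rewrite (@val_foldl _ _ val _ _
  (fun x j => if (j < i) && (i < m j) then exchange j x else x)) ?val_enum_ord //.
move=> y j; rewrite square_belowE //; case: ifP => // /andP [ji _].
have jS : val (ordS j) = j.+1 by rewrite /= modn_small //; apply: leq_ltn_trans ji _.
rewrite /exchange; case: tpermP => [->|->|/eqP yj /eqP yS]; rewrite ?jS ?eqxx //.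
  by rewrite eqn_leq ltnn.
by rewrite -[y == _ :> nat]/(val y == val j) val_eqE (negPf yj) -jS val_eqE (negPf yS).
Qed.

Lemma bandlow_killpatrick_lt (k : 'I_n) : bandlow_killpatrick n p k < m k.
Proof. by rewrite bandlow_killpatrickE; apply: path_action_lt => //=; rewrite ltn_ord leqnn orbT. Qed.

Lemma bandlow_killpatrick_max (j : 'I_n) :
  exists2 i : 'I_n, i <= j & (bandlow_killpatrick n p i).+1 = m j.
Proof.
have := column_height_le j; have := column_height_gt (ltn_ord j).
case mj : (m j) => [//|a] ja an.
have [l la lP] := exists_threshold an.
have lj : l <= j by rewrite -lP mj.
have ln : l < n by apply: leq_ltn_trans lj _.
exists (Ordinal ln) => //; rewrite bandlow_killpatrickE (path_action_eq (j := l) (a := a)) //.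
  by have := lP l; have := column_height_mono lj; rewrite -/m mj; lia.
by rewrite an.
Qed.
End Heights.

(** * A one-parameter family of orbits *)

Section InfiniteFamily.
Context {F : numClosedFieldType} {n : nat}.
Variables (m : nat -> nat) (R : rel 'I_n) (t : 'S_n) (p0 p1 p2 p3 : 'I_n).
Hypothesis m_mono : forall i j, (i <= j)%N -> (m i <= m j)%N.
Hypothesis R_refl : reflexive R.
Hypotheses (p01 : (p0 < p1)%N) (p12 : (p1 < p2)%N) (p23 : (p2 < p3)%N).
Hypothesis t_lt : forall q, (t q < m q)%N.
Hypotheses (t3_lt : (t p3 < m p0)%N) (t2_lt : (t p2 < m p1)%N).
Let R' a b := R (t a) (t b).
Hypotheses (R01 : ~~ R' p0 p1) (R02 : ~~ R' p0 p2) (R03 : ~~ R' p0 p3).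
Hypotheses (R12 : ~~ R' p1 p2) (R13 : ~~ R' p1 p3).
Hypotheses (R20 : ~~ R' p2 p0) (R21 : ~~ R' p2 p1).
Hypotheses (R30 : ~~ R' p3 p0) (R31 : ~~ R' p3 p1) (R32 : ~~ R' p3 p2).

(** The torus preserves the entry at [(p3, p2)] times the one at [(p2, p1)] divided by the one at
    [(p3, p1)], which is [c] here. The entry at [(p3, p0)] keeps the group from adding row [p3] to
    row [p2]. *)
Definition family_lower (c : F) : 'M[F]_n :=
  1%:M + delta_mx p3 p0 + delta_mx p2 p1 + delta_mx p3 p1 + c *: delta_mx p3 p2.

Definition family (c : F) : 'M[F]_n := permutation_matrix t *m family_lower c.

Let mul_delta (A : 'M[F]_n) (a b i j : 'I_n) : (A *m delta_mx a b) i j = A i a * (j == b)%:R.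
Proof.
rewrite mxE (bigD1 a) //= big1 ?addr0; first by rewrite mxE eqxx.
by move=> k ka; rewrite mxE (negPf ka) mulr0.
Qed.

Let delta_mul (A : 'M[F]_n) (a b i j : 'I_n) : (delta_mx a b *m A) i j = (i == a)%:R * A b j.
Proof.
rewrite mxE (bigD1 b) //= big1 ?addr0; first by rewrite mxE eqxx andbT.
by move=> k kb; rewrite mxE (negPf kb) andbF mul0r.
Qed.

Let mul_family (A : 'M[F]_n) c (i j : 'I_n) : (A *m family_lower c) i j =
  A i j + A i p3 * (j == p0)%:R + A i p2 * (j == p1)%:R + A i p3 * (j == p1)%:R +
  c * (A i p3 * (j == p2)%:R).
Proof.
by rewrite /family_lower !mulmxDr mulmx1 -scalemxAr !mxE -!mul_delta !mxE.
Qed.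

Let family_mul (A : 'M[F]_n) c (i j : 'I_n) : (family_lower c *m A) i j =
  A i j + (i == p3)%:R * A p0 j + (i == p2)%:R * A p1 j + (i == p3)%:R * A p1 j +
  c * ((i == p3)%:R * A p2 j).
Proof.
by rewrite /family_lower !mulmxDl mul1mx -scalemxAl !mxE -!delta_mul !mxE.
Qed.

Let ne (a b : 'I_n) : (a < b)%N -> ((a == b) = false) * ((b == a) = false).
Proof. by move=> ab; split; apply/eqP => E; move: ab; rewrite E ltnn. Qed.

Let p02 : (p0 < p2)%N. Proof. exact: ltn_trans p12. Qed.
Let p03 : (p0 < p3)%N. Proof. exact: ltn_trans p23. Qed.
Let p13 : (p1 < p3)%N. Proof. exact: ltn_trans p23. Qed.

Let neqs := (ne p01, ne p02, ne p03, ne p12, ne p13, ne p23, eqxx).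

Lemma family_staircase c : staircase m (family c).
Proof.
have lowE i j : family_lower c i j != 0 ->
    [\/ i = j, (i = p3) /\ (p0 <= j < p3)%N | (i = p2) /\ (p1 <= j < p2)%N].
  case: (eqVneq i j) => [|ij]; first by constructor 1.
  rewrite !mxE (negPf ij) mulr0n add0r.
  case: (eqVneq i p3) => [->|i3] /=.
    case: (eqVneq j p0) => [->|_]; first by constructor 2; rewrite leqnn p03.
    case: (eqVneq j p1) => [->|_]; first by constructor 2; rewrite (ltnW p01) p13.
    case: (eqVneq j p2) => [->|_]; first by constructor 2; rewrite (ltnW p02) p23.
    by rewrite !andbF mulr0 !addr0 eqxx.
  case: (eqVneq i p2) => [->|i2] /=; last by rewrite mulr0 !addr0 eqxx.
  case: (eqVneq j p1) => [->|_]; first by constructor 3; rewrite leqnn p12.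
  by rewrite mulr0 !addr0 eqxx.
split.
  rewrite /GL /= unitmx_mul permutation_matrix_unit /= unitmxE det_trig.
    rewrite big1 ?unitr1 // => i _; rewrite !mxE eqxx.
    case: (eqVneq i p3) => [->|i3]; first by rewrite !neqs /= mulr0 !addr0.
    case: (eqVneq i p2) => [->|i2]; first by rewrite !neqs /= mulr0 !addr0.
    by rewrite /= mulr0 !addr0.
  apply/is_trig_mxP => i j ij; apply/eqP; apply: contraLR ij => /lowE; rewrite -leqNgt.
  by case=> [->//|[-> /andP [_ /ltnW]]|[-> /andP [_ /ltnW]]].
move=> i j; rewrite /family permutation_matrixE -row_permE mxE => /lowE.
case=> [E|[E /andP [l _]]|[E /andP [l _]]].
- by rewrite -(permKV t i) E.
- by rewrite -(permKV t i) E; apply: leq_trans t3_lt (m_mono l).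
- by rewrite -(permKV t i) E; apply: leq_trans t2_lt (m_mono l).
Qed.

(** Entry [(p2, p0)] kills [k p2 p3], and entries [(p0, p1)], [(p0, p2)], [(p1, p2)] kill those of
    [b]. Column [p1] then gives [k p3 p3 = b p1 p1 = k p2 p2], entry [(p2, p2)] gives
    [k p2 p2 = b p2 p2], and entry [(p3, p2)] reads [c * k p3 p3 = c' * b p2 p2]. *)
Lemma family_orbit_inj c c' h b : incidence_group R h -> upper_borel b ->
  h *m family c = family c' *m b -> c = c'.
Proof.
move=> [_ sh]; rewrite upper_borelE => -[Gb sb] E.
pose k : 'M[F]_n := \matrix_(i, j) h (t i) (t j).
have Ek : k *m family_lower c = family_lower c' *m b.
  have -> : k = perm_mx t *m h *m permutation_matrix t.
    rewrite permutation_matrixE -row_permE -col_permE.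
    by apply/matrixP => i j; rewrite !mxE.
  rewrite -!mulmxA -/(family c) E /family !mulmxA.
  by rewrite permutation_matrixE -perm_mxM mulgV perm_mx1 mul1mx.
have k0 i j : ~~ R' i j -> k i j = 0 by move=> nR; rewrite mxE (supported_eq0 sh).
have b0 (i j : 'I_n) : (j < i)%N -> b i j = 0.
  by move=> ji; apply: (supported_eq0 sb); rewrite -ltnNge.
have e i j : (k *m family_lower c) i j = (family_lower c' *m b) i j by rewrite Ek.
pose zs := (k0 _ _ R01, k0 _ _ R02, k0 _ _ R03, k0 _ _ R12, k0 _ _ R13, k0 _ _ R20,
  k0 _ _ R21, k0 _ _ R30, k0 _ _ R31, k0 _ _ R32,
  (b0 _ _ p01, b0 _ _ p02, b0 _ _ p03, b0 _ _ p12, b0 _ _ p13, b0 _ _ p23)).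
pose ar := (mul0r, mulr0, mul1r, mulr1, addr0, add0r).
have := e p2 p0; have := e p3 p0; have := e p0 p1; have := e p1 p1; have := e p2 p1.
have := e p3 p1; have := e p0 p2; have := e p1 p2; have := e p2 p2; have := e p3 p2.
rewrite !mul_family !family_mul !neqs !zs /= !ar => e32 e22 e12 e02 e31 e21 _ e01 _ e20.
have b22 : b p2 p2 != 0.
  have : \det b^T != 0 by rewrite det_tr -unitfE -unitmxE.
  rewrite det_trig; last by apply/is_trig_mxP => i j ij; rewrite mxE b0.
  by move/prodf_neq0 => /(_ p2 isT); rewrite mxE.
apply: (mulIf b22); move: e32 e22 e31 e21.
by rewrite e20 -e12 -e02 -e01 !ar => <- <- -> ->.
Qed.

Lemma infinitely_many_orbits :
  ~ finitely_many_orbits (incidence_group R)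
      [set translate g upper_borel | g in (staircase m : set 'M[F]_n)].
Proof.
rewrite /finitely_many_orbits; set A := (X in finite_set X) => Afin.
pose u (k : nat) := orbit_of (incidence_group R) (translate (family k%:R) upper_borel).
have uA k : A (u k).
  by exists (translate (family k%:R) upper_borel) => //; exists (family k%:R) => //;
     apply: family_staircase.
have u_inj : injective u.
  move=> k l E; apply/eqP; rewrite -(eqr_nat F); apply/eqP.
  have : u k (translate (family k%:R) upper_borel).
    exists 1%:M; last exact: translate1.
    by split; [exact: unitmx1 | exact: supported_scalar].
  rewrite E => -[h Hh]; rewrite translateM => /translate_eq [|b Bb Eb].
    have [Gh _] := Hh; have [Gf _] := family_staircase l%:R.
    by rewrite /GL /= unitmx_mul Gh Gf.
  by rewrite (family_orbit_inj Hh Bb Eb).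
apply: infinite_nat; have := @finite_preimage _ _ A u (in2W u_inj) Afin.
by congr finite_set; apply/seteqP; split => // k _; apply: uA.
Qed.
End InfiniteFamily.

(** * Obstructions to sphericity *)

(** The valley before column [j] is the point [(j, m j.-1)]. In the second alternative
    [m j' = m j.-1] says that the valley before column [j'] is the one just preceding, and
    [j' < m j'.-1] that it lies off the diagonal, hence in the same component. *)
Definition obstruction (n : nat) (m : nat -> nat) : Prop :=
  exists j : nat, [/\ (0 < j < n)%N, (m j.-1 < m j)%N, (j.+2 <= m j.-1)%N &
    ((m j.-1).+2 <= m j)%N \/
    exists j' : nat, [/\ (0 < j' < j)%N, (m j'.-1 < m j')%N,
      m j' = m j.-1 & (j' < m j'.-1)%N]].

Section Obstruction.
Variables (n : nat) (m : nat -> nat).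
Hypothesis m_mono : forall i j, (i <= j)%N -> (m i <= m j)%N.
Hypothesis m_gt : forall i, (i < n)%N -> (i < m i)%N.
Hypothesis m_le : forall i, (m i <= n)%N.

(* Listing the missing values increasingly, the value in position [q] is at most [q]
   since all smaller values come before it. *)
Lemma complete_permutation (s : seq nat) : uniq s -> all (gtn n) s ->
  (forall q, (q < size s)%N -> (nth 0 s q < m q)%N) ->
  exists t : 'S_n, (forall q, (t q < m q)%N) /\
    forall q : 'I_n, (q < size s)%N -> t q = nth 0%N s q :> nat.
Proof.
move=> us sn sm; pose r := [seq x <- iota 0 n | x \notin s]; pose s' := s ++ r.
have us' : uniq s'.
  rewrite cat_uniq us filter_uniq ?iota_uniq // andbT.
  by apply/hasPn => x; rewrite mem_filter => /andP [].
have ms' x : (x \in s') = (x < n)%N.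
  rewrite mem_cat mem_filter mem_iota /= add0n.
  by case: (boolP (x \in s)) => //= /(allP sn) /= ->.
have ss' : size s' = n.
  rewrite -[RHS](size_iota 0); apply/perm_size/uniq_perm; rewrite ?iota_uniq //.
  by move=> x; rewrite ms' mem_iota.
have tn (q : 'I_n) : (nth 0%N s' q < n)%N by rewrite -ms' mem_nth // ss'.
have t_inj : injective (fun q => Ordinal (tn q)).
  move=> q q' [] /eqP; rewrite nth_uniq ?ss' // => /eqP; exact: val_inj.
exists (perm t_inj); split=> q; rewrite permE /=; last by move=> qs; rewrite nth_cat qs.
rewrite nth_cat; case: (ltnP q (size s)) => [qs|sq]; first exact: sm.
apply: leq_ltn_trans (m_gt (ltn_ord q)).
set k := (q - size s)%N; set x := nth 0%N r k.
have kr : (k < size r)%N.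
  by rewrite /k ltn_subLR // -size_cat ss'.
have dr : drop k r = x :: drop k.+1 r by rewrite (drop_nth 0%N).
have sr : sorted ltn (drop k r).
  by apply/drop_sorted/sorted_filter; [exact: ltn_trans | exact: iota_ltn_sorted].
have xr y : y \in drop k r -> (x <= y)%N.
  rewrite dr inE => /predU1P [->//|]; move: sr; rewrite dr /= => /(order_path_min ltn_trans).
  by move=> /allP h /h /ltnW.
have xn : (x < n)%N by rewrite -ms' mem_cat mem_nth ?orbT.
have : {subset iota 0 x <= s ++ take k r}.
  move=> y; rewrite mem_iota /= add0n => yx.
  have : y \in (s ++ take k r) ++ drop k r.
    by rewrite -catA cat_take_drop ms'; apply: ltn_trans xn.
  by rewrite mem_cat => /orP [//|/xr]; rewrite leqNgt yx.
move/(uniq_leq_size (iota_uniq _ _)); rewrite size_iota size_cat size_take kr /k.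
by rewrite subnKC.
Qed.

Variables (F : numClosedFieldType) (f : 'I_n -> nat).
Hypothesis f_inj : injective f.
Let be : 'I_n -> nat := column_block m.

(** The columns after [s] receive [e3], [e4], [e1], [e2] in this order. The relations that may
    survive, from [e1] to [e2] and from [e4] to [e3], are then the two that [infinitely_many_orbits]
    tolerates. *)
Let infinite_orbits_ordered (s : seq nat) (e1 e2 e3 e4 : 'I_n) :
  uniq (s ++ [:: val e3; val e4; val e1; val e2]) -> all (gtn n) s ->
  (forall q, (q < size s)%N -> (nth 0 s q < m q)%N) ->
  (e3 < m (size s))%N -> (e2 < m (size s))%N ->
  (e4 < m (size s).+1)%N -> (e1 < m (size s).+1)%N ->
  be e1 != be e3 -> be e1 != be e4 -> be e2 != be e3 -> be e2 != be e4 ->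
  (f e1 < f e2)%N -> (be e4 == be e3 -> f e4 < f e3)%N ->
  ~ finitely_many_orbits (block_borel be f)
      [set translate g upper_borel | g in (staircase m : set 'M[F]_n)].
Proof.
move=> us sn sm m3 m2 m4 m1 n13 n14 n23 n24 f12 f43.
set s' := s ++ _ in us; pose J := size s.
have [|q|t [t_lt tE]] := complete_permutation us.
- by rewrite all_cat sn /= !ltn_ord.
- rewrite size_cat /= nth_cat => ql; case: (ltnP q (size s)) => [qs|Jq]; first exact: sm.
  have mJ := m_mono Jq.
  case: (ltngtP (q - J) 1) => [q0|q2|q1].
  + have -> : (q - size s = 0)%N by rewrite -/J; lia.
    exact: leq_trans mJ.
  + have mJ1 : (m J.+1 <= m q)%N by apply: m_mono; lia.
    have [E|E] : (q - size s = 2 \/ q - size s = 3)%N by rewrite -/J; lia.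
      by rewrite E /=; apply: leq_trans mJ1.
    by rewrite E /=; apply: leq_trans mJ.
  + rewrite -/J q1 /=; apply: leq_trans m4 (m_mono _); rewrite -/J; lia.
have ss' : size s' = (J + 4)%N by rewrite size_cat.
have Jn : (J + 4 <= n)%N.
  rewrite -ss' -[X in (_ <= X)%N](size_iota 0); apply: uniq_leq_size => // x.
  rewrite mem_iota /= add0n mem_cat => /orP [/(allP sn)//|].
  by rewrite !inE => /or4P [] /eqP -> /=; apply: ltn_ord.
have l0 : (J < n)%N by lia.
have l1 : (J.+1 < n)%N by lia.
have l2 : (J.+2 < n)%N by lia.
have l3 : (J.+3 < n)%N by lia.
have tJ (q : 'I_n) i : q = (J + i)%N :> nat -> (i < 4)%N ->
    t q = nth 0%N [:: val e3; val e4; val e1; val e2] i :> nat.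
  move=> qE i4; rewrite tE ?ss' qE; last by rewrite ltn_add2l.
  by rewrite nth_cat ltnNge leq_addr /= addKn.
have E0 : t (Ordinal l0) = e3 by apply/ord_inj/(tJ _ 0%N) => //=; rewrite addn0.
have E1 : t (Ordinal l1) = e4 by apply/ord_inj/(tJ _ 1%N) => //=; rewrite addn1.
have E2 : t (Ordinal l2) = e1 by apply/ord_inj/(tJ _ 2%N) => //=; rewrite addn2.
have E3 : t (Ordinal l3) = e2 by apply/ord_inj/(tJ _ 3%N) => //=; rewrite addn3.
apply: (@infinitely_many_orbits F n m _ t (Ordinal l0) (Ordinal l1) (Ordinal l2) (Ordinal l3));
  rewrite ?E0 ?E1 ?E2 ?E3 //=.
- by move=> i; rewrite eqxx leqnn.
- by case: (boolP (be e4 == be e3)) f43 => [/eqP -> /(_ isT)|]; rewrite ?eqxx //=;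
    rewrite ?ltnNge // eq_sym => /negPf ->.
- by rewrite eq_sym (negPf n13).
- by rewrite eq_sym (negPf n23).
- by rewrite eq_sym (negPf n14).
- by rewrite eq_sym (negPf n24).
- by rewrite (negPf n13).
- by rewrite (negPf n14).
- by rewrite (negPf n23).
- by rewrite (negPf n24).
- by rewrite negb_and -ltnNge f12 orbT.
Qed.

Let infinite_orbits_pair (s : seq nat) (u v e3 e4 : 'I_n) :
  uniq (s ++ [:: val e3; val e4; val u; val v]) -> all (gtn n) s ->
  (forall q, (q < size s)%N -> (nth 0 s q < m q)%N) ->
  (e3 < m (size s))%N -> (u < m (size s))%N -> (v < m (size s))%N ->
  (e4 < m (size s).+1)%N ->
  be u != be e3 -> be u != be e4 -> be v != be e3 -> be v != be e4 ->
  (be e4 == be e3 -> f e4 < f e3)%N ->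
  ~ finitely_many_orbits (block_borel be f)
      [set translate g upper_borel | g in (staircase m : set 'M[F]_n)].
Proof.
move=> us sn sm m3 mu mv m4 u3 u4 v3 v4 f43.
have mJ := m_mono (leqnSn (size s)).
case: (ltngtP (f u) (f v)) => [fuv|fvu|/f_inj uv].
- by apply: (infinite_orbits_ordered us) => //; apply: leq_trans mJ.
- apply: (@infinite_orbits_ordered s v u e3 e4) => //; last exact: leq_trans mJ.
  rewrite (perm_uniq (s2 := s ++ [:: val e3; val e4; val u; val v])) //.
  by rewrite perm_cat2l !perm_cons -[[:: val v; _]]/([:: val v] ++ [:: val u]) perm_catC.
by move: us; rewrite uv cat_uniq /= !inE eqxx !andbF.
Qed.

Let be_neq (c i k : 'I_n) : (k < m c)%N -> (m c <= i)%N -> be k != be i.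
Proof. by move=> kc ci; rewrite ltn_eqF // (column_block_lt kc ci). Qed.

Lemma obstruction_infinitely_many_orbits : obstruction n m ->
  ~ finitely_many_orbits (block_borel be f)
      [set translate g upper_borel | g in (staircase m : set 'M[F]_n)].
Proof.
move=> [j [/andP [j0 jn] asc jd]]; set h := m j.-1 in asc jd *.
have hn : (h < n)%N by apply: leq_trans asc (m_le _).
have j1n : (j.-1 < n)%N by lia.
pose c : 'I_n := Ordinal j1n.
pose eh : 'I_n := Ordinal hn.
case=> [asc2|[j' [/andP [j'0 j'j] asc' mj' jd']]].
  (* Here [j] and [j.+1] lie below [h], and column [c] separates them from [h] and [h.+1]. The order
     of [h] and [h.+1] under [f] is not known, so [key] covers both. *)
  have h1n : (h.+1 < n)%N by apply: leq_trans asc2 (m_le _).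
  have j1 : (j.+1 < n)%N by lia.
  pose e1 : 'I_n := Ordinal jn; pose e2 : 'I_n := Ordinal j1; pose eh1 : 'I_n := Ordinal h1n.
  have hm : (h <= m j)%N by apply: ltnW.
  have key (a b : 'I_n) : (a = eh /\ b = eh1) \/ (a = eh1 /\ b = eh) -> (f a < f b)%N ->
    ~ finitely_many_orbits (block_borel be f)
      [set translate g upper_borel | g in (staircase m : set 'M[F]_n)].
    move=> ab fab; have hab : (h <= a)%N /\ (h <= b)%N by case: ab => -[-> ->] /=; lia.
    have mab : (a < m j)%N /\ (b < m j)%N by case: ab => -[-> ->] /=; lia.
    have nab : (val a != val b)%N by case: ab => -[-> ->] /=; lia.
    have [[ha hb] [ma mb]] := (hab, mab).
    apply: (@infinite_orbits_pair (iota 0 j) e1 e2 b a); rewrite ?size_iota //=.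
    - rewrite cat_uniq iota_uniq /= !inE !mem_iota /= !add0n.
      move: nab ha hb jd => /=; lia.
    - by apply/allP => x; rewrite mem_iota /=; lia.
    - by move=> q qj; rewrite nth_iota // add0n; apply: m_gt; lia.
    - lia.
    - lia.
    - by apply: leq_trans ma (m_mono _).
    - by apply: (@be_neq c) => //=; rewrite -/h; lia.
    - by apply: (@be_neq c) => //=; rewrite -/h; lia.
    - by apply: (@be_neq c) => //=; rewrite -/h; lia.
    - by apply: (@be_neq c) => //=; rewrite -/h; lia.
  case: (ltngtP (f eh) (f eh1)) => [fl|fl|/f_inj /(congr1 val) /=].
  - by apply: (key eh eh1) => //; left.
  - by apply: (key eh1 eh) => //; right.
  - lia.
have j'1n : (j'.-1 < n)%N by lia.
pose c' : 'I_n := Ordinal j'1n.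
(* [y] and [z] are the rows just below the two valleys. The first [j.-1] columns take the smallest
   values other than [y], and [x] is the next such value. Column [c'] separates [y] from [z], and
   column [c] separates [x], [y], [z] from [h]. *)
pose y := (m j'.-1).-1; pose z := h.-1; pose x := bump y j.-1.
have yn : (y < n)%N by rewrite /y; have := m_le j'.-1; lia.
have zn : (z < n)%N by rewrite /z; lia.
have xz : (x < z)%N by rewrite /x /z /bump; lia.
have xn : (x < n)%N by lia.
have yz : (y < z)%N by rewrite /y /z; lia.
have xy : x != y by rewrite /x /bump; lia.
pose ex : 'I_n := Ordinal xn; pose ey : 'I_n := Ordinal yn; pose ez : 'I_n := Ordinal zn.
have nyz : be ey != be ez by apply: (@be_neq c') => /=; rewrite /y /z; lia.
have nh (a : 'I_n) : (a < h)%N -> be a != be eh by move=> ah; apply: (@be_neq c).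
pose s := [seq bump y q | q <- iota 0 j.-1].
have ss : size s = j.-1 by rewrite size_map size_iota.
have us : uniq (s ++ [:: y; h; x; z]).
  have bs a : a \in s -> (a < x)%N && (a != y).
    move=> /mapP [q]; rewrite mem_iota /= add0n => qj ->.
    by rewrite /x eq_sym neq_bump andbT /bump; lia.
  rewrite cat_uniq map_inj_uniq ?iota_uniq; last exact: (can_inj (bumpK y)).
  apply/and3P; split => //; last by move: xz yz xy; rewrite /= !inE /z; lia.
  apply/hasPn => a; rewrite !inE => ah; apply/negP => /bs.
  by move: ah xz; rewrite /z; lia.
have sn : all (gtn n) s.
  apply/allP => a /mapP [q]; rewrite mem_iota /= add0n => qj ->.
  by have := xn; rewrite /x /bump; lia.
have sm q : (q < size s)%N -> (nth 0%N s q < m q)%N.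
  rewrite ss => qj; rewrite (nth_map 0%N) ?size_iota // nth_iota // add0n /bump.
  case: (leqP y q) => [yq|_] /=; rewrite ?add0n ?add1n; last by apply: m_gt; lia.
  have : (m j' <= m q)%N by apply: m_mono; move: yq; rewrite /y; lia.
  rewrite mj'; lia.
have hmJ : (h < m (size s).+1)%N by rewrite ss prednK.
have mlt a : (a < h)%N -> (a < m (size s))%N by rewrite ss.
(* The row [x] shares its block with at most one of [y] and [z]; one that it avoids serves as
   [e3]. *)
case: (eqVneq (be ex) (be ez)) => [bxz|nxz].
  apply: (@infinite_orbits_pair s ex ez ey eh) => //; try by apply: mlt; rewrite /= /z; lia.
  - by rewrite bxz eq_sym.
  - by apply: nh => /=; rewrite /z; lia.
  - by rewrite eq_sym.
  - by apply: nh => /=; rewrite /z; lia.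
  - by rewrite eq_sym (negPf (nh _ _)) //=; rewrite /y /z; lia.
apply: (@infinite_orbits_pair s ex ey ez eh) => //; try by apply: mlt; rewrite /= /z; lia.
- rewrite (perm_uniq (s2 := s ++ [:: y; h; x; z])) //= perm_cat2l.
  by apply/seq.permP => P /=; lia.
- by apply: nh => /=; rewrite /z; lia.
- by apply: nh => /=; rewrite /z; lia.
- by rewrite eq_sym (negPf (nh _ _)) //=; rewrite /y /z; lia.
Qed.
End Obstruction.

(** * Reduction to matrices with entries 0 and 1 *)

Definition zero_one {F : nzRingType} {p q : nat} (A : 'M[F]_(p, q)) :=
  forall i j, A i j = 0 \/ A i j = 1.

Section ZeroOne.
Context {F : numClosedFieldType}.

(** Its incidence group is the whole torus times the unitriangular group, for the order [f], on the
    indices in [A]; other coordinates are only rescaled. *)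
Definition active_rel p (A : pred 'I_p) (f : 'I_p -> nat) : rel 'I_p :=
  fun k l => (k == l) || [&& A k, A l & (f k < f l)%N].

Lemma active_rel_refl p A f : reflexive (@active_rel p A f).
Proof. by move=> i; rewrite /active_rel eqxx. Qed.

Lemma active_rel_trans p A f : transitive (@active_rel p A f).
Proof.
move=> j i k /orP [/eqP ->//|/and3P [Ai Aj ij]] /orP [/eqP <-|/and3P [_ Ak jk]].
  by rewrite /active_rel Ai Aj ij orbT.
by rewrite /active_rel Ai Ak (ltn_trans ij jk) orbT.
Qed.

Lemma upper_borelM n (b c : 'M[F]_n) : upper_borel b -> upper_borel c -> upper_borel (b *m c).
Proof. by have [_ _ M _] := upper_borel_subgroup (F := F) (n := n); apply: M. Qed.

Lemma upper_borelV n (b : 'M[F]_n) : upper_borel b -> upper_borel (invmx b).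
Proof. by have [_ _ _ V] := upper_borel_subgroup (F := F) (n := n); apply: V. Qed.

Lemma upper_borel1 n : upper_borel (1%:M : 'M[F]_n).
Proof. by case: (upper_borel_subgroup (F := F) (n := n)). Qed.

Lemma upper_borel_block p q (A : 'M[F]_p) X (D : 'M[F]_q) :
  upper_borel (block_mx A X 0 D) <-> upper_borel A /\ upper_borel D.
Proof.
rewrite !upper_borelE; split.
  move=> [G s]; move: G; rewrite /GL /= unitmxE det_ublock unitrM -!unitmxE => /andP [GA GD].
  split; split => // i j nz.
    by have := s (lshift q i) (lshift q j); rewrite block_mxEul => /(_ nz).
  by have := s (rshift p i) (rshift p j); rewrite block_mxEdr => /(_ nz); rewrite /= leq_add2l.
move=> [[GA sA] [GD sD]]; split; first by rewrite /GL /= unitmxE det_ublock unitrM -!unitmxE GA GD.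
move=> i j; rewrite !mxE; case: splitP => i' ->; rewrite !mxE; case: splitP => j' ->.
- exact: sA.
- by move=> _; apply: ltnW; apply: leq_trans (leq_addr _ _).
- by rewrite mxE eqxx.
- by move/sD; rewrite /= leq_add2l.
Qed.

Section ColumnMatrix.
Variables (p : nat) (i : 'I_p).

Let column_matrix (u : 'I_p -> F) : 'M[F]_p :=
  \matrix_(k, l) if l == i then u k else (k == l)%:R.

Let mul_column_matrix u q (B : 'M[F]_(p, q)) k j :
  (column_matrix u *m B) k j = (if k == i then 0 else B k j) + u k * B i j.
Proof.
rewrite mxE (bigD1 i) //= mxE eqxx addrC; congr (_ + _).
case: (eqVneq k i) => [->|ki].
  by apply: big1 => l li; rewrite mxE (negPf li) eq_sym (negPf li) mul0r.
rewrite (bigD1 k) //= mxE (negPf ki) eqxx mul1r big1 ?addr0 // => l /andP [li lk].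
by rewrite mxE (negPf li) eq_sym (negPf lk) mul0r.
Qed.

(** Elimination with pivot row [i]: as [f i] is maximal among the active nonzero entries, the group
    may add multiples of row [i] to the other rows concerned. A matrix whose row [i] is zero is
    unaffected. *)
Lemma clear_column (A : pred 'I_p) (f : 'I_p -> nat) (z : 'cV[F]_p) :
  {in A &, injective f} -> A i -> z i 0 != 0 ->
  (forall k, A k -> z k 0 != 0 -> (f k <= f i)%N) ->
  exists2 L : 'M[F]_p, incidence_group (active_rel A f) L &
    (forall q (B : 'M[F]_(p, q)), (forall j, B i j = 0) -> L *m B = B) /\
    forall k, A k -> (L *m z) k 0 = (k == i)%:R.
Proof.
move=> f_inj Ai zi zf.
pose u k := if k == i then (z i 0)^-1 else if A k then - (z k 0 / z i 0) else 0.
pose v k := if k == i then z i 0 else if A k then z k 0 else 0.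
exists (column_matrix u).
  split.
    have : column_matrix u *m column_matrix v = 1%:M.
      apply/matrixP => k l; rewrite mul_column_matrix !mxE /u /v.
      case: (eqVneq l i) => [->|li].
        rewrite eqxx; case: (eqVneq k i) => [_|ki]; first by rewrite add0r mulVf.
        by case: (A k); rewrite ?mul0r ?addr0 // mulNr divfK // subrr.
      rewrite mulr0 addr0; case: (eqVneq k i) => [->|//].
      by rewrite eq_sym (negPf li).
    by case/mulmx1_unit.
  move=> k l; rewrite mxE /active_rel; case: (eqVneq k l) => [//|kl] /=.
  case: (eqVneq l i) => [li|_]; last by rewrite eqxx.
  rewrite /u li; rewrite li in kl; rewrite (negPf kl) Ai.
  case: (boolP (A k)) => [Ak|_]; last by rewrite eqxx.
  rewrite oppr_eq0 mulf_eq0 negb_or => /andP [zk _] /=.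
  rewrite ltn_neqAle zf // andbT; apply: contra kl => /eqP /f_inj -> //.
split=> [q B B0|k Ak]; first apply/matrixP => k j; rewrite mul_column_matrix ?B0 ?mulr0 ?addr0.
  by case: (eqVneq k i) => [->|//]; rewrite B0.
rewrite /u; case: (eqVneq k i) => [_|ki]; first by rewrite add0r mulVf.
by rewrite Ak mulNr divfK // subrr.
Qed.
End ColumnMatrix.

Definition partial_permutation p q (A : pred 'I_p) (Q : 'M[F]_(p, q)) :=
  [/\ forall i j, A i -> Q i j = 0 \/ Q i j = 1,
      forall i j j', A i -> Q i j != 0 -> Q i j' != 0 -> j = j' &
      forall i i' j, A i -> A i' -> Q i j != 0 -> Q i' j != 0 -> i = i'].

(** Column by column. Column operations clear the last column in the active rows that already have a
    pivot; the remaining active row largest for [f] then clears the others, without harm to earlier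
    columns, where it is zero. *)
Lemma bruhat_reduction p q (A : pred 'I_p) (f : 'I_p -> nat) (Z : 'M[F]_(p, q)) :
  {in A &, injective f} ->
  exists L b, [/\ incidence_group (active_rel A f) L, upper_borel b &
    partial_permutation A (L *m Z *m b)].
Proof.
move=> f_inj; have [LG L1 LM LV] := incidence_subgroup (F := F)
  (@active_rel_refl p A f) (@active_rel_trans p A f).
elim: q Z => [|q IH] Z.
  by exists 1%:M, 1%:M; split => //; [exact: upper_borel1 | split => [i []|i []|i i' []]].
move: Z; rewrite -[q.+1]addn1 => Z.
have [K [b1 [HK Hb1 [P01 Prow Pcol]]]] := IH (lsubmx Z).
set Q := K *m lsubmx Z *m b1 in P01 Prow Pcol.
pose z1 := K *m rsubmx Z.
pose y : 'cV[F]_q := \col_j (if [pick i | A i && (Q i j != 0)] is Some i then - z1 i 0 else 0).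
pose z2 := Q *m y + z1.
pose b := block_mx b1 (b1 *m y) 0 1%:M.
have Bb : upper_borel b by apply/upper_borel_block; split => //; exact: upper_borel1.
have E : K *m Z *m b = row_mx Q z2.
  rewrite -[Z]hsubmxK mul_mx_row /b (mul_row_block (K *m _)) mulmx0 addr0 mulmx1.
  by rewrite /z2 /z1 /Q !mulmxA.
have Qone i j : A i -> Q i j != 0 -> Q i j = 1.
  by move=> Ai; case: (P01 i j Ai) => ->; rewrite ?eqxx.
have z20 i j : A i -> Q i j != 0 -> z2 i 0 = 0.
  move=> Ai Qij; rewrite mxE mxE (bigD1 j) //= big1 ?addr0; last first.
    move=> j' jj'; apply/eqP; rewrite mulf_eq0; apply/orP; left.
    by apply: contraR jj' => Qij'; apply/eqP/(Prow i).
  rewrite Qone // mul1r mxE; case: pickP => [i' /andP [Ai' Qi'j]|/(_ i)]; last by rewrite Ai Qij.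
  by rewrite (Pcol i' i j) // addNr.
case: (pickP (fun i => A i && (z2 i 0 != 0))) => [i0 Pi0|none].
  have [i /andP [Ai zi] imax] := @arg_maxnP _ i0 (fun i => A i && (z2 i 0 != 0)) f Pi0.
  have Q0 j : Q i j = 0.
    by apply/eqP/negPn/negP => /(z20 _ _ Ai) /eqP; apply/negP.
  have [k Ak zk|L HL [LB Lz]] := @clear_column p i A f z2 f_inj Ai zi.
    by apply: imax; rewrite Ak zk.
  exists (L *m K), b; split => //; first exact: LM.
  have -> : L *m K *m Z *m b = row_mx Q (L *m z2).
    by rewrite -!mulmxA (mulmxA K) E mul_mx_row LB.
  split.
  - move=> k j Ak; rewrite mxE; case: split => j'; first exact: P01.
    by rewrite ord1 Lz //; case: (k == i); [right | left].
  - move=> k j j' Ak; rewrite !mxE; case: splitP => l lE; case: splitP => l' lE' nz nz';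
      apply: ord_inj; rewrite lE lE' ?(ord1 l) ?(ord1 l') //.
    + by rewrite (Prow k l l').
    + by move: nz' nz; rewrite ord1 Lz //; case: (eqVneq k i) => [->|]; rewrite ?Q0 eqxx.
    + by move: nz nz'; rewrite ord1 Lz //; case: (eqVneq k i) => [->|]; rewrite ?Q0 eqxx.
  - move=> k k' j Ak Ak'; rewrite !mxE; case: split => l; first exact: Pcol.
    rewrite ord1 !Lz //; case: (eqVneq k i) => [->|]; last by rewrite eqxx.
    by case: (eqVneq k' i) => [->|]; rewrite ?eqxx.
have z0 i : A i -> z2 i 0 = 0 by move=> Ai; have := none i; rewrite Ai /= => /negbFE /eqP.
exists K, b; rewrite E; split => //; split.
- move=> k j Ak; rewrite mxE; case: split => j'; first exact: P01.
  by rewrite ord1 z0 //; left.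
- move=> k j j' Ak; rewrite !mxE; case: splitP => l lE; case: splitP => l' lE' nz nz';
    apply: ord_inj; rewrite lE lE'.
  + by rewrite (Prow k l l').
  + by move: nz'; rewrite ord1 z0 // eqxx.
  + by move: nz; rewrite ord1 z0 // eqxx.
  + by rewrite (ord1 l) (ord1 l').
- move=> k k' j Ak Ak'; rewrite !mxE; case: split => l; first exact: Pcol.
  by rewrite ord1 z0 // eqxx.
Qed.

(* Once the rows in [A] form a partial permutation matrix, rescaling the columns
   normalizes the remaining row, and rescaling the rows in [A] restores them. *)
Lemma zero_one_reduction p q (A : pred 'I_p) (f : 'I_p -> nat) (Z : 'M[F]_(p, q)) :
  {in A &, injective f} -> (forall i i', ~~ A i -> ~~ A i' -> i = i') ->
  exists L Q b, [/\ incidence_group (active_rel A f) L, zero_one Q, upper_borel b &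
    Z = L *m Q *m b].
Proof.
move=> f_inj A1; have [L [b [HL Hb [P01 Prow Pcol]]]] := bruhat_reduction Z f_inj.
have [LG L1 LM LV] := incidence_subgroup (F := F)
  (@active_rel_refl p A f) (@active_rel_trans p A f).
set Q := L *m Z *m b in P01 Prow Pcol; have QE : Q = L *m Z *m b by [].
clearbody Q.
pose y j : F := if [pick i | ~~ A i] is Some i then Q i j else 0.
pose s j : F := if y j == 0 then 1 else (y j)^-1.
pose t i : F := if [pick j | A i && (Q i j != 0)] is Some j then (s j)^-1 else 1.
have s0 j : s j != 0 by rewrite /s; case: (eqVneq (y j) 0) => [_|yj]; rewrite ?oner_eq0 ?invr_eq0.
have t0 i : t i != 0 by rewrite /t; case: pickP => *; rewrite ?oner_eq0 ?invr_eq0.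
pose T : 'M[F]_p := diag_mx (\row_i t i); pose S : 'M[F]_q := diag_mx (\row_j s j).
have diagu n (d : 'I_n -> F) : (forall i, d i != 0) -> diag_mx (\row_i d i) \in unitmx.
  move=> d0; rewrite unitmxE unitfE det_diag; apply/prodf_neq0 => i _.
  by rewrite mxE.
have HT : incidence_group (active_rel A f) T.
  split; first exact: diagu.
  by move=> i j; rewrite mxE; case: (eqVneq i j) => [->|_]; rewrite ?active_rel_refl ?eqxx.
have HS : upper_borel S.
  rewrite upper_borelE; split; first exact: diagu.
  by move=> i j; rewrite mxE; case: (eqVneq i j) => [->|_]; rewrite ?leqnn ?eqxx.
have TL := LM _ _ HT HL; have bS := upper_borelM Hb HS.
exists (invmx (T *m L)), (T *m Q *m S), (invmx (b *m S)); split.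
- exact: LV.
- move=> i j; have -> : (T *m Q *m S) i j = t i * Q i j * s j.
    by rewrite mul_mx_diag mul_diag_mx !mxE.
  case: (boolP (A i)) => [Ai|nAi].
    case: (eqVneq (Q i j) 0) => [->|Qij]; first by left; rewrite mulr0 mul0r.
    right; have Q1 : Q i j = 1 by case: (P01 i j Ai) Qij => ->; rewrite ?eqxx.
    rewrite /t; case: pickP => [j' /andP [_ Qij']|/(_ j)]; last by rewrite Ai Qij.
    by rewrite (Prow i j' j) // Q1 mulr1 mulVf.
  have yj : y j = Q i j.
    by rewrite /y; case: pickP => [i' nAi'|/(_ i)]; [rewrite (A1 i' i) | rewrite nAi].
  have -> : t i = 1 by rewrite /t; case: pickP => [j' /andP [Ai]|//]; rewrite Ai in nAi.
  rewrite mul1r /s yj; case: (eqVneq (Q i j) 0) => [->|Qij]; first by left; rewrite mul0r.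
  by right; rewrite mulfV.
- exact: upper_borelV.
- have [[GTL _] [GbS _]] := (TL, bS).
  have -> : T *m Q *m S = T *m L *m Z *m (b *m S) by rewrite QE !mulmxA.
  by rewrite mulmxA mulmxK // mulKmx.
Qed.
End ZeroOne.

(** * Normal forms with entries 0 and 1, stage by stage *)

Section Reducible.
Context {F : numClosedFieldType}.
Variables (m be f : nat -> nat).

(** With [m], [be] and [f] defined on [nat], the same data serve matrices of every intermediate size
    [h]. *)
Definition stage_borel h : set 'M[F]_h :=
  incidence_group (fun i j => (be i == be j) && (f i <= f j)%N).

Definition reducible h := forall g : 'M[F]_h, staircase m g ->
  exists L Q b, [/\ stage_borel L, zero_one Q, upper_borel b & g = L *m Q *m b].

Lemma stage_borel_subgroup h : subgroup (@stage_borel h).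
Proof.
apply: incidence_subgroup => [i|j i k] /=; first by rewrite eqxx leqnn.
by move=> /andP [/eqP -> l1] /andP [-> l2]; rewrite (leq_trans l1 l2).
Qed.

Lemma stage_borelM h (g g' : 'M[F]_h) :
  stage_borel g -> stage_borel g' -> stage_borel (g *m g').
Proof. by have [_ _ M _] := stage_borel_subgroup h; apply: M. Qed.

Lemma stage_borel_scalar h (c : F) : c != 0 -> stage_borel (c%:M : 'M[F]_h).
Proof.
move=> c0; split; last by apply: supported_scalar => i; rewrite /= eqxx leqnn.
by rewrite /GL /= unitmxE det_scalar unitrX // unitfE.
Qed.

Lemma stage_borel_block p q (L : 'M[F]_p) (K : 'M[F]_q) (A : pred 'I_q) :
  stage_borel L -> incidence_group (active_rel A (fun i => f (p + i))) K ->
  (forall k l, A k -> A l -> be (p + k) = be (p + l)) ->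
  stage_borel (block_mx L 0 0 K).
Proof.
move=> [GL_ sL] [GK sK] Abe; split.
  by rewrite /GL /= unitmxE det_ublock unitrM -!unitmxE [L \in _]GL_ [K \in _]GK.
move=> i j; rewrite !mxE; case: splitP => i' iE; rewrite !mxE; case: splitP => j' jE;
  rewrite iE jE ?mxE ?eqxx //.
- exact: sL.
- move/sK => /orP [/eqP ->|/and3P [Ai Aj /ltnW ->]]; first by rewrite eqxx leqnn.
  by rewrite (Abe _ _ Ai Aj) eqxx.
Qed.

Lemma zero_one_block p q r s (A : 'M[F]_(p, q)) (B : 'M_(p, s)) (C : 'M_(r, q)) D :
  zero_one A -> zero_one B -> zero_one C -> zero_one D -> zero_one (block_mx A B C D).
Proof.
by move=> zA zB zC zD i j; rewrite !mxE; case: split => i'; rewrite !mxE; case: split => j'.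
Qed.

Lemma zero_one0 p q : zero_one (0 : 'M[F]_(p, q)).
Proof. by move=> i j; rewrite mxE; left. Qed.

Lemma reducible0 : reducible 0.
Proof.
move=> g _; exists 1%:M, 1%:M, 1%:M; split; last by rewrite [LHS]flatmx0 [RHS]flatmx0.
- by case: (stage_borel_subgroup 0).
- by case.
- exact: upper_borel1.
Qed.

Lemma zero_one_block_sub p q r s (A : 'M[F]_(p, q)) (B : 'M_(p, s)) (C : 'M_(r, q)) D :
  zero_one (block_mx A B C D) -> [/\ zero_one A, zero_one B, zero_one C & zero_one D].
Proof.
move=> z; split=> i j.
- by have := z (lshift r i) (lshift s j); rewrite block_mxEul.
- by have := z (lshift r i) (rshift q j); rewrite block_mxEur.
- by have := z (rshift p i) (lshift s j); rewrite block_mxEdl.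
- by have := z (rshift p i) (rshift q j); rewrite block_mxEdr.
Qed.

(** The path meets the diagonal at [h], so [g] is block upper triangular. The diagonal blocks are
    reduced independently, and the upper right block is absorbed by the right factor. The index left
    out of [A] is meant for the last row of a ledge. *)
Lemma reducible_new_component h r (A : pred 'I_r) : reducible h ->
  (forall j, (j < h)%N -> (m j <= h)%N) ->
  (forall k l, A k -> A l -> be (h + k) = be (h + l)) ->
  (forall k l, ~~ A k -> ~~ A l -> k = l) ->
  {in A &, injective (fun i : 'I_r => f (h + i))} -> reducible (h + r).
Proof.
move=> red mh Abe A1 finj g [Gg sg].
have g0 : dlsubmx g = 0.
  apply/matrixP => i j; rewrite !mxE; apply: (supported_eq0 sg) => /=.
  by rewrite -leqNgt; apply: leq_trans (mh j _) (leq_addr _ _).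
have gE : g = block_mx (ulsubmx g) (ursubmx g) 0 (drsubmx g) by rewrite -g0 submxK.
move: Gg; rewrite /GL /= gE unitmxE det_ublock unitrM -!unitmxE => /andP [Gu Gd].
have [L [Q [b [HL Q01 Hb uE]]]] : exists L Q b,
    [/\ stage_borel L, zero_one Q, upper_borel b & ulsubmx g = L *m Q *m b].
  by apply: red; split => // i j; rewrite !mxE => /sg.
have [K [Q' [b' [HK Q'01 Hb' dE]]]] := zero_one_reduction (drsubmx g) finj A1.
have QU : L *m Q \in unitmx.
  by move: Gu; rewrite uE unitmx_mul => /andP [].
exists (block_mx L 0 0 K), (block_mx Q 0 0 Q'), (block_mx b (invmx (L *m Q) *m ursubmx g) 0 b').
split.
- exact: stage_borel_block HK Abe.
- by apply: zero_one_block => //; apply: zero_one0.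
- exact/upper_borel_block.
transitivity (block_mx (ulsubmx g) (ursubmx g) 0 (drsubmx g)) => //.
rewrite !mulmx_block !mul0mx !mulmx0 !addr0 !add0r -uE -dE.
by rewrite !mul0mx !addr0 add0r mulKVmx.
Qed.

Section Continue.
Variables (h r : nat).

(* [corner M] acts by [M] on the last [r + 1] coordinates. *)
Let corner (M : 'M[F]_(1 + r)) : 'M[F]_(h + 1 + r) :=
  block_mx (block_mx 1%:M 0 0 (ulsubmx M)) (col_mx 0 (ursubmx M))
    (row_mx 0 (dlsubmx M)) (drsubmx M).

Let cornerM M N : corner (M *m N) = corner M *m corner N.
Proof.
have E : M *m N = block_mx (ulsubmx M) (ursubmx M) (dlsubmx M) (drsubmx M) *m
   block_mx (ulsubmx N) (ursubmx N) (dlsubmx N) (drsubmx N) by rewrite !submxK.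
rewrite /corner E !mulmx_block !block_mxKul !block_mxKur !block_mxKdl !block_mxKdr.
rewrite mul_col_row mul_block_col !mul0mx !mulmx0 !mul1mx !add0r !addr0.
rewrite mul_row_block mul_mx_row mul_col_mx mul_row_col !mul0mx !mulmx0 !add0r.
by rewrite add_row_mx add_block_mx add_col_mx !add0r ?addr0.
Qed.

Let upper_corner b : upper_borel b -> upper_borel (corner b).
Proof.
move=> Hb; have b0 : dlsubmx b = 0.
  apply/matrixP => i j; rewrite !mxE; move: Hb; rewrite upper_borelE => -[_ sb].
  by apply: (supported_eq0 sb); rewrite /= (ord1 j).
move: Hb; rewrite -{1}[b]submxK b0 => /upper_borel_block [Hu Hd].
rewrite /corner b0 row_mx0; apply/upper_borel_block; split => //.
by apply/upper_borel_block; split => //; exact: upper_borel1.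
Qed.

(** Some standard basis vector lies outside the span of the [h] columns. *)
Let exists_complement (A : 'M[F]_(h + 1, h)) :
  (forall x : 'cV[F]_h, A *m x = 0 -> x = 0) ->
  exists v : 'cV[F]_(h + 1), row_mx A v \in unitmx.
Proof.
move=> A_inj; have [i ni] : exists i, ~~ (row i 1%:M <= A^T)%MS.
  apply: contrapT => /forallNP sub.
  have : (1%:M <= A^T)%MS by apply/row_subP => i; apply/negPn/negP/sub.
  move/mxrankS; rewrite mxrank1; have := rank_leq_row A^T; lia.
exists (delta_mx i 0); rewrite -unitmx_tr -row_free_unit tr_row_mx trmx_delta.
rewrite rowE mulmx1 in ni.
apply: inj_row_free => v; rewrite -[v]hsubmxK mul_row_col => E.
have v2 : rsubmx v = 0.
  apply/eqP/negPn/negP => v2; case/negP: ni.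
  have c0 : rsubmx v 0 0 != 0.
    apply: contra v2 => /eqP z; apply/eqP/matrixP => a b.
    by rewrite !ord1 z mxE.
  have -> : delta_mx 0 i = (- (rsubmx v 0 0)^-1) *: (lsubmx v *m A^T) :> 'rV_(h + 1).
    have -> : lsubmx v *m A^T = - (rsubmx v *m delta_mx 0 i).
      by apply/eqP; rewrite -addr_eq0 E.
    rewrite scalerN scaleNr opprK [rsubmx v]mx11_scalar mul_scalar_mx scalerA.
    by rewrite mxE eqxx mulr1n mulVf // scale1r.
  exact/scalemx_sub/submxMl.
move: E; rewrite v2 mul0mx addr0 => E.
suff -> : lsubmx v = 0 by rewrite row_mx0.
apply: trmx_inj; rewrite trmx0; apply: A_inj.
by apply: trmx_inj; rewrite trmx_mul trmxK E trmx0.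
Qed.

(** The valley at column [h] is at distance 1 from the diagonal. The first [h] columns, completed by
    one vector, form a matrix of the previous stage; what remains has size [1 + r]. *)
Lemma reducible_continue : reducible (h + 1) ->
  (forall j, (j < h)%N -> (m j <= h + 1)%N) -> (h < m h)%N ->
  (forall k l, (k < r)%N -> (l < r)%N -> be (h + 1 + k) = be (h + 1 + l)) ->
  {in gtn r &, injective (fun i => f (h + 1 + i))} -> reducible (h + 1 + r).
Proof.
move=> red mh mhh hbe finj g [Gg sg].
pose A := lsubmx (ulsubmx g); pose a := rsubmx (ulsubmx g); pose Y := ursubmx g.
pose w := rsubmx (dlsubmx g); pose Z := drsubmx g.
have W0 : lsubmx (dlsubmx g) = 0.
  apply/matrixP => i j; rewrite !mxE; apply: (supported_eq0 sg) => /=.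
  by rewrite -leqNgt; apply: leq_trans (mh j _) (leq_addr _ _).
have gE : g = block_mx (row_mx A a) Y (row_mx 0 w) Z.
  by rewrite -W0 !hsubmxK submxK.
have [x Ax|v Vu] := @exists_complement A.
  have : g *m col_mx (col_mx x 0) 0 = 0.
    rewrite gE mul_block_col !mul_row_col !mulmx0 mul0mx Ax !addr0 col_mx0 //.
  move/(congr1 (mulmx (invmx g))); rewrite mulKmx // mulmx0.
  by move/(congr1 (@usubmx _ _ _ _)); rewrite col_mxKu linear0 => /(congr1 (@usubmx _ _ _ _));
     rewrite col_mxKu linear0.
set V := row_mx A v in Vu.
have [L [Q [b [HL Q01 Hb VE]]]] : exists L Q b,
    [/\ stage_borel L, zero_one Q, upper_borel b & V = L *m Q *m b].
  apply: red; split => // i j; rewrite /V mxE; case: splitP => j' jE nz.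
    by rewrite jE; apply: (sg (lshift r i) (lshift r (lshift 1 j'))); rewrite !mxE in nz *.
  by rewrite jE (ord1 j') addn0; apply: leq_trans (ltn_ord i) _; rewrite addn1.
pose xa := invmx V *m a; pose xY := invmx V *m Y.
pose M1 : 'M[F]_(1 + r) := block_mx (dsubmx xa) (dsubmx xY) w Z.
pose U1 : 'M[F]_(h + 1 + r) :=
  block_mx (block_mx 1%:M (usubmx xa) 0 1%:M) (col_mx (usubmx xY) 0) 0 1%:M.
have gE1 : g = block_mx V 0 0 1%:M *m corner M1 *m U1.
  have VA : V *m col_mx 1%:M 0 = A by rewrite mul_row_col mulmx1 mulmx0 addr0.
  rewrite -mulmxA.
  have -> : corner M1 *m U1 = block_mx (block_mx 1%:M (usubmx xa) 0 (dsubmx xa))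
      xY (row_mx 0 w) Z.
    rewrite /corner /M1 !block_mxKul !block_mxKur !block_mxKdl !block_mxKdr.
    rewrite /U1 mulmx_block !mulmx0 !addr0 mulmx_block !mul1mx !mulmx1 !mul0mx !mulmx0.
    rewrite !addr0 !add0r mul_block_col mul_row_block mul_row_col !mul1mx !mul0mx !mulmx0.
    by rewrite !mulmx1 !addr0 !add0r add_col_mx add0r addr0 vsubmxK.
  rewrite mulmx_block !mul0mx !mul1mx !addr0 !add0r /xY mulKVmx // gE.
  congr (block_mx _ _ _ _); rewrite block_mxEh mul_mx_row VA vsubmxK /xa mulKVmx //.
have [c [cE Hc]] : exists c, c = b /\ upper_borel c by exists b.
pose la := drsubmx c.
have c0 : dlsubmx c = 0.
  apply/matrixP => i j; rewrite !mxE; move: Hc; rewrite upper_borelE => -[_ sc].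
  by apply: (supported_eq0 sc); rewrite /= (ord1 i) addn0 -ltnNge.
have cE' : b = block_mx (ulsubmx c) (ursubmx c) 0 la by rewrite -cE -c0 submxK.
(* Moving [b] to the right of [corner M1] costs only its last diagonal entry [la], in the first row
   of [M1]; the rest of [b] goes into [U2]. *)
pose M2 : 'M[F]_(1 + r) := block_mx (la *m dsubmx xa) (la *m dsubmx xY) w Z.
pose U2 : 'M[F]_(h + 1 + r) :=
  block_mx (block_mx (ulsubmx c) (ursubmx c *m dsubmx xa) 0 1%:M)
    (col_mx (ursubmx c *m dsubmx xY) 0) 0 1%:M.
have E2 : block_mx b 0 0 1%:M *m corner M1 = corner M2 *m U2.
  rewrite /corner /M1 /M2 !block_mxKul !block_mxKur !block_mxKdl !block_mxKdr /U2 cE'.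
  rewrite !mulmx_block !mul_block_col !mul_row_block !mul_row_col.
  rewrite !mul0mx !mulmx0 !mul1mx !mulmx1 ?addr0 ?add0r ?mul_mx_row ?mulmx0.
  by rewrite add_col_mx ?addr0 ?add0r.
(* Coordinate 0 of the corner belongs to the previous stage and may only be rescaled. *)
pose A1 : pred 'I_(1 + r) := fun i => i != 0.
have A1f : {in A1 &, injective (fun i : 'I_(1 + r) => f (h + i))}.
  move=> i j; rewrite !unfold_in /A1 => i0 j0 E; apply: ord_inj.
  have [i1 j1] : (0 < i)%N /\ (0 < j)%N by rewrite !lt0n; split.
  have iE : (h + 1 + i.-1 = h + i)%N by lia.
  have jE : (h + 1 + j.-1 = h + j)%N by lia.
  have li := ltn_ord i; have lj := ltn_ord j.
  have : i.-1 = j.-1 :> nat by apply: finj; rewrite ?unfold_in /= ?iE ?jE //; lia.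
  lia.
have A11 k l : ~~ A1 k -> ~~ A1 l -> k = l by rewrite /A1 !negbK => /eqP -> /eqP ->.
have [K [M0 [b2 [HK M01 Hb2 M2E]]]] := zero_one_reduction M2 A1f A11.
have [GK sK] := HK.
have lr (o : 'I_1) (i : 'I_r) : (lshift r o == rshift 1 i) = false.
  by apply/eqP => /(congr1 val) /=; rewrite (ord1 o) add1n.
have rl (o : 'I_1) (i : 'I_r) : (rshift 1 i == lshift r o) = false by rewrite eq_sym.
have Al (o : 'I_1) : A1 (lshift r o) = false.
  by apply/negbTE; rewrite negbK; apply/eqP/val_inj; rewrite (ord1 o).
have Kur : ursubmx K = 0.
  apply/matrixP => i j; rewrite !mxE; apply: (supported_eq0 sK).
  by rewrite /active_rel lr Al.
have Kdl : dlsubmx K = 0.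
  apply/matrixP => i j; rewrite !mxE; apply: (supported_eq0 sK).
  by rewrite /active_rel rl Al andbF.
pose mu := ulsubmx K 0 0; pose D := drsubmx K.
have KE : K = block_mx mu%:M 0 0 D by rewrite -mx11_scalar -Kur -Kdl submxK.
have mu0 : mu != 0.
  move: GK; rewrite /GL /= KE unitmxE det_ublock det_scalar expr1 unitrM unitfE.
  by case/andP.
have HD : stage_borel (block_mx mu%:M 0 0 D : 'M[F]_(h + 1 + r)).
  apply: (@stage_borel_block _ _ _ _ predT); first exact: stage_borel_scalar.
    split=> [|i j nz].
      by move: GK; rewrite /GL /= KE unitmxE det_ublock unitrM -!unitmxE => /andP [].
    have := sK (rshift 1 i) (rshift 1 j); rewrite {1}KE block_mxEdr => /(_ nz).
    rewrite /active_rel (inj_eq (@rshift_inj _ _)) => /orP [-> //|/and3P [_ _ lt]].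
    by move: lt; rewrite !addnA => ->; rewrite orbT.
  by move=> k l _ _; apply: hbe; apply: ltn_ord.
pose S : 'M[F]_(h + 1 + r) := block_mx (block_mx (mu^-1)%:M 0 0 1%:M) 0 0 1%:M.
have HS : upper_borel S.
  apply/upper_borel_block; split; last exact: upper_borel1.
  apply/upper_borel_block; split; last exact: upper_borel1.
  rewrite upper_borelE; split; last by apply: supported_scalar => i; rewrite /= leqnn.
  by rewrite /GL /= unitmxE det_scalar unitrX // unitfE invr_eq0.
have HL1 : stage_borel (block_mx L 0 0 1%:M : 'M[F]_(h + 1 + r)).
  apply: (@stage_borel_block _ _ _ _ pred0) => //; split; first exact: unitmx1.
  by apply: supported_scalar => i; rewrite /active_rel eqxx.
exists (block_mx L 0 0 1%:M *m block_mx mu%:M 0 0 D),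
  (block_mx Q 0 0 1%:M *m corner M0), (S *m corner b2 *m U2 *m U1).
(* The factor [mu] on the last column of [Q] becomes [mu] on all the old rows, undone on the first
   [h] columns by [S]. *)
have E3 : block_mx Q 0 0 1%:M *m corner K =
    block_mx mu%:M 0 0 D *m block_mx Q 0 0 1%:M *m S.
  rewrite KE /corner /S !block_mxKul !block_mxKur !block_mxKdl !block_mxKdr row_mx0 col_mx0.
  rewrite !mulmx_block !mul0mx !mulmx0 !mulmx1 !mul1mx ?addr0 ?add0r ?mulmx1.
  congr (block_mx _ _ _ _); last by rewrite mul0mx.
  rewrite -[Q]hsubmxK !mul_scalar_mx scale_row_mx !mul_row_block.
  rewrite !mulmx0 !addr0 !add0r !mulmx1 !mul_mx_scalar scalerA mulVf //.
  by rewrite scale1r.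
have E4 : S *m corner M0 = corner M0 *m S.
  rewrite /corner /S !mulmx_block !mul_block_col !mul_row_block.
  by rewrite !mul0mx !mulmx0 !mulmx1 !mul1mx !addr0 !add0r ?mulmx0 ?mul0mx.
have zo1 k (q' : 'cV[F]_(h + 1)) (e : 'rV[F]_k) :
    zero_one q' -> zero_one e -> zero_one (q' *m e).
  move=> zq ze i j; rewrite mxE big_ord1.
  by case: (zq i 0) => ->; rewrite ?mul0r ?mul1r; [left | exact: ze].
have zrow p0 q0 k (X : 'M[F]_(p0, q0)) (X' : 'M_(p0, k)) :
    zero_one X -> zero_one X' -> zero_one (row_mx X X').
  by move=> zX zX' i j; rewrite mxE; case: split.
(* [corner M0] changes only the last column of [Q], so the new blocks are a 0-1 column times a 0-1
   row and no sum of several terms arises. *)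
have E5 : block_mx Q 0 0 1%:M *m corner M0 = block_mx
    (row_mx (lsubmx Q) (rsubmx Q *m ulsubmx M0)) (rsubmx Q *m ursubmx M0)
    (row_mx 0 (dlsubmx M0)) (drsubmx M0).
  rewrite /corner mulmx_block !mul0mx !mul1mx !addr0 !add0r -{1 2}[Q]hsubmxK.
  by rewrite mul_row_block mul_row_col !mulmx0 mulmx1 !addr0 !add0r.
have [Hcu _] : upper_borel (ulsubmx c) /\ upper_borel la.
  by move: Hb; rewrite cE' => /upper_borel_block.
split.
- exact: stage_borelM.
- rewrite E5; have M0' := M01; rewrite -[M0]submxK in M0'.
  have [z1 z2 z3 z4] := zero_one_block_sub M0'.
  have zr : zero_one (rsubmx Q) by move=> i j; rewrite mxE.
  apply: zero_one_block => //; [|exact: zo1|by apply: zrow => //; exact: zero_one0].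
  by apply: zrow; [move=> i j; rewrite mxE | exact: zo1].
- apply: upper_borelM; [apply: upper_borelM; [apply: upper_borelM => // |]|].
  + exact: upper_corner.
  + apply/upper_borel_block; split; last exact: upper_borel1.
    by apply/upper_borel_block; split => //; exact: upper_borel1.
  + apply/upper_borel_block; split; last exact: upper_borel1.
    by apply/upper_borel_block; split => //; exact: upper_borel1.
have iM (X X' : 'M[F]_(h + 1)) : block_mx (X *m X') 0 0 1%:M =
    block_mx X 0 0 1%:M *m block_mx X' 0 0 1%:M :> 'M[F]_(h + 1 + r).
  by rewrite mulmx_block !mul0mx !mulmx0 mul1mx !addr0 !add0r.
rewrite gE1 VE !iM -!mulmxA (mulmxA _ (corner M1)) E2 M2E !cornerM.
rewrite !mulmxA; congr (_ *m _ *m _); rewrite -!mulmxA; congr (_ *m _).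
rewrite (mulmxA _ (corner K)) E3 -!mulmxA; congr (_ *m (_ *m _)).
by rewrite (mulmxA S) E4 -!mulmxA.
Qed.
End Continue.
End Reducible.

(** * Spherical Dyck paths and obstructions *)

Section Words.
Local Open Scope nat_scope.

Lemma size_subpath p a b : b <= size p -> size (subpath p a b) = b - a.
Proof. by move=> bp; rewrite size_drop size_takel. Qed.

Lemma nth_subpath p a b i : a + i < b -> nth North (subpath p a b) i = nth North p (a + i).
Proof. by move=> ib; rewrite nth_drop nth_take. Qed.

Lemma count_subpath (q : pred bool) p a b i : a + i <= b ->
  count q (take (a + i) p) = count q (take a p) + count q (take i (subpath p a b)).
Proof.
move=> ib; rewrite /subpath take_drop take_takel; last by rewrite addnC.
by rewrite -count_cat -[X in count _ (X ++ _)](take_takel p (leq_addl i a)) cat_take_drop addnC.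
Qed.

Lemma xcoord_subpath p a b i : a + i <= b ->
  xcoord p (a + i) = xcoord p a + xcoord (subpath p a b) i.
Proof. exact: count_subpath. Qed.

Lemma ycoord_subpath p a b i : a + i <= b ->
  ycoord p (a + i) = ycoord p a + ycoord (subpath p a b) i.
Proof. exact: count_subpath. Qed.

Lemma subpath_subpath p a b c d : a + d <= b ->
  subpath (subpath p a b) c d = subpath p (a + c) (a + d).
Proof.
move=> db; rewrite /subpath take_drop drop_drop take_takel; last by rewrite addnC.
by rewrite [c + a]addnC [d + a]addnC.
Qed.

Lemma run_decomposition (u : path_word) : exists n1 e1 r,
  u = nseq n1 North ++ nseq e1 East ++ r /\ (r = [::] \/ 0 < e1 /\ exists r', r = North :: r').
Proof.
elim: u => [|s u [n1 [e1 [r [uE rP]]]]]; first by exists 0, 0, [::]; split => //; left.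
case: s; first by exists n1.+1, e1, r; rewrite uE.
case: n1 uE => [|n1] uE.
  by exists 0, e1.+1, r; rewrite uE; split => //; case: rP => [->|[_ ?]]; [left | right].
by exists 0, 1, u; split => //; right; split => //; rewrite uE; eexists.
Qed.

(** The upper bound excludes the default value [North] of [nth] at the end of the word. *)
Definition valley (p : path_word) k :=
  [/\ 0 < k, k < size p, nth North p k.-1 = East & nth North p k = North].

Lemma elbow_valley t i : is_elbow t -> ~ valley t i.
Proof.
move=> [m [_ ->]] [i0 it]; rewrite !nth_cat !nth_nseq !size_nseq.
rewrite size_cat !size_nseq in it.
by do ?case: ifP => //; lia.
Qed.

Lemma ledge_valley t : is_ledge t -> exists i0, forall i, valley t i ->
  [/\ i = i0, i.+1 < size t & nth North t i.+1 = East].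
Proof.
move=> [m [a [b [a1 b2 abm ->]]]]; exists (m.-1 + a) => i [i0].
have st : size (nseq m.-1 North ++ nseq a East ++ North :: nseq b East) = m.-1 + a + b.+1.
  by rewrite !size_cat /= !size_nseq addnA.
rewrite st => it.
have nthE k : nth North (nseq m.-1 North ++ nseq a East ++ North :: nseq b East) k =
    ((k < m.-1) || (k == m.-1 + a) || (m.-1 + a + b < k)) :> bool.
  rewrite !nth_cat !size_nseq !nth_nseq.
  case: ltnP => [//|km] /=; case: ltnP => [ka|ka]; first by rewrite /East; lia.
  have [kE|kE] : k = m.-1 + a \/ m.-1 + a < k by lia.
    by rewrite kE addKn subnn eqxx /=.
  have -> : k - m.-1 - a = (k - m.-1 - a.+1).+1 by lia.
  by rewrite /= nth_nseq; case: ifP => h; rewrite /East /North; lia.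
by rewrite !nthE /North /East => h1 h2; split; lia.
Qed.

(** Cut at the last point before [k] and the first one after [k] that are weakly below the line; the
    level changes by one at each step, so both lie on the line. *)
Lemma component_around q r lo k hi : lo < k < hi -> hi <= size q ->
  ycoord q lo <= xcoord q lo + r -> xcoord q k + r < ycoord q k ->
  ycoord q hi <= xcoord q hi + r ->
  exists a b, [/\ lo <= a, a < k < b, b <= hi & is_component r q a b].
Proof.
move=> /andP [lok khi] hiq lo_le k_gt hi_le.
have step i : i < size q -> xcoord q i + r < ycoord q i ->
    ycoord q i.+1 <= xcoord q i.+1 + r -> ycoord q i.+1 = xcoord q i.+1 + r.
  by move=> iq; rewrite xcoordS // ycoordS //; case: (nth _ _ _) => /=; lia.
have step' i : i < size q -> ycoord q i <= xcoord q i + r ->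
    xcoord q i.+1 + r < ycoord q i.+1 -> ycoord q i = xcoord q i + r.
  by move=> iq; rewrite xcoordS // ycoordS //; case: (nth _ _ _) => /=; lia.
have [b /andP [kb b_le] b_min] :=
  @ex_minnP (fun b => (k < b) && (ycoord q b <= xcoord q b + r))
    (ex_intro _ hi (introT andP (conj khi hi_le))).
have bhi : b <= hi by apply: b_min; rewrite khi.
have [a /andP [ak a_le] a_max] :=
  @ex_maxnP (fun a => (a < k) && (ycoord q a <= xcoord q a + r)) k
    (ex_intro _ lo (introT andP (conj lok lo_le)))
    (fun a aP => ltnW (proj1 (andP aP))).
have gt i : a < i < b -> xcoord q i + r < ycoord q i.
  move=> /andP [ai ib]; rewrite ltnNge; apply/negP => i_le.
  case: (ltngtP i k) => [ik|ki|ik]; last by move: k_gt; rewrite -ik; lia.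
    by have := a_max i; rewrite ik i_le => /(_ isT); lia.
  by have := b_min i; rewrite ki i_le => /(_ isT); lia.
exists a, b; split => //; first by apply: a_max; rewrite lok.
  by rewrite ak.
split => //; first by lia.
  apply: step' => //; first by lia.
  by apply: gt; lia.
have b1 : b.-1.+1 = b by lia.
by rewrite -b1; apply: step; [lia | apply: gt; lia | rewrite b1].
Qed.

Lemma valley_subpath q a b k : a < k < b -> b <= size q ->
  valley (subpath q a b) (k - a) <-> valley q k.
Proof.
move=> /andP [ak kb] bq; rewrite /valley size_subpath //.
rewrite !nth_subpath; [|lia|lia].
have -> : a + (k - a) = k by lia.
have -> : a + (k - a).-1 = k.-1 by lia.
by split => -[*]; split => //; lia.
Qed.

Lemma xcoord_runs n1 e1 r :
  xcoord (nseq n1 North ++ nseq e1 East ++ r) (n1 + e1) = e1.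
Proof.
rewrite /xcoord catA take_size_cat ?size_cat ?size_nseq // count_cat !count_nseq /=.
by rewrite mul1n.
Qed.

Lemma ycoord_runs n1 e1 r :
  ycoord (nseq n1 North ++ nseq e1 East ++ r) (n1 + e1) = n1.
Proof.
rewrite /ycoord catA take_size_cat ?size_cat ?size_nseq // count_cat !count_nseq /=.
by rewrite mul1n addn0.
Qed.

Lemma nth_runs n1 e1 r i : i < n1 + e1 ->
  nth North (nseq n1 North ++ nseq e1 East ++ r) i = (i < n1) :> bool.
Proof.
move=> ie; rewrite nth_cat size_nseq nth_nseq; case: ltnP => // n1i.
by rewrite nth_cat size_nseq nth_nseq; case: ltnP => //; lia.
Qed.

Variables (n : nat) (p : path_word).
Hypothesis p_dyck : is_dyck_path n p.
Let m := column_height p.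
Let x := xcoord p.
Let y := ycoord p.

Let xS k : k < size p -> x k.+1 = x k + (nth North p k == East).
Proof. exact: xcoordS. Qed.
Let yS k : k < size p -> y k.+1 = y k + nth North p k.
Proof. exact: ycoordS. Qed.
Let xy k : k <= size p -> x k <= y k. Proof. by case: p_dyck => _ _; apply. Qed.
Let x_mono k l : k <= l -> x k <= x l. Proof. exact: xcoord_mono. Qed.
Let y_mono k l : k <= l -> y k <= y l. Proof. exact: ycoord_mono. Qed.
Let m_east k : k < size p -> nth North p k = East -> m (x k) = y k.
Proof. exact: column_height_east. Qed.

Let y_le k : y k <= n. Proof. by have [<- _ _] := p_dyck; apply: ycoord_le. Qed.

Let east_at j : j < n -> exists k, [/\ k < size p, nth North p k = East, x k = j & m j = y k].
Proof.
have [_ E _] := p_dyck; rewrite -E => /exists_east [k kp [pk xk]].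
by exists k; split => //; rewrite -m_east // /x xk.
Qed.

Lemma valley_ascent k : valley p k ->
  [/\ 0 < x k, x k < n, m (x k).-1 = y k & y k < m (x k)].
Proof.
move=> [k0 kp E N]; have k1 : k.-1.+1 = k by rewrite prednK.
have kp' : k.-1 < size p by lia.
have xk : x k = (x k.-1).+1 by rewrite -{1}k1 xS // E eqxx addn1.
have yk : y k = y k.-1 by rewrite -{1}k1 yS // E addn0.
have xn : x k < n.
  by have := xy (ltnW kp); have := y_le k.+1; rewrite yS // N /=; lia.
split=> //; first by rewrite xk.
  by rewrite xk /= m_east.
have [l [lp lE xl ->]] := east_at xn.
have kl : k < l.
  rewrite ltn_neqAle; apply/andP; split; first by apply: contraTneq isT => kl; rewrite -kl N in lE.
  rewrite leqNgt; apply/negP => lk; have := x_mono lk; rewrite xS // lE eqxx; lia.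
by have := y_mono kl; rewrite yS // N /=; lia.
Qed.

Lemma ascent_valley j : 0 < j < n -> m j.-1 < m j ->
  exists k, [/\ valley p k, x k = j & y k = m j.-1].
Proof.
move=> /andP [j0 jn] asc; have [|k [kp kE xk mk]] := @east_at j.-1; first by lia.
have xk1 : x k.+1 = j by rewrite xS // kE eqxx; lia.
have yk1 : y k.+1 = m j.-1 by rewrite yS // kE mk addn0.
have k1p : k.+1 < size p.
  rewrite ltn_neqAle kp andbT; apply/eqP => E; have [_ cE _] := p_dyck.
  by move: xk1; rewrite E /x /xcoord take_size cE; lia.
exists k.+1; split => //; split => //.
case pk : (nth North p k.+1) => //; have := m_east k1p pk; rewrite xk1 yk1; lia.
Qed.

Lemma height_at_least k : 0 < x k -> k <= size p -> m (x k).-1 <= y k.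
Proof.
move=> x0 kp; have xn : (x k).-1 < n by have := xy kp; have := y_le k; lia.
have [l [lp lE xl ->]] := east_at xn; apply: y_mono.
rewrite leqNgt; apply/negP => kl; have := x_mono (ltnW kl); lia.
Qed.

Lemma valley_north k : valley p k -> k.+1 < size p -> nth North p k.+1 = North ->
  (y k).+2 <= m (x k).
Proof.
move=> V k1p N1; have [k0 kp E N] := V; have [_ xn _ _] := valley_ascent V.
have [l [lp lE xl ->]] := east_at xn.
have kl : k.+1 < l.
  have lk : l <> k by move=> lk; rewrite lk N in lE.
  have lk1 : l <> k.+1 by move=> lk1; rewrite lk1 N1 in lE.
  suff : ~ l < k by lia.
  move=> llk; have := x_mono llk; rewrite xS // lE eqxx; lia.
by have := y_mono kl; rewrite !yS // N N1 /=; lia.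
Qed.

Lemma valley_east k : valley p k -> k.+1 < size p -> nth North p k.+1 = East ->
  m (x k) = (y k).+1.
Proof.
move=> [k0 kp E N] k1p E1; have := m_east k1p E1.
by rewrite xS // yS // N /= addn0 addn1.
Qed.

(** A ledge has a single valley, followed by exactly one North step. The valley [k] has level at
    least 2, so it lies inside a component of each of the two levels. Neither is an elbow, and the
    second North step or the second valley [k'] rules out the permitted ledges. *)
Lemma obstruction_not_spherical : obstruction n m -> ~ is_spherical_dyck_path p.
Proof.
move=> [j [jn asc jd alt]] sph; have [k [V xk yk]] := ascent_valley jn asc.
have [k0 kp E N] := V.
have second : ~ (k.+1 < size p /\ nth North p k.+1 = East) \/
    exists k', [/\ valley p k', k' < k & forall l, k' <= l <= k -> x l < y l].
  case: alt => [alt|[j' [jj' asc' mj' jd']]].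
    by left => -[k1p E1]; have := valley_east V k1p E1; rewrite xk yk; lia.
  right; have [|k' [V' xk' yk']] := @ascent_valley j' _ asc'; first by lia.
  have k'k : k' < k.
    rewrite ltnNge; apply/negP => /x_mono; rewrite xk xk'; lia.
  exists k'; split => // l /andP [k'l lk].
  have lx := x_mono lk; have ly := y_mono k'l.
  rewrite ltnNge; apply/negP => yx.
  have h : m (x l).-1 <= y l by apply: height_at_least; lia.
  have : m j' <= m (x l).-1 by apply: column_height_mono p_dyck _ _ _; lia.
  by rewrite mj'; lia.
have lev : x k + 1 < y k by rewrite xk yk; lia.
have szE : x (size p) = n /\ y (size p) = n.
  by have [cN cE _] := p_dyck; rewrite /x /y /xcoord /ycoord take_size.
have [|||||a [b [_ /andP [ak kb] _ C]]] := @component_around p 0 0 k (size p).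
- by rewrite k0 kp.
- by [].
- by rewrite /ycoord take0.
- by rewrite addn0; apply: leq_trans lev; rewrite addn1.
- by move: szE; rewrite /x /y; lia.
have [/andP [ab bp] la lb int] := C; rewrite addn0 in la lb.
have akb : a < k < b by rewrite ak.
have st := size_subpath a bp.
have Vt : valley (subpath p a b) (k - a) by apply/valley_subpath.
have after k' : k' < k -> (forall l, k' <= l <= k -> x l < y l) -> a < k'.
  move=> k'k lP; rewrite ltnNge; apply/negP => k'a.
  by have := lP a; rewrite k'a (ltnW ak) => /(_ isT); rewrite /x /y la; lia.
have [[El|Le]|comps] := sph a b C.
- exact: elbow_valley El Vt.
- have [i0 i0P] := ledge_valley Le; have [ki0 k1 E1] := i0P _ Vt.
  case: second => [[]|[k' [V' k'k lP]]].
    split; first by rewrite st in k1; lia.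
    by move: E1; rewrite nth_subpath; [congr (nth _ _ _ = _) |]; rewrite st in k1; lia.
  have ak' := after _ k'k lP.
  have Vt' : valley (subpath p a b) (k' - a) by apply/valley_subpath => //; lia.
  by have [] := i0P _ Vt'; lia.
have xt i : a + i <= b -> x (a + i) = x a + xcoord (subpath p a b) i by exact: xcoord_subpath.
have yt i : a + i <= b -> y (a + i) = y a + ycoord (subpath p a b) i by exact: ycoord_subpath.
have kE : a + (k - a) = k by lia.
have bE : a + (b - a) = b by lia.
have [|||||c [d [_ /andP [ck kd] dt D]]] :=
    @component_around (subpath p a b) 1 0 (k - a) (size (subpath p a b)).
- by rewrite st; lia.
- by [].
- by rewrite /xcoord /ycoord take0.
- have := xt (k - a); have := yt (k - a); rewrite kE => /(_ (ltnW kb)) e1 /(_ (ltnW kb)) e2.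
  by move: lev; rewrite e1 e2 /x /y la; lia.
- have := xt (b - a); have := yt (b - a); rewrite st bE => /(_ (leqnn _)) e1 /(_ (leqnn _)) e2.
  by move: lb; rewrite -/(x b) -/(y b) e1 e2 /x /y la; lia.
have ckd : c < k - a < d by rewrite ck.
have Vu : valley (subpath (subpath p a b) c d) (k - a - c) by apply/valley_subpath.
have [El|[Le c1]] := comps c d D; first exact: elbow_valley El Vu.
have [i0 i0P] := ledge_valley Le; have [ki0 k1 E1] := i0P _ Vu.
have dab : d <= b - a by rewrite -st.
rewrite size_subpath // in k1.
case: second => [[]|[k' [V' k'k lP]]].
  split; first by lia.
  move: E1; rewrite subpath_subpath; last by lia.
  by rewrite nth_subpath; [congr (nth _ _ _ = _) |]; lia.
have ak' := after _ k'k lP.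
(* A valley there would make step [a] East, whereas the component rises from the diagonal at [a]. *)
have k'a1 : k' <> a.+1.
  move=> k'a; have [_ _ Ek' _] := V'; move: Ek'; rewrite k'a /= => Ea.
  have := int a.+1; rewrite xcoordS ?ycoordS ?Ea /=; [|lia|lia].
  by rewrite -/(x a) -/(y a) /x /y la => /(_ ltac:(lia)); lia.
have Vt' : valley (subpath p a b) (k' - a) by apply/valley_subpath => //; lia.
have Vu' : valley (subpath (subpath p a b) c d) (k' - a - c).
  by apply/valley_subpath => //; lia.
by have [] := i0P _ Vu'; lia.
Qed.

(** The second alternative of [obstruction], read on the word: [m (x k') = y k] says that no valley
    lies between [k'] and [k]. *)
Lemma no_consecutive_valleys k' k : ~ obstruction n m -> valley p k' -> valley p k ->
  x k' < y k' -> m (x k') = y k -> x k + 1 < y k -> False.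
Proof.
move=> nob V' V lev' mE lev; have [x0' xn' m1' m2'] := valley_ascent V'.
have [x0 xn m1 m2] := valley_ascent V.
apply: nob; exists (x k); rewrite m1; split => //; [by rewrite x0 | lia|].
right; exists (x k'); rewrite m1'; split => //.
rewrite x0' /= ltnNge; apply/negP => /(column_height_mono p_dyck); rewrite -/m; lia.
Qed.

Lemma not_obstruction_spherical : ~ obstruction n m -> is_spherical_dyck_path p.
Proof.
move=> nob a b [/andP [ab bp] la lb int] t; right => c d [/andP [cd dt] lc ld intt].
rewrite addn0 in la lb.
have dab : a + d <= b by move: dt; rewrite size_subpath //; lia.
have tu : subpath t c d = subpath p (a + c) (a + d) by rewrite subpath_subpath.
have xt i : a + i <= b -> x (a + i) = x a + xcoord t i by exact: xcoord_subpath.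
have yt i : a + i <= b -> y (a + i) = y a + ycoord t i by exact: ycoord_subpath.
have xya : x a = y a by rewrite /x /y la.
rewrite tu; set al := a + c; set de := a + d.
have lal : y al = x al + 1 by rewrite /al xt ?yt ?lc; lia.
have lde : y de = x de + 1 by rewrite /de xt ?yt ?ld; lia.
have dep : de <= size p by rewrite /de; lia.
have inner i : al < i < de -> x i + 1 < y i.
  rewrite /al /de => ii; have iE : a + (i - a) = i by lia.
  have := intt (i - a); have := xt (i - a); have := yt (i - a); rewrite iE; lia.
set u := subpath p al de; have su : size u = de - al by rewrite size_subpath.
have ade : al < de by rewrite /al /de; lia.
have nu i : al + i < de -> nth North p (al + i) = nth North u i by move=> h; rewrite nth_subpath.
have xu i : al + i <= de -> x (al + i) = x al + xcoord u i by exact: xcoord_subpath.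
have yu i : al + i <= de -> y (al + i) = y al + ycoord u i by exact: ycoord_subpath.
have N0 : nth North p al = North.
  case pal : (nth North p al) => //.
  have alp : al < size p by lia.
  have x1 : x al.+1 = (x al).+1 by rewrite xS // pal addn1.
  have y1 : y al.+1 = y al by rewrite yS // pal addn0.
  case: (ltngtP al.+1 de) => [h|h|h]; [|lia|].
    by have := inner al.+1; rewrite leqnn h x1 y1 => /(_ isT); lia.
  by move: lde; rewrite -h x1 y1; lia.
have [n1 [e1 [r [uE rP]]]] := run_decomposition u.
have n1_gt : 0 < n1.
  rewrite lt0n; apply/eqP => n10; have := nu 0; rewrite addn0 => /(_ ade).
  rewrite N0 uE n10 /=; case: (posnP e1) => [e10|]; last by case: (e1).
  case: rP => [r0|[]]; last by rewrite e10.
  by move: su; rewrite uE n10 e10 r0 /=; lia.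
have su1 : size u = n1 + (e1 + size r) by rewrite uE !size_cat !size_nseq.
have xk : x (al + (n1 + e1)) = x al + e1.
  by rewrite xu ?uE ?xcoord_runs //; lia.
have yk : y (al + (n1 + e1)) = y al + n1.
  by rewrite yu ?uE ?ycoord_runs //; lia.
have unth i : i < n1 + e1 -> nth North p (al + i) = (i < n1) :> bool.
  by move=> ii; rewrite nu ?uE ?nth_runs //; lia.
case: rP => [r0|[e1_gt [r' rE]]].
  left; exists n1; split => //; rewrite uE r0 cats0.
  have E : al + (n1 + e1) = de by rewrite r0 /= addn0 in su1; lia.
  by move: xk yk; rewrite E => xk yk; have -> : e1 = n1 by lia.
right; set k := al + (n1 + e1) in xk yk.
have kde : k < de by rewrite /k; rewrite rE /= in su1; lia.
have Ek : nth North p k.-1 = East.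
  have -> : k.-1 = al + (n1 + e1).-1 by rewrite /k; lia.
  by rewrite unth; [apply/negbTE; lia | lia].
have Nk : nth North p k = North.
  by rewrite /k nu // uE rE !nth_cat !size_nseq ltnNge leq_addr /= addKn ltnn subnn.
have kdep : k < size p by lia.
have V : valley p k by split => //; rewrite /k; lia.
have lev : x k + 1 < y k by apply: inner; rewrite /k; lia.
have k1de : k.+1 < de.
  rewrite ltn_neqAle kde andbT; apply/eqP => E; move: lde; rewrite -E xS // yS // Nk /=; lia.
have k1p : k.+1 < size p by lia.
have E1 : nth North p k.+1 = East.
  case pk : (nth North p k.+1) => //; case: nob.
  have [x0 xn m1 m2] := valley_ascent V; have := valley_north V k1p pk.
  by exists (x k); rewrite m1; split => //; [rewrite x0 | lia | left].
(* Otherwise the starting point [al] is itself a valley, at level 1, and [k] is the next one. *)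
have c1 : c = 1.
  have c0 : c <> 0 by move=> c0; move: lc; rewrite c0 /xcoord /ycoord take0.
  case: (ltngtP c 1) => [|c1|//]; first by lia.
  have al1 : al.-1.+1 = al by rewrite /al; lia.
  have alp : al.-1 < size p by lia.
  have lal1 : x al.-1 < y al.-1.
    by have := int al.-1; rewrite addn0; apply; rewrite /al; lia.
  have Eal : nth North p al.-1 = East.
    case pal : (nth North p al.-1) => //; move: lal.
    by rewrite -{1 2}al1 xS // yS // pal /=; lia.
  have Val : valley p al by split => //; rewrite ?N0 // /al; lia.
  have kn : al + n1 < size p by rewrite /k in kdep; lia.
  have En : nth North p (al + n1) = East by rewrite unth ?ltnn //; lia.
  exfalso; apply: (@no_consecutive_valleys al k nob Val V) => //; first by lia.
  have xn1 : x (al + n1) = x al.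
    have := xu n1; rewrite uE => -> //; last by rewrite /k in kde; lia.
    by rewrite /xcoord take_size_cat ?size_nseq // count_nseq /= mul0n addn0.
  rewrite -xn1 m_east // yk yu; last by rewrite /k in kde; lia.
  by rewrite uE /ycoord take_size_cat ?size_nseq // count_nseq /= mul1n.
split => //.
have [n2 [e2 [r2 [r'E r2P]]]] := run_decomposition r'.
have sr' : size u = n1 + (e1 + (size r').+1) by rewrite su1 rE.
have nr' i : k.+1 + i < de -> nth North p (k.+1 + i) = nth North r' i.
  move=> ii; have -> : k.+1 + i = al + (n1 + (e1 + i.+1)) by rewrite /k; lia.
  rewrite nu; last by rewrite /k in ii; lia.
  rewrite uE rE !nth_cat !size_nseq ltnNge leq_addr /= addKn ltnNge leq_addr /= addKn.
  by [].
have n20 : n2 = 0.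
  apply/eqP; rewrite -leqn0 leqNgt; apply/negP => n2_gt.
  by have := nr' 0; rewrite addn0 E1 r'E => /(_ k1de); case: (n2) n2_gt.
rewrite n20 /= in r'E.
have xr i : i <= e2 -> k.+1 + i <= de -> x (k.+1 + i) = x k + i /\ y (k.+1 + i) = y k + 1.
  elim: i => [|i IH] ie ki.
    by rewrite addn0 xS // yS // Nk /= !addn0.
  have [||xi yi] := IH; [lia | lia|].
  have pi : nth North p (k.+1 + i) = East.
    rewrite nr'; last by lia.
    by rewrite r'E nth_cat size_nseq nth_nseq; case: ltnP => //; lia.
  have ip : k.+1 + i < size p by lia.
  by rewrite addnS xS // yS // pi xi yi /=; lia.
have sr2 : k.+1 + (e2 + size r2) = de.
  have : size r' = e2 + size r2 by rewrite r'E size_cat size_nseq.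
  by rewrite /k; lia.
case: r2P => [r20|[e2_gt [r2' r2E]]].
  rewrite r20 /= addn0 in sr2.
  have [||xe ye] := xr e2; [by [] | by lia|].
  rewrite sr2 in xe ye.
  (* [k] has level at least 2 and one more North step follows, so returning to level 1 takes
     [e2 >= 2] East steps. *)
  exists n1.+1, e1, e2; split => //=; [by lia | by lia|].
  by rewrite uE rE r'E r20 cats0.
exfalso; rewrite r2E /= in sr2.
set k2 := k.+1 + e2; have k2de : k2 < de by rewrite /k2; lia.
have [||xe ye] := xr e2; [by [] | by lia|].
have V2 : valley p k2.
  split; [by rewrite /k2; lia | by lia| |].
    have -> : k2.-1 = k.+1 + e2.-1 by rewrite /k2; lia.
    rewrite nr'; last by lia.
    by rewrite r'E nth_cat size_nseq nth_nseq; case: ltnP => //; lia.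
  by rewrite /k2 nr' // r'E r2E nth_cat size_nseq ltnn subnn.
apply: (@no_consecutive_valleys k k2 nob V V2); first by lia.
  by rewrite (valley_east V k1p E1) /k2 ye addn1.
by apply: inner; rewrite /k2 /k in k2de *; lia.
Qed.
End Words.

(** * Building the staircase of a path without obstruction *)

Section Stages.
Context {F : numClosedFieldType}.
Variables (n : nat) (m f : nat -> nat).
Hypothesis m_mono : forall i j, (i <= j)%N -> (m i <= m j)%N.
Hypothesis m_gt : forall i, (i < n)%N -> (i < m i)%N.
Hypothesis m_le : forall i, (m i <= n)%N.
Hypothesis f_inj : forall i j, (i < n)%N -> (j < n)%N -> f i = f j -> i = j.

Definition row_block (i : nat) : nat := #|[set c : 'I_n | m c <= i]%N|%SET.

Lemma row_block_eq j h i k : (forall c, (c < j)%N -> (m c <= h)%N) ->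
  (h <= i < m j)%N -> (h <= k < m j)%N -> row_block i = row_block k.
Proof.
move=> mh ij kj; apply: eq_card => c; rewrite !finset.in_set.
by case: (ltnP c j) => [/mh|/m_mono]; lia.
Qed.

Let first_column j := exists j', [/\ (j' <= j)%N, m j' = m j & (j' = 0 \/ m j'.-1 < m j')%N].

Let first_columnP j : first_column j.
Proof.
have [j' /eqP mj' min] := @ex_minnP (fun i => m i == m j) (ex_intro _ j (eqxx _)).
exists j'; split => //; first by apply: min.
case: (posnP j') => [->|j0]; [by left | right].
rewrite ltn_neqAle m_mono ?leq_pred // andbT; apply/eqP => E.
by have := min j'.-1; rewrite E mj' eqxx => /(_ isT); lia.
Qed.

(* The stages are the heights [h] of the peaks of the path; [j] is the first column
   of height larger than [h]. *)
Let stage j := if j is j'.+1 then m j' else 0%N.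

Let stage_ge j : (j <= n)%N -> (j <= stage j)%N.
Proof. by case: j => // j; apply: m_gt. Qed.

Let stage_le j : (stage j <= n)%N. Proof. by case: j => [|j]; [|exact: m_le]. Qed.

Let below_stage j c : (c < j)%N -> (m c <= stage j)%N.
Proof. by case: j => // j cj; apply: m_mono. Qed.

(** The next peak starts at the valley [(j', stage j')]. On the diagonal or at distance 1 the
    previous stage is extended. Farther away the path must form a ledge, and the stage is rebuilt
    from the point of the diagonal where the ledge starts. *)
Lemma reducible_stages : ~ obstruction n m -> reducible (F := F) m row_block f n.
Proof.
move=> nob; suff : forall j, (j <= n)%N -> reducible (F := F) m row_block f (stage j).
  move=> /(_ n (leqnn n)); have -> // : stage n = n.
  by apply/eqP; rewrite eqn_leq stage_le stage_ge.
move=> j; elim/ltn_ind: j => -[_ _|j IH jn]; first exact: reducible0.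
have [j' [j'j mj' asc]] := first_columnP j.
have j'n : (j' <= n)%N by lia.
have red' : reducible (F := F) m row_block f (stage j') by apply: IH; lia.
have hE : stage j.+1 = m j' by rewrite mj'.
have hlt : (stage j' <= m j')%N.
  by case: asc => [->//|]; case: (j') => //= i; apply: ltnW.
have hn : (m j' <= n)%N := m_le j'.
have fi h r : (h + r <= n)%N -> {in gtn r &, injective (fun i => f (h + i))}.
  by move=> hr i k; rewrite !unfold_in /= => ir kr /f_inj; lia.
rewrite hE; have := stage_ge j'n; rewrite leq_eqVlt => /predU1P [jE|].
  have -> : m j' = (stage j' + (m j' - stage j'))%N by lia.
  apply: (@reducible_new_component _ _ _ _ _ _ predT) => //.
  - by move=> c cj; apply: below_stage; rewrite jE.
  - move=> k l _ _; have := ltn_ord k; have := ltn_ord l => lk ll.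
    by apply: (@row_block_eq j' (stage j')); [exact: below_stage | lia | lia].
  - move=> k l _ _ E; apply: ord_inj.
    by apply: (fi (stage j') (m j' - stage j')%N) E; rewrite ?unfold_in //=; lia.
rewrite leq_eqVlt => /predU1P [jE|jd].
  have jE' : (stage j' = j' + 1)%N by rewrite -jE addn1.
  have -> : m j' = (j' + 1 + (m j' - stage j'))%N by lia.
  apply: reducible_continue.
  - by rewrite -jE'.
  - by move=> c cj; rewrite -jE'; apply: below_stage.
  - by apply: m_gt; have := stage_le j'; lia.
  - move=> k l kr lr.
    by apply: (@row_block_eq j' (stage j')); [exact: below_stage | lia | lia].
  - by apply: fi; lia.
have j'0 : (0 < j')%N by rewrite lt0n; apply/eqP => z; rewrite z in jd.
have sE : stage j' = m j'.-1 by case: (j') j'0.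
have asc' : (m j'.-1 < m j')%N by case: asc => // z; rewrite z in j'0.
have j'lt : (j' < n)%N by have := stage_le j'; lia.
have hS : m j' = (stage j').+1.
  apply/eqP; rewrite eqn_leq; apply/andP; split; last by rewrite sE.
  rewrite leqNgt; apply/negP => gt; apply: nob; exists j'; rewrite -sE.
  by split; [rewrite j'0 | rewrite sE | | left].
(* [j2] is the first column of the previous peak; if that peak did not start on the diagonal, its
   valley would give the second alternative of [obstruction]. *)
have [j2 [j2j mj2 asc2]] := first_columnP j'.-1.
have j2E : stage j2 = j2.
  case: asc2 => [->//|asc2]; have j20 : (0 < j2)%N.
    by rewrite lt0n; apply/eqP => z; rewrite z ltnn in asc2.
  have s2 : stage j2 = m j2.-1 by case: (j2) j20.
  apply/eqP; rewrite eqn_leq stage_ge ?andbT; last by lia.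
  rewrite s2 leqNgt; apply/negP => gt; apply: nob; exists j'; rewrite -sE.
  split; [by rewrite j'0 | by rewrite sE | by [] | right].
  by exists j2; split => //; [lia | rewrite mj2 sE].
have red2 : reducible (F := F) m row_block f j2 by rewrite -j2E; apply: IH; lia.
have lt2 : (j2 < stage j')%N by rewrite sE -mj2; apply: m_gt; lia.
have -> : m j' = (j2 + (m j' - j2))%N by lia.
(* All rows up to the previous peak form one block and are active; the inactive one is the row added
   by the ledge. *)
apply: (@reducible_new_component _ _ _ _ _ _ (fun k => k < stage j' - j2)%N) => //.
- by move=> c cj; have := below_stage cj; rewrite j2E.
- move=> k l kA lA.
  apply: (@row_block_eq j2 (stage j2)); [exact: below_stage | |];
  by rewrite j2E mj2 -sE; lia.
- by move=> k l; rewrite -!leqNgt => kA lA; apply: ord_inj; have := ltn_ord k; have := ltn_ord l; lia.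
- move=> k l _ _ E; apply: ord_inj; have := ltn_ord k; have := ltn_ord l => lk ll.
  by apply: (fi j2 (m j' - j2)%N) E; rewrite ?unfold_in //=; lia.
Qed.
End Stages.

(** Every orbit contains the class of a 0-1 matrix, and these are encoded by the finite type of
    boolean matrices. *)
Lemma reducible_finitely_many_orbits {F : numClosedFieldType} (n : nat) (m be f : nat -> nat) :
  reducible (F := F) m be f n ->
  finitely_many_orbits (@stage_borel F be f n)
    [set translate g upper_borel | g in (staircase m : set 'M[F]_n)].
Proof.
move=> red; pose K : set 'M[F]_n := @stage_borel F be f n.
pose o (Q : 'M[bool]_n) :=
  orbit_of K (translate (map_mx (fun c : bool => c%:R : F) Q) upper_borel).
apply: (@sub_finite_set _ _ (o @` setT)); last exact/finite_image/finite_finset.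
move=> _ [_ [g Sg <-] <-]; have [L [Q [b [HL Q01 Hb E]]]] := red g Sg.
exists (map_mx (fun c => c == 1) Q) => //.
have -> : o (map_mx (fun c => c == 1) Q) = orbit_of K (translate Q upper_borel).
  rewrite /o; congr (orbit_of _ (translate _ _)); apply/matrixP => i j; rewrite !mxE.
  by case: (Q01 i j) => ->; rewrite ?eqxx // eq_sym oner_eq0.
have [KG K1 KM KV] := stage_borel_subgroup (F := F) be f n.
rewrite E translate_borel // -translateM; apply/seteqP; split => _ [h Kh <-].
  exists (h *m invmx L); first by apply: KM => //; apply: KV.
  by rewrite !translateM mulmxKV //; apply: KG.
by exists (h *m L); [apply: KM | rewrite !translateM ?mulmxA].
Qed.

Theorem theorem1p4 (R : realType) (n : nat) (w : 'S_n) (p : path_word)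
    (L BL : set 'M[complex R]_n)
    (w_avoids : avoids_312 w)
    (p_dyck : is_dyck_path n p)
    (p_w : bandlow_killpatrick n p = w)
    (L_levi : is_levi_subgroup (stabilizer (schubert_variety w)) L)
    (L_torus : subset diagonal_torus L)
    (BL_borel : is_borel_subgroup L BL)
    (BL_torus : subset diagonal_torus BL) :
  finitely_many_orbits BL (schubert_variety w) <-> is_spherical_dyck_path p.
Proof.
pose m := column_height p.
have m_mono := column_height_mono p_dyck.
have m_gt := column_height_gt p_dyck.
have m_le := column_height_le p_dyck.
have w_lt k : (w k < m k)%N by rewrite -p_w; apply: bandlow_killpatrick_lt.
have w_max (j : 'I_n) : exists2 i : 'I_n, (i <= j)%N & (w i).+1 = m j.
  by rewrite -p_w; apply: bandlow_killpatrick_max.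
rewrite (stabilizer_schubert m_mono m_gt w_lt w_max w_avoids) in L_levi.
have LE := levi_eq_block_levi L_levi L_torus; rewrite LE in BL_borel.
have [f f_inj BLE] := borel_eq_block_borel BL_borel BL_torus.
rewrite (schubert_varietyE m_mono w_lt w_max w_avoids) BLE.
split=> [fin|sph].
  apply: (not_obstruction_spherical p_dyck) => ob.
  exact: (obstruction_infinitely_many_orbits m_mono m_gt m_le f_inj ob fin).
(* Extension to [nat], as the stages require; only the values below [n] matter. *)
pose f' i := if insub i is Some o then f o else 0%N.
have f'E (i : 'I_n) : f' i = f i by rewrite /f' valK.
have f'_inj i j : (i < n)%N -> (j < n)%N -> f' i = f' j -> i = j.
  by move=> ilt jlt; rewrite (f'E (Ordinal ilt)) (f'E (Ordinal jlt)) => /f_inj [].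
have nob : ~ obstruction n m by move/(obstruction_not_spherical p_dyck).
have := reducible_finitely_many_orbits
  (@reducible_stages (complex R) n m f' m_mono m_gt m_le f'_inj nob).
suff -> : @stage_borel (complex R) (row_block n m) f' n = block_borel (column_block m) f by [].
by apply/seteqP; split => g [Gg sg]; split => // i j /sg; rewrite !f'E.
Qed.
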